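(* Let $H=\bigoplus_{n\ge 0}H(n)$ be a coradically graded Hopf algebra with coradical $H_0=H(0)$. If $X_0$ is a complete set of AM-exact $H_0$-equivariant Morita equivalence class representatives, then every Loewy-graded, AM-exact $H$-comodule algebra is $H$-equivariant Morita equivalent to an element of $$X:=\{A : A \text{ is a Loewy-graded } H\text{-comodule algebra with } A(0) \text{ isomorphic (as an } H_0\text{-comodule algebra) to an element of } X_0\}.$$
   Context: Throughout, $\Bbbk$ is an algebraically closed field of characteristic zero; Hopf algebras, modules, comodules and comodule algebras are finite-dimensional over $\Bbbk$. For an algebra $A$, ${}_A\mathcal{M}$ is the category of finite-dimensional left $A$-modules. Coradically graded: $H=\bigoplus_{n\ge0}H(n)$ is a graded Hopf algebra whose coradical filtration $\{H_n\}$ is $H_n=\bigoplus_{i=0}^nH(i)$; in particular the coradical $H_0=H(0)$ is a Hopf subalgebra. $H$-comodule algebra: an algebra $A$ with a left coaction $\lambda:A\to H\otimes A$, $\lambda(a)=a_{(-1)}\otimes a_{(0)}$, that is an algebra morphism. $A$ has trivial coinvariants if $A^{\mathrm{co}H}=\{a:\lambda(a)=1\otimes a\}$ is one-dimensional. $A$ is right $H$-simple if it has no right ideals $J$ with $\lambda(J)\subseteq H\otimes J$ other than $0$ and $A$. $A$ is AM-exact if it is right $H$-simple with trivial coinvariants. The same terminology is used with $H_0$ in place of $H$. Loewy-graded: an $H$-comodule algebra $A$ with an algebra grading $A=\bigoplus_{n\ge0}A(n)$ such that $\lambda^{-1}(H_n\otimes A)=\bigoplus_{i=0}^nA(i)$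 and $\lambda(A(n))\subseteq\bigoplus_{i=0}^nH(i)\otimes A(n-i)$ for all $n$. Then $A(0)$ is an $H_0$-comodule algebra. Morita equivalence: for an $H$-comodule algebra $A$, ${}_A\mathcal{M}$ is a left module category over the tensor category ${}_H\mathcal{M}$: for $X\in{}_H\mathcal{M}$, $M\in{}_A\mathcal{M}$, the object $X\otimes_\Bbbk M$ has action $a\cdot(x\otimes m)=a_{(-1)}x\otimes a_{(0)}m$. Two $H$-comodule algebras $A,B$ are $H$-equivariant Morita equivalent, $A\simeq_HB$, if ${}_A\mathcal{M}$ and ${}_B\mathcal{M}$ are equivalent as ${}_H\mathcal{M}$-module categories. A module category $\mathcal{N}$ over a finite tensor category $\mathcal{C}$ is exact if $P\otimes N$ is projective for every projective $P\in\mathcal{C}$ and every $N\in\mathcal{N}$; it is indecomposable if it is not equivalent to a direct sum of two nontrivial module categories. A complete set of AM-exact $H_0$-equivariant Morita equivalence class representatives is a set $X_0$ of AM-exact $H_0$-comodule algebras such that every exact indecomposable ${}_{H_0}\mathcal{M}$-module category is equivalent to ${}_A\mathcal{M}$ for some $A\in X_0$. *)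

(* Defs.v *)
From HB Require Import structures.
From mathcomp Require Import all_boot all_order all_algebra all_field.

Set Implicit Arguments.
Unset Strict Implicit.
Unset Printing Implicit Defensive.

Import GRing.Theory.
Local Open Scope ring_scope.

Section Tensor.
Variable k : fieldType.
Import VectorInternalTheory.
Implicit Types U V W X Y Z : vectType k.

Definition bilin (U V W : lmodType k) (f : U -> V -> W) : Prop :=
  (forall v, linear (f^~ v)) /\ (forall u, linear (f u)).

Lemma linfun_linear V W (f : V -> W) : linear f -> linfun f =1 f.
Proof.
move=> lf v.
pose mf := GRing.isSemilinear.Build k V W _ f (GRing.semilinear_linear lf).
pose g : {linear V -> W} := HB.pack f mf.
exact: (lfunE g).
Qed.

(* U (x) V is realised by coordinate matrices: [u \ox v] has entries u_i v_j.
   It is only used through its universal property ([tlift], [tliftE], [tens_ext]). *)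
Definition tens U V : vectType k := 'M[k]_(dim U, dim V).

Definition tpure U V (u : U) (v : V) : tens U V :=
  (v2r u)^T *m v2r v.

Local Notation "u \ox v" := (tpure u v) (at level 40, left associativity).

Definition tbasis V (i : 'I_(dim V)) : V :=
  r2v (delta_mx 0 i).

Definition tlift U V W (f : U -> V -> W) : 'Hom(tens U V, W) :=
  linfun (fun t : 'M[k]_(dim U, dim V) =>
    \sum_i \sum_j t i j *: f (tbasis i) (tbasis j)).

Lemma tpurePl U V c (u u' : U) (v : V) :
  (c *: u + u') \ox v = c *: (u \ox v) + u' \ox v.
Proof. by rewrite /tpure !linearP mulmxDl scalemxAl. Qed.

Lemma tpurePr U V c (u : U) (v v' : V) :
  u \ox (c *: v + v') = c *: (u \ox v) + u \ox v'.
Proof. by rewrite /tpure !linearP. Qed.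

Lemma tpure0l U V (v : V) : (0 : U) \ox v = 0.
Proof. by rewrite /tpure linear0 trmx0 mul0mx. Qed.

Lemma tpure0r U V (u : U) : u \ox (0 : V) = 0.
Proof. by rewrite /tpure linear0 mulmx0. Qed.

Lemma tpureZl U V c (u : U) (v : V) : (c *: u) \ox v = c *: (u \ox v).
Proof. by rewrite -[c *: u]addr0 tpurePl tpure0l addr0. Qed.

Lemma tpureZr U V c (u : U) (v : V) : u \ox (c *: v) = c *: (u \ox v).
Proof. by rewrite -[c *: v]addr0 tpurePr tpure0r addr0. Qed.

Lemma tpure_bilin U V : bilin (@tpure U V).
Proof. by split=> [v c u u'|u c v v']; rewrite ?tpurePl ?tpurePr. Qed.

Lemma tlift_sum U V W (f : U -> V -> W) (t : 'M[k]_(dim U, dim V)) :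
  tlift f t = \sum_i \sum_j t i j *: f (tbasis i) (tbasis j).
Proof.
rewrite /tlift linfun_linear // => c s s'.
rewrite scaler_sumr -big_split; apply: eq_bigr => i _.
rewrite scaler_sumr -big_split; apply: eq_bigr => j _.
by rewrite /= !mxE scalerDl scalerA.
Qed.

Lemma linear_sumZ V W (f : V -> W) (I : finType) (c : I -> k) (b : I -> V) :
  linear f -> f (\sum_i c i *: b i) = \sum_i c i *: f (b i).
Proof.
move=> lf; rewrite -(linfun_linear lf) linear_sum.
by apply: eq_bigr => i _; rewrite linearZ /= linfun_linear.
Qed.

Lemma tbasis_sum V (v : V) :
  v = \sum_i v2r v 0 i *: tbasis i.
Proof.
apply: v2r_inj; rewrite linear_sum /=.
rewrite {1}[v2r v]row_sum_delta.
by apply: eq_bigr => i _; rewrite linearZ /= r2vK.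
Qed.

Lemma tliftE U V W (f : U -> V -> W) u v : bilin f -> tlift f (u \ox v) = f u v.
Proof.
case=> fl fr; rewrite tlift_sum [in RHS](tbasis_sum u) (linear_sumZ _ _ (fl v)).
apply: eq_bigr => i _; rewrite [in RHS](tbasis_sum v) (linear_sumZ _ _ (fr _)).
rewrite scaler_sumr; apply: eq_bigr => j _.
by rewrite scalerA /tpure mxE big_ord1 !mxE.
Qed.

Lemma tens_ext U V W (g h : 'Hom(tens U V, W)) :
  (forall u v, g (u \ox v) = h (u \ox v)) -> g = h.
Proof.
move=> gh; apply/lfunP => t.
have -> : t = \sum_i \sum_j (t : 'M[k]_(_,_)) i j *: (tbasis i \ox tbasis j) :> tens U V.
  rewrite {1}[t]matrix_sum_delta; apply: eq_bigr => i _; apply: eq_bigr => j _.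
  congr (_ *: _); rewrite /tpure !r2vK trmx_delta.
  by rewrite mul_delta_mx.
rewrite !linear_sum; apply: eq_bigr => i _; rewrite !linear_sum.
by apply: eq_bigr => j _; rewrite !linearZ /= gh.
Qed.

Lemma tliftP U V W c (f g : U -> V -> W) :
  tlift (fun u v => c *: f u v + g u v) = c *: tlift f + tlift g.
Proof.
apply/lfunP => t; rewrite add_lfunE scale_lfunE !tlift_sum.
rewrite scaler_sumr -big_split; apply: eq_bigr => i _.
rewrite scaler_sumr -big_split; apply: eq_bigr => j _.
by rewrite /= scalerDr !scalerA mulrC.
Qed.

Lemma eq_tlift U V W (f g : U -> V -> W) : f =2 g -> tlift f = tlift g.
Proof.
move=> fg; apply/lfunP => t; rewrite !tlift_sum.
by apply: eq_bigr => i _; apply: eq_bigr => j _; rewrite fg.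
Qed.

Definition tmap U U' V V' (f : 'Hom(U, U')) (g : 'Hom(V, V')) :
    'Hom(tens U V, tens U' V') :=
  tlift (fun u v => f u \ox g v).

Lemma tmapE U U' V V' (f : 'Hom(U, U')) (g : 'Hom(V, V')) u v :
  tmap f g (u \ox v) = f u \ox g v.
Proof. 
rewrite tliftE //; split=> [w c x y|w c x y]; by rewrite linearP ?tpurePl ?tpurePr.
Qed.

Lemma tmap1 U V : tmap \1%VF \1%VF = \1%VF :> 'End(tens U V).
Proof. by apply: tens_ext => u v; rewrite tmapE !id_lfunE. Qed.

Lemma tmap_comp U U' U'' V V' V'' (f' : 'Hom(U', U'')) (g' : 'Hom(V', V''))
    (f : 'Hom(U, U')) (g : 'Hom(V, V')) :
  (tmap f' g' \o tmap f g)%VF = tmap (f' \o f) (g' \o g).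
Proof. by apply: tens_ext => u v; rewrite comp_lfunE !tmapE !comp_lfunE. Qed.

Lemma tmapPl U U' V V' c (f f' : 'Hom(U, U')) (g : 'Hom(V, V')) :
  tmap (c *: f + f') g = c *: tmap f g + tmap f' g.
Proof.
by apply: tens_ext => u v; rewrite !(add_lfunE, scale_lfunE, tmapE) tpurePl.
Qed.

Lemma tmapPr U U' V V' c (f : 'Hom(U, U')) (g g' : 'Hom(V, V')) :
  tmap f (c *: g + g') = c *: tmap f g + tmap f g'.
Proof.
by apply: tens_ext => u v; rewrite !(add_lfunE, scale_lfunE, tmapE) tpurePr.
Qed.

Lemma tens_ind U V (P : tens U V -> Prop) :
  P 0 -> (forall u v t, P t -> P (u \ox v + t)) -> forall t, P t.
Proof.
move=> P0 Pp t.
have -> : t = \sum_i \sum_j ((t : 'M[k]_(_,_)) i j *: tbasis i) \ox tbasis j :> tens U V.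
  rewrite {1}[t]matrix_sum_delta; apply: eq_bigr => i _; apply: eq_bigr => j _.
  rewrite -[_ *: tbasis i]addr0 tpurePl.
  rewrite tpure0l addr0; congr (_ *: _); rewrite /tpure !r2vK trmx_delta.
  by rewrite mul_delta_mx.
have Ps : forall (s : seq (U * V)) t', P t' -> P (\sum_(p <- s) p.1 \ox p.2 + t').
  elim=> [|p s IH] t' Pt'; first by rewrite big_nil add0r.
  by rewrite big_cons -addrA; apply/Pp/IH.
rewrite pair_big -[X in P X]addr0 /=.
have := Ps [seq ((t : 'M[k]_(_,_)) p.1 p.2 *: tbasis p.1, tbasis p.2) |
            p <- index_enum ('I_(dim U) * 'I_(dim V))%type] 0 P0.
by rewrite big_map.
Qed.

Definition tassoc U V W : 'Hom(tens (tens U V) W, tens U (tens V W)) :=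
  tlift (fun t w => tlift (fun u v => u \ox (v \ox w)) t).

Definition tassoc_inv U V W : 'Hom(tens U (tens V W), tens (tens U V) W) :=
  tlift (fun u t => tlift (fun v w => (u \ox v) \ox w) t).

Lemma tassocE U V W (u : U) (v : V) (w : W) :
  tassoc U V W ((u \ox v) \ox w) = u \ox (v \ox w).
Proof.
rewrite tliftE; first by rewrite tliftE //; split=> [?|?] c x y; rewrite !(tpurePl, tpurePr).
split=> [w' c x y|t c x y]; first by rewrite linearP.
rewrite -scale_lfunE -add_lfunE -tliftP; congr (fun_of_lfun _ _).
by apply: eq_tlift => u' v'; rewrite !tpurePr.
Qed.

Lemma tassoc_invE U V W (u : U) (v : V) (w : W) :
  tassoc_inv U V W (u \ox (v \ox w)) = (u \ox v) \ox w.
Proof.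
rewrite tliftE; first by rewrite tliftE //; split=> [?|?] c x y; rewrite !(tpurePl, tpurePr).
split=> [t c x y|u' c x y]; last by rewrite linearP.
rewrite -scale_lfunE -add_lfunE -tliftP; congr (fun_of_lfun _ _).
by apply: eq_tlift => u' v'; rewrite !tpurePl.
Qed.

Lemma tens_ext3 U V W Z (f g : 'Hom(tens (tens U V) W, Z)) :
  (forall u v w, f ((u \ox v) \ox w) = g ((u \ox v) \ox w)) -> f = g.
Proof.
move=> fg; apply: tens_ext => t w; elim/tens_ind: t => [|u v t IH].
  by rewrite tpure0l !linear0.
by rewrite -[u \ox v]scale1r tpurePl !linearP /= IH fg.
Qed.

Lemma tens_ext3r U V W Z (f g : 'Hom(tens U (tens V W), Z)) :
  (forall u v w, f (u \ox (v \ox w)) = g (u \ox (v \ox w))) -> f = g.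
Proof.
move=> fg; apply: tens_ext => u t; elim/tens_ind: t => [|v w t IH].
  by rewrite tpure0r !linear0.
by rewrite -[v \ox w]scale1r tpurePr !linearP /= IH fg.
Qed.

Lemma tens_ext4 U V W X Z (f g : 'Hom(tens (tens (tens U V) W) X, Z)) :
  (forall u v w x, f ((u \ox v) \ox w \ox x) = g ((u \ox v) \ox w \ox x)) ->
  f = g.
Proof.
move=> fg; apply: tens_ext3 => t w x; elim/tens_ind: t => [|u v t IH].
  by rewrite !tpure0l !linear0.
by rewrite -[u \ox v]scale1r !tpurePl !linearP /= IH fg.
Qed.

Lemma tassocK U V W : (tassoc_inv U V W \o tassoc U V W)%VF = \1%VF.
Proof.
by apply: tens_ext3 => u v w; rewrite comp_lfunE tassocE tassoc_invE id_lfunE.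
Qed.

Lemma tassocVK U V W : (tassoc U V W \o tassoc_inv U V W)%VF = \1%VF.
Proof.
by apply: tens_ext3r => u v w; rewrite comp_lfunE tassoc_invE tassocE id_lfunE.
Qed.

Lemma tassoc_nat U U' V V' W W' (f : 'Hom(U, U')) (g : 'Hom(V, V'))
    (h : 'Hom(W, W')) :
  (tassoc U' V' W' \o tmap (tmap f g) h)%VF =
  (tmap f (tmap g h) \o tassoc U V W)%VF.
Proof.
by apply: tens_ext3 => u v w; rewrite !comp_lfunE tassocE !tmapE tassocE.
Qed.

(* For U <= V and U' <= W, the image of U (x) U' in V (x) W. *)
Definition tensv V W (U : {vspace V}) (U' : {vspace W}) : {vspace tens V W} :=
  <<[seq u \ox u' | u <- vbasis U, u' <- vbasis U']>>%VS.

(* The product of the algebra A (x) B. *)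
Definition tmul (A B : falgType k) (s t : tens A B) : tens A B :=
  tlift (fun a b => tlift (fun a' b' => (a * a') \ox (b * b')) t) s.

Arguments tmul {A B} s t.

Lemma tmul_linearl (A B : falgType k) (t : tens A B) : linear (tmul^~ t).
Proof. by move=> c s s'; rewrite /tmul linearP. Qed.

Lemma tmul_linearr (A B : falgType k) (s : tens A B) : linear (tmul s).
Proof.
move=> c t t'; rewrite /tmul -scale_lfunE -add_lfunE -tliftP.
by congr (fun_of_lfun _ _); apply: eq_tlift => a b; rewrite linearP.
Qed.

Lemma tmulE (A B : falgType k) (a a' : A) (b b' : B) :
  tmul (a \ox b) (a' \ox b') = (a * a') \ox (b * b').
Proof.
rewrite /tmul tliftE.
  rewrite tliftE //; split=> [?|?] c x y /=.
    by rewrite mulrDr -scalerAr tpurePl.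
  by rewrite mulrDr -scalerAr tpurePr.
split=> [y|x] c z w.
  rewrite -scale_lfunE -add_lfunE -tliftP; congr (fun_of_lfun _ _).
  by apply: eq_tlift => u' v'; rewrite mulrDl -scalerAl !tpurePl.
rewrite -scale_lfunE -add_lfunE -tliftP; congr (fun_of_lfun _ _).
by apply: eq_tlift => u' v'; rewrite mulrDl -scalerAl !tpurePr.
Qed.

Lemma tmul_pure_morph (A B A' B' : falgType k) (f : 'Hom(A, A')) (g : 'Hom(B, B')) :
    {morph f : x y / x * y} -> {morph g : x y / x * y} ->
  {morph tmap f g : s t / tmul s t}.
Proof.
move=> fM gM s t.
have lin0 : forall (A B : falgType k) (t : tens A B), tmul 0 t = 0 /\ tmul t 0 = 0.
  move=> C D u.
  by rewrite -(linfun_linear (tmul_linearl u)) -(linfun_linear (tmul_linearr u)) !linear0.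
have linD : forall (A B : falgType k) (t u v : tens A B),
    tmul (u + v) t = tmul u t + tmul v t /\ tmul t (u + v) = tmul t u + tmul t v.
  move=> C D w u v.
  by rewrite -!(linfun_linear (tmul_linearl w)) -!(linfun_linear (tmul_linearr w)) !linearD.
elim/tens_ind: s => [|a b s IHs]; first by rewrite linear0 !(lin0 _ _ _).1 linear0.
rewrite (linD _ _ _ _ _).1 !linearD /= (linD _ _ _ _ _).1 IHs; congr (_ + _).
elim/tens_ind: t {IHs} => [|a' b' t IHt].
  by rewrite linear0 !(lin0 _ _ _).2 linear0.
rewrite (linD _ _ _ _ _).2 !linearD /= (linD _ _ _ _ _).2 IHt; congr (_ + _).
by rewrite !(tmulE, tmapE) fM gM.
Qed.

Definition tact U V X Y (rho : 'Hom(U, 'End(X))) (sigma : 'Hom(V, 'End(Y))) :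
    'Hom(tens U V, 'End(tens X Y)) :=
  tlift (fun u v => tmap (rho u) (sigma v)).

Lemma tactE U V X Y (rho : 'Hom(U, 'End(X))) (sigma : 'Hom(V, 'End(Y))) u v :
  tact rho sigma (u \ox v) = tmap (rho u) (sigma v).
Proof.
by rewrite tliftE //; split=> [?|?] c x y; rewrite linearP ?tmapPl ?tmapPr.
Qed.

Lemma tact_tmap U V U' V' X Y (rho : 'Hom(U, 'End(X))) (sigma : 'Hom(V, 'End(Y)))
    (f : 'Hom(U', U)) (g : 'Hom(V', V)) :
  tact (rho \o f) (sigma \o g) = (tact rho sigma \o tmap f g)%VF.
Proof. by apply: tens_ext => u v; rewrite comp_lfunE tmapE !tactE !comp_lfunE. Qed.

Lemma tact_assoc U V W X Y Z (rho : 'Hom(U, 'End(X))) (sigma : 'Hom(V, 'End(Y)))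
    (tau : 'Hom(W, 'End(Z))) s :
  (tassoc X Y Z \o tact (tact rho sigma) tau s =
   tact rho (tact sigma tau) (tassoc U V W s) \o tassoc X Y Z)%VF.
Proof.
elim/tens_ind: s => [|t w s IH].
  by rewrite !linear0 comp_lfun0l comp_lfun0r.
rewrite !linearD /= comp_lfunDl comp_lfunDr IH; congr (_ + _).
elim/tens_ind: t => [|u v t {}IH].
  by rewrite tpure0l !linear0 comp_lfun0l comp_lfun0r.
rewrite -[u \ox v]scale1r tpurePl scale1r !linearD /= comp_lfunDl comp_lfunDr IH.
by congr (_ + _); rewrite tassocE !tactE tassoc_nat.
Qed.

End Tensor.
Notation "u \ox v" := (tpure u v) (at level 40, left associativity) : ring_scope.

Section Hopf.
Variable k : fieldType.

Record hopfAlgebra := HopfAlgebra {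
  hopf_alg :> falgType k;
  comult : 'Hom(hopf_alg, tens hopf_alg hopf_alg);
  counit : 'Hom(hopf_alg, k^o);
  antipode : 'End(hopf_alg);
  comultA : forall h : hopf_alg,
    tassoc _ _ _ (tmap comult \1 (comult h)) = tmap \1 comult (comult h);
  counitl : forall h : hopf_alg,
    tlift (fun x y => (counit x : k) *: y) (comult h) = h;
  counitr : forall h : hopf_alg,
    tlift (fun x y => (counit y : k) *: x) (comult h) = h;
  comult1 : comult 1 = 1 \ox 1;
  comultM : {morph comult : x y / x * y >-> tmul x y};
  counit1 : counit 1 = 1;
  counitM : {morph counit : x y / x * y};
  antipodel : forall h : hopf_alg,
    tlift (fun x y => antipode x * y) (comult h) = (counit h : k) *: 1;
  antipoder : forall h : hopf_alg,
    tlift (fun x y => x * antipode y) (comult h) = (counit h : k) *: 1 }.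

Record comodAlgebra (H : hopfAlgebra) := ComodAlgebra {
  comod_alg :> falgType k;
  coact : 'Hom(comod_alg, tens H comod_alg);
  coactA : forall a : comod_alg,
    tassoc _ _ _ (tmap (comult H) \1 (coact a)) = tmap \1 coact (coact a);
  coact_counit : forall a : comod_alg,
    tlift (fun h b => (counit H h : k) *: b) (coact a) = a;
  coact1 : coact 1 = 1 \ox 1;
  coactM : {morph coact : a b / a * b >-> tmul a b} }.

Definition comod_iso (H : hopfAlgebra) (A B : comodAlgebra H) : Prop :=
  exists f : 'Hom(A, B),
    [/\ bijective f, f 1 = 1, {morph f : a b / a * b} &
        forall a, coact B (f a) = tmap \1 f (coact A a)].

Definition coinvariants (H : hopfAlgebra) (A : comodAlgebra H) : {vspace A} :=
  lker (coact A - linfun (fun a : A => (1 : H) \ox a)).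

Lemma coinvariantsP (H : hopfAlgebra) (A : comodAlgebra H) (a : A) :
  reflect (coact A a = 1 \ox a) (a \in coinvariants A).
Proof.
apply: (iffP eqlfunP); rewrite linfun_linear // => c x y; exact: tpurePr.
Qed.

Definition right_simple (H : hopfAlgebra) (A : comodAlgebra H) : Prop :=
  forall J : {vspace A},
    (J * fullv <= J)%VS -> (coact A @: J <= tensv fullv J)%VS ->
  J = 0%VS \/ J = fullv.

Definition AM_exact (H : hopfAlgebra) (A : comodAlgebra H) : Prop :=
  right_simple A /\ \dim (coinvariants A) = 1%N.

Definition grading (V : vectType k) (G : nat -> {vspace V}) : Prop :=
  (forall n, directv (\sum_(i < n) G i)) /\
  exists n, (\sum_(i < n) G i)%VS = fullv.

Definition filt (V : vectType k) (G : nat -> {vspace V}) (n : nat) :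
    {vspace V} :=
  (\sum_(i < n.+1) G i)%VS.

Definition alg_graded (A : falgType k) (G : nat -> {vspace A}) : Prop :=
  [/\ grading G, 1 \in G 0%N & forall i j, (G i * G j <= G (i + j)%N)%VS].

Definition hopf_graded (H : hopfAlgebra) (G : nat -> {vspace H}) : Prop :=
  [/\ alg_graded G,
      forall n, (comult H @: G n <= \sum_(i < n.+1) tensv (G i) (G (n - i)%N))%VS,
      forall n, (0 < n)%N -> (G n <= lker (counit H))%VS &
      forall n, (antipode H @: G n <= G n)%VS].

Lemma hopf_graded_alg (H : hopfAlgebra) (G : nat -> {vspace H}) :
  hopf_graded G -> alg_graded G.
Proof. by case. Qed.

Definition subcoalgebra (H : hopfAlgebra) (D : {vspace H}) : Prop :=
  (comult H @: D <= tensv D D)%VS.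

Definition simple_subcoalgebra (H : hopfAlgebra) (D : {vspace H}) : Prop :=
  [/\ subcoalgebra D, D != 0%VS &
      forall E : {vspace H}, subcoalgebra E -> (E <= D)%VS ->
        E = 0%VS \/ E = D].

(* [C] is the sum of all simple subcoalgebras: as H is finite-dimensional,
   this sum is always the sum of finitely many of them. *)
Definition is_coradical (H : hopfAlgebra) (C : {vspace H}) : Prop :=
  (forall D : {vspace H}, simple_subcoalgebra D -> (D <= C)%VS) /\
  exists2 s : seq {vspace H},
    forall D, D \in s -> simple_subcoalgebra D & C = (\sum_(D <- s) D)%VS.

Definition is_coradical_filtration (H : hopfAlgebra) (F : nat -> {vspace H}) :
    Prop :=
  is_coradical (F 0%N) /\
  forall n, F n.+1 =
    (comult H @^-1: (tensv fullv (F n) + tensv (F 0%N) fullv))%VS.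

Record coradGradedHopf := CoradGradedHopf {
  cgh_hopf :> hopfAlgebra;
  hdeg : nat -> {vspace cgh_hopf};
  cgh_graded : hopf_graded hdeg;
  cgh_coradical : is_coradical_filtration (filt hdeg) }.

(* [filt (hdeg H)] is the coradical filtration of H, by [cgh_coradical]. *)
Definition Loewy_grading (H : coradGradedHopf) (A : comodAlgebra H)
    (G : nat -> {vspace A}) : Prop :=
  [/\ alg_graded G,
      forall n, (coact A @^-1: tensv (filt (hdeg H) n) fullv)%VS = filt G n &
      forall n, (coact A @: G n <=
                 \sum_(i < n.+1) tensv (hdeg H i) (G (n - i)%N))%VS].

Lemma Loewy_grading_alg (H : coradGradedHopf) (A : comodAlgebra H)
    (G : nat -> {vspace A}) :
  Loewy_grading G -> alg_graded G.
Proof. by case. Qed.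

Record LoewyGraded (H : coradGradedHopf) := MkLoewyGraded {
  lg_comod :> comodAlgebra H;
  ldeg : nat -> {vspace lg_comod};
  lg_grading : Loewy_grading ldeg }.

(* The degree-zero part is a subalgebra; its [1] is that of A. *)
Lemma alg_graded_aspace (A : falgType k) (G : nat -> {vspace A}) :
  alg_graded G -> is_aspace (G 0%N).
Proof.
by case=> _ G1 GM; rewrite /is_aspace has_algid1 //=; have := GM 0%N 0%N.
Qed.

Definition deg0 (A : falgType k) (G : nat -> {vspace A}) (Gg : alg_graded G) :
    {aspace A} :=
  ASpace (alg_graded_aspace Gg).

Section Deg0.
Variables (A : falgType k) (G : nat -> {vspace A}) (Gg : alg_graded G).
Local Notation A0 := (subvs_of (deg0 Gg)).

Definition incl0 : 'Hom(A0, A) := linfun (vsval (U := G 0%N)).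
Definition proj0 : 'Hom(A, A0) := linfun (vsproj (G 0%N)).

Lemma incl0E (a : A0) : incl0 a = val a. Proof. exact: lfunE. Qed.

Lemma incl0K : (proj0 \o incl0)%VF = \1%VF.
Proof. by apply/lfunP=> a; rewrite comp_lfunE !lfunE /= vsvalK. Qed.

Lemma incl0VK (a : A) : a \in G 0%N -> incl0 (proj0 a) = a.
Proof. by move=> Ga; rewrite !lfunE /= vsprojK. Qed.

Lemma incl01 : incl0 1 = 1.
Proof.
rewrite incl0E -[LHS]/(algid (deg0 Gg)); apply/eqP; rewrite algid_eq1.
by case: Gg.
Qed.

Lemma incl0M : {morph incl0 : a b / a * b}.
Proof. by move=> a b; rewrite !incl0E. Qed.

Lemma incl0_in (a : A0) : incl0 a \in G 0%N.
Proof. by rewrite incl0E; apply: (valP a). Qed.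

End Deg0.

Lemma tmap_sectionK (U U' V V' : vectType k) (i : 'Hom(U, U')) (p : 'Hom(U', U))
    (j : 'Hom(V, V')) (q : 'Hom(V', V)) :
  (p \o i)%VF = \1%VF -> (q \o j)%VF = \1%VF ->
  injective (tmap i j).
Proof.
move=> pi qj; apply: (can_inj (g := tmap p q)) => t.
by rewrite -comp_lfunE tmap_comp pi qj tmap1 id_lfunE.
Qed.

Lemma tensv_section (U U' V V' : vectType k) (i : 'Hom(U, U')) (p : 'Hom(U', U))
    (j : 'Hom(V, V')) (q : 'Hom(V', V)) (X : {vspace U'}) (Y : {vspace V'}) t :
  {in X, forall x, i (p x) = x} -> {in Y, forall y, j (q y) = y} ->
  t \in tensv X Y -> tmap i j (tmap p q t) = t.
Proof.
move=> ip jq tXY; apply/eqP.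
suff /subvP/(_ _ tXY): (tensv X Y <= lker ((tmap i j \o tmap p q) - \1)%VF)%VS.
  by move/eqlfunP; rewrite comp_lfunE id_lfunE => ->.
apply/span_subvP => _ /allpairsP[[x y] /= [Xx Yy ->]].
by apply/eqlfunP; rewrite comp_lfunE id_lfunE !tmapE ip ?jq // vbasis_mem.
Qed.

Lemma hom_tlift (U V W Z : vectType k) (g : 'Hom(W, Z)) (f : U -> V -> W) t :
  g (tlift f t) = tlift (fun u v => g (f u v)) t.
Proof.
rewrite !tlift_sum linear_sum; apply: eq_bigr => i _.
by rewrite linear_sum; apply: eq_bigr => j _; rewrite linearZ.
Qed.

Lemma tlift_tmap (U V U' V' W : vectType k) (f : U -> V -> W)
    (i : 'Hom(U', U)) (j : 'Hom(V', V)) t :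
  bilin f -> tlift f (tmap i j t) = tlift (fun u v => f (i u) (j v)) t.
Proof.
move=> bf; rewrite -comp_lfunE; congr (fun_of_lfun _ _).
apply: tens_ext => u v; rewrite comp_lfunE tmapE !tliftE //.
by case: bf => fl fr; split=> [w c x y|w c x y]; rewrite linearP ?(fl, fr).
Qed.

Lemma coassoc_restrict (C C0 V V0 : vectType k)
    (i : 'Hom(C0, C)) (p : 'Hom(C, C0)) (j : 'Hom(V0, V)) (q : 'Hom(V, V0))
    (d : 'Hom(C, tens C C)) (l : 'Hom(V, tens C V))
    (d0 : 'Hom(C0, tens C0 C0)) (l0 : 'Hom(V0, tens C0 V0)) :
    (p \o i)%VF = \1%VF -> (q \o j)%VF = \1%VF ->
    (forall c, tmap i i (d0 c) = d (i c)) ->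
    (forall v, tmap i j (l0 v) = l (j v)) ->
    (forall v, tassoc _ _ _ (tmap d \1 (l v)) = tmap \1 l (l v)) ->
  forall v, tassoc _ _ _ (tmap d0 \1 (l0 v)) = tmap \1 l0 (l0 v).
Proof.
move=> pi qj id0 jl0 dl v.
apply: (@tmap_sectionK _ _ _ _ i p (tmap i j) (tmap p q)) => //.
  by rewrite tmap_comp pi qj tmap1.
have nat t : tmap i (tmap i j) (tassoc _ _ _ t) = tassoc _ _ _ (tmap (tmap i i) j t).
  by rewrite -!comp_lfunE tassoc_nat.
have eL t : tmap (tmap i i) j (tmap d0 \1 t) = tmap d \1 (tmap i j t).
  rewrite -!comp_lfunE !tmap_comp comp_lfun1l comp_lfun1r; congr (tmap _ _ _).
  by apply/lfunP=> c; rewrite !comp_lfunE.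
have eR t : tmap i (tmap i j) (tmap \1 l0 t) = tmap \1 l (tmap i j t).
  rewrite -!comp_lfunE !tmap_comp comp_lfun1l comp_lfun1r; congr (tmap _ _ _).
  by apply/lfunP=> c; rewrite !comp_lfunE.
by rewrite nat eL eR jl0 dl.
Qed.

Section HopfDeg0.
Variables (H : hopfAlgebra) (G : nat -> {vspace H}) (Gg : hopf_graded G).
Local Notation Ga := (hopf_graded_alg Gg).
Local Notation H0 := (subvs_of (deg0 Ga)).
Local Notation i0 := (incl0 Ga).
Local Notation p0 := (proj0 Ga).

(* The projections lose nothing, since H(0) is a Hopf subalgebra: see [comult0E]
   and [antipode0E]; likewise [coact0E] for the coaction below. *)
Definition comult0 : 'Hom(H0, tens H0 H0) := (tmap p0 p0 \o comult H \o i0)%VF.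
Definition counit0 : 'Hom(H0, k^o) := (counit H \o i0)%VF.
Definition antipode0 : 'End(H0) := (p0 \o antipode H \o i0)%VF.

Lemma comult0E x : tmap i0 i0 (comult0 x) = comult H (i0 x).
Proof.
rewrite !comp_lfunE (@tensv_section _ _ _ _ _ _ _ _ (G 0%N) (G 0%N)) //;
  try by move=> *; apply: incl0VK.
have [_ /(_ 0%N)/subvP GC _ _] := Gg; have := GC _ (memv_img _ (incl0_in x)).
by rewrite big_ord1.
Qed.

Let ii_inj : injective (tmap i0 i0).
Proof. by apply: (@tmap_sectionK _ _ _ _ _ p0 _ p0); apply: incl0K. Qed.

Let i0_inj : injective i0.
Proof. by apply: (can_inj (g := p0)) => x; rewrite -comp_lfunE incl0K id_lfunE. Qed.

Lemma antipode0E x : i0 (antipode0 x) = antipode H (i0 x).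
Proof.
rewrite !comp_lfunE incl0VK //; have [_ _ _ /(_ 0%N)/subvP GS] := Gg; apply: GS.
exact/memv_img/incl0_in.
Qed.

Fact comult0A h :
  tassoc _ _ _ (tmap comult0 \1 (comult0 h)) = tmap \1 comult0 (comult0 h).
Proof.
by apply: (coassoc_restrict (incl0K Ga) (incl0K Ga) comult0E comult0E); apply: comultA.
Qed.

Fact counit0l h : tlift (fun x y => (counit0 x : k) *: y) (comult0 h) = h.
Proof.
apply: i0_inj; rewrite -[RHS]counitl -comult0E tlift_tmap; last first.
  by split=> [?|?] c x y; rewrite linearP ?scalerDl ?scalerDr ?scalerA // mulrC.
rewrite hom_tlift; congr (fun_of_lfun _ _); apply: eq_tlift => x y.
by rewrite linearZ comp_lfunE.
Qed.

Fact counit0r h : tlift (fun x y => (counit0 y : k) *: x) (comult0 h) = h.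
Proof.
apply: i0_inj; rewrite -[RHS]counitr -comult0E tlift_tmap; last first.
  by split=> [?|?] c x y; rewrite linearP ?scalerDl ?scalerDr ?scalerA // mulrC.
rewrite hom_tlift; congr (fun_of_lfun _ _); apply: eq_tlift => x y.
by rewrite linearZ comp_lfunE.
Qed.

Fact comult01 : comult0 1 = 1 \ox 1.
Proof. by apply: ii_inj; rewrite comult0E tmapE !incl01 comult1. Qed.

Fact comult0M : {morph comult0 : x y / x * y >-> tmul x y}.
Proof.
move=> x y; apply: ii_inj.
by rewrite comult0E incl0M comultM tmul_pure_morph ?comult0E //; apply: incl0M.
Qed.

Fact counit01 : counit0 1 = 1.
Proof. by rewrite comp_lfunE incl01 counit1. Qed.

Fact counit0M : {morph counit0 : x y / x * y}.
Proof. by move=> x y; rewrite !comp_lfunE incl0M counitM. Qed.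

Fact antipode0l h :
  tlift (fun x y => antipode0 x * y) (comult0 h) = (counit0 h : k) *: 1.
Proof.
have eh : counit0 h = counit H (i0 h) by rewrite comp_lfunE.
apply: i0_inj; rewrite linearZ /= incl01 eh.
rewrite -[RHS](antipodel (i0 h)) -comult0E.
rewrite tlift_tmap; last first.
  by split=> [?|?] c x y; rewrite ?linearP ?mulrDl ?mulrDr -?scalerAl -?scalerAr.
rewrite hom_tlift; congr (fun_of_lfun _ _); apply: eq_tlift => x y.
by rewrite incl0M antipode0E.
Qed.

Fact antipode0r h :
  tlift (fun x y => x * antipode0 y) (comult0 h) = (counit0 h : k) *: 1.
Proof.
have eh : counit0 h = counit H (i0 h) by rewrite comp_lfunE.
apply: i0_inj; rewrite linearZ /= incl01 eh.
rewrite -[RHS](antipoder (i0 h)) -comult0E.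
rewrite tlift_tmap; last first.
  by split=> [?|?] c x y; rewrite ?linearP ?mulrDl ?mulrDr -?scalerAl -?scalerAr.
rewrite hom_tlift; congr (fun_of_lfun _ _); apply: eq_tlift => x y.
by rewrite incl0M antipode0E.
Qed.

Definition hopf_deg0 : hopfAlgebra :=
  HopfAlgebra comult0A counit0l counit0r comult01 comult0M counit01 counit0M
    antipode0l antipode0r.

End HopfDeg0.

Definition coradical_part (H : coradGradedHopf) : hopfAlgebra :=
  hopf_deg0 (cgh_graded H).

Section ComodDeg0.
Variables (H : coradGradedHopf) (A : LoewyGraded H).
Local Notation Hg := (hopf_graded_alg (cgh_graded H)).
Local Notation Ag := (Loewy_grading_alg (lg_grading A)).
Local Notation A0 := (subvs_of (deg0 Ag)).
Local Notation H0 := (coradical_part H).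

Definition coact0 : 'Hom(A0, tens H0 A0) :=
  (tmap (proj0 Hg) (proj0 Ag) \o coact A \o incl0 Ag)%VF.

Lemma coact0E a : tmap (incl0 Hg) (incl0 Ag) (coact0 a) = coact A (incl0 Ag a).
Proof.
rewrite !comp_lfunE (@tensv_section _ _ _ _ _ _ _ _ (hdeg H 0%N) (ldeg A 0%N)) //;
  try by move=> *; apply: incl0VK.
have [_ _ /(_ 0%N)/subvP GC] := lg_grading A.
by have := GC _ (memv_img _ (incl0_in a)); rewrite big_ord1.
Qed.

Let ii_inj : injective (tmap (incl0 Hg) (incl0 Ag)).
Proof.
by apply: (@tmap_sectionK _ _ _ _ _ (proj0 Hg) _ (proj0 Ag)); apply: incl0K.
Qed.

Let i0_inj : injective (incl0 Ag).
Proof.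
apply: (can_inj (g := proj0 Ag)) => x.
by rewrite -comp_lfunE incl0K id_lfunE.
Qed.

Fact coact0A a :
  tassoc _ _ _ (tmap (comult H0) \1 (coact0 a)) = tmap \1 coact0 (coact0 a).
Proof.
apply: (coassoc_restrict (incl0K Hg) (incl0K Ag) _ coact0E (@coactA _ A)).
exact: comult0E.
Qed.

Fact coact0_counit a :
  tlift (fun h b => (counit H0 h : k) *: b) (coact0 a) = a.
Proof.
apply: i0_inj; rewrite -[RHS]coact_counit -coact0E tlift_tmap; last first.
  by split=> [?|?] c x y; rewrite linearP ?scalerDl ?scalerDr ?scalerA // mulrC.
rewrite hom_tlift; congr (fun_of_lfun _ _); apply: eq_tlift => x y.
by rewrite linearZ /= comp_lfunE.
Qed.

Fact coact01 : coact0 1 = 1 \ox 1.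
Proof. by apply: ii_inj; rewrite coact0E tmapE !incl01 coact1. Qed.

Fact coact0M : {morph coact0 : x y / x * y >-> tmul x y}.
Proof.
move=> x y; apply: ii_inj; rewrite coact0E incl0M coactM.
by rewrite tmul_pure_morph ?coact0E //; apply: incl0M.
Qed.

Definition comod_deg0 : comodAlgebra H0 :=
  ComodAlgebra coact0A coact0_counit coact01 coact0M.

End ComodDeg0.


End Hopf.

Section Categories.
Variable k : fieldType.

Record linCat := LinCat {
  cob :> Type;
  chom : cob -> cob -> lmodType k;
  cid : forall X, chom X X;
  ccomp : forall X Y Z, chom Y Z -> chom X Y -> chom X Z;
  ccomp_bilinear : forall X Y Z, bilin (@ccomp X Y Z);
  ccompA : forall X Y Z T (h : chom Z T) (g : chom Y Z) (f : chom X Y),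
    ccomp h (ccomp g f) = ccomp (ccomp h g) f;
  ccomp1l : forall X Y (f : chom X Y), ccomp (cid Y) f = f;
  ccomp1r : forall X Y (f : chom X Y), ccomp f (cid X) = f }.

Arguments cid {l} X.
Arguments ccomp {l X Y Z} g f.
Local Notation "g \oc f" := (ccomp g f) (at level 40, left associativity).

Lemma ccompPl (C : linCat) (X Y Z : C) c (g g' : chom Y Z) (f : chom X Y) :
  (c *: g + g') \oc f = c *: (g \oc f) + g' \oc f.
Proof. exact: (ccomp_bilinear X Y Z).1. Qed.

Lemma ccompPr (C : linCat) (X Y Z : C) c (g : chom Y Z) (f f' : chom X Y) :
  g \oc (c *: f + f') = c *: (g \oc f) + g \oc f'.
Proof. exact: (ccomp_bilinear X Y Z).2. Qed.

Section InCat.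
Variable C : linCat.

Definition is_iso (X Y : C) (f : chom X Y) : Prop :=
  exists g : chom Y X, g \oc f = cid X /\ f \oc g = cid Y.

Definition epi (X Y : C) (f : chom X Y) : Prop :=
  forall Z (g h : chom Y Z), g \oc f = h \oc f -> g = h.

Definition projective (P : C) : Prop :=
  forall (X Y : C) (e : chom X Y), epi e ->
  forall f : chom P Y, exists g : chom P X, e \oc g = f.

Definition is_kernel (X Y Z : C) (f : chom X Y) (g : chom Y Z) : Prop :=
  g \oc f = 0 /\
  forall T (h : chom T Y), g \oc h = 0 -> exists! h', f \oc h' = h.

Definition is_cokernel (X Y Z : C) (f : chom X Y) (g : chom Y Z) : Prop :=
  g \oc f = 0 /\
  forall T (h : chom Y T), h \oc f = 0 -> exists! h', h' \oc g = h.

Definition short_exact (X Y Z : C) (f : chom X Y) (g : chom Y Z) : Prop :=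
  is_kernel f g /\ is_cokernel f g.

End InCat.

Record linFunctor (C D : linCat) := LinFunctor {
  fob :> C -> D;
  fhom : forall X Y : C, chom X Y -> chom (fob X) (fob Y);
  fhom_linear : forall X Y, linear (@fhom X Y);
  fhom_id : forall X, fhom (cid X) = cid (fob X);
  fhom_comp : forall X Y Z (g : chom Y Z) (f : chom X Y),
    fhom (g \oc f) = fhom g \oc fhom f }.

Definition is_equivalence (C D : linCat) (F : linFunctor C D) : Prop :=
  exists G : linFunctor D C,
    (exists eta : forall X : C, chom X (G (F X)),
       (forall X, is_iso (eta X)) /\
       forall (X Y : C) (f : chom X Y),
         eta Y \oc f = fhom G (fhom F f) \oc eta X) /\
    (exists eps : forall Y : D, chom (F (G Y)) Y,
       (forall Y, is_iso (eps Y)) /\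
       forall (X Y : D) (f : chom X Y),
         f \oc eps X = eps Y \oc fhom F (fhom G f)).

Record monCat := MonCat {
  mon_cat :> linCat;
  tob : mon_cat -> mon_cat -> mon_cat;
  thom : forall X X' Y Y' : mon_cat,
    chom X X' -> chom Y Y' -> chom (tob X Y) (tob X' Y');
  thom_bilinear : forall X X' Y Y', bilin (@thom X X' Y Y');
  thom_id : forall X Y, thom (cid X) (cid Y) = cid (tob X Y);
  thom_comp : forall X X' X'' Y Y' Y''
    (f' : chom X' X'') (f : chom X X') (g' : chom Y' Y'') (g : chom Y Y'),
    thom (f' \oc f) (g' \oc g) = thom f' g' \oc thom f g;
  tunit : mon_cat;
  talpha : forall X Y Z, chom (tob (tob X Y) Z) (tob X (tob Y Z));
  tlambda : forall X, chom (tob tunit X) X;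
  trho : forall X, chom (tob X tunit) X;
  talpha_iso : forall X Y Z, is_iso (talpha X Y Z);
  tlambda_iso : forall X, is_iso (tlambda X);
  trho_iso : forall X, is_iso (trho X);
  talpha_nat : forall X X' Y Y' Z Z'
    (f : chom X X') (g : chom Y Y') (h : chom Z Z'),
    talpha X' Y' Z' \oc thom (thom f g) h =
    thom f (thom g h) \oc talpha X Y Z;
  tlambda_nat : forall X X' (f : chom X X'),
    tlambda X' \oc thom (cid tunit) f = f \oc tlambda X;
  trho_nat : forall X X' (f : chom X X'),
    trho X' \oc thom f (cid tunit) = f \oc trho X;
  tpentagon : forall X Y Z T,
    talpha X Y (tob Z T) \oc talpha (tob X Y) Z T =
    thom (cid X) (talpha Y Z T) \oc talpha X (tob Y Z) T \oc
      thom (talpha X Y Z) (cid T);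
  ttriangle : forall X Y,
    thom (cid X) (tlambda Y) \oc talpha X tunit Y =
    thom (trho X) (cid Y) }.

Record moduleCat (C : monCat) := ModuleCat {
  mod_cat :> linCat;
  aob : C -> mod_cat -> mod_cat;
  ahom : forall (X X' : C) (M M' : mod_cat),
    chom X X' -> chom M M' -> chom (aob X M) (aob X' M');
  ahom_bilinear : forall X X' M M', bilin (@ahom X X' M M');
  ahom_id : forall X M, ahom (cid X) (cid M) = cid (aob X M);
  ahom_comp : forall X X' X'' M M' M''
    (f' : chom X' X'') (f : chom X X') (g' : chom M' M'') (g : chom M M'),
    ahom (f' \oc f) (g' \oc g) = ahom f' g' \oc ahom f g;
  aalpha : forall X Y M, chom (aob (tob X Y) M) (aob X (aob Y M));
  alambda : forall M, chom (aob (tunit C) M) M;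
  aalpha_iso : forall X Y M, is_iso (aalpha X Y M);
  alambda_iso : forall M, is_iso (alambda M);
  aalpha_nat : forall X X' Y Y' M M'
    (f : chom X X') (g : chom Y Y') (h : chom M M'),
    aalpha X' Y' M' \oc ahom (thom f g) h =
    ahom f (ahom g h) \oc aalpha X Y M;
  alambda_nat : forall M M' (f : chom M M'),
    alambda M' \oc ahom (cid (tunit C)) f = f \oc alambda M;
  apentagon : forall X Y Z M,
    aalpha X Y (aob Z M) \oc aalpha (tob X Y) Z M =
    ahom (cid X) (aalpha Y Z M) \oc aalpha X (tob Y Z) M \oc
      ahom (talpha X Y Z) (cid M);
  atriangle : forall X M,
    ahom (cid X) (alambda M) \oc aalpha X (tunit C) M =
    ahom (trho X) (cid M) }.

Record moduleFunctor (C : monCat) (M N : moduleCat C) := ModuleFunctor {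
  mf_fun :> linFunctor M N;
  mf_str : forall (X : C) (P : M), chom (mf_fun (aob X P)) (aob X (mf_fun P));
  mf_str_iso : forall X P, is_iso (mf_str X P);
  mf_str_nat : forall X X' P P' (f : chom X X') (g : chom P P'),
    mf_str X' P' \oc fhom mf_fun (ahom f g) =
    ahom f (fhom mf_fun g) \oc mf_str X P;
  mf_pentagon : forall (X Y : C) (P : M),
    aalpha X Y (mf_fun P) \oc mf_str (tob X Y) P =
    ahom (cid X) (mf_str Y P) \oc mf_str X (aob Y P) \oc
      fhom mf_fun (aalpha X Y P);
  mf_triangle : forall P : M,
    alambda (mf_fun P) \oc mf_str (tunit C) P = fhom mf_fun (alambda P) }.

Definition module_equivalent (C : monCat) (M N : moduleCat C) : Prop :=
  exists F : moduleFunctor M N, is_equivalence F.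

Section DirectSum.
Variables (C : monCat) (M N : moduleCat C).

Definition sum_hom (P Q : M * N) : lmodType k :=
  (chom P.1 Q.1 * chom P.2 Q.2)%type.

Definition sum_id (P : M * N) : sum_hom P P := (cid P.1, cid P.2).

Definition sum_comp (P Q T : M * N) (g : sum_hom Q T) (f : sum_hom P Q) :
    sum_hom P T :=
  (g.1 \oc f.1, g.2 \oc f.2).

Fact sum_comp_bilinear P Q T : bilin (@sum_comp P Q T).
Proof.
by split=> [v|u] c x y; congr pair; rewrite /= ?ccompPl ?ccompPr.
Qed.

Fact sum_compA P Q S T (h : sum_hom S T) (g : sum_hom Q S) (f : sum_hom P Q) :
  sum_comp h (sum_comp g f) = sum_comp (sum_comp h g) f.
Proof. by congr pair; rewrite /= ccompA. Qed.

Fact sum_comp1l P Q (f : sum_hom P Q) : sum_comp (sum_id Q) f = f.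
Proof. by case: f => f g; congr pair; rewrite /= ccomp1l. Qed.

Fact sum_comp1r P Q (f : sum_hom P Q) : sum_comp f (sum_id P) = f.
Proof. by case: f => f g; congr pair; rewrite /= ccomp1r. Qed.

Definition sum_linCat : linCat :=
  LinCat sum_comp_bilinear sum_compA sum_comp1l sum_comp1r.

Definition sum_aob (X : C) (P : sum_linCat) : sum_linCat :=
  (aob X P.1, aob X P.2).

Definition sum_ahom (X X' : C) (P P' : sum_linCat)
    (f : chom X X') (g : chom P P') : chom (sum_aob X P) (sum_aob X' P') :=
  (ahom f g.1, ahom f g.2).

Definition sum_aalpha (X Y : C) (P : sum_linCat) :
    chom (sum_aob (tob X Y) P) (sum_aob X (sum_aob Y P)) :=
  (aalpha X Y P.1, aalpha X Y P.2).

Definition sum_alambda (P : sum_linCat) : chom (sum_aob (tunit C) P) P :=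
  (alambda P.1, alambda P.2).

Fact sum_iso (P Q : sum_linCat) (f : chom P Q) :
  is_iso f.1 -> is_iso f.2 -> is_iso f.
Proof.
case: f => f f' [g [gf fg]] [g' [gf' fg']]; exists (g, g').
by split; congr pair.
Qed.

Fact sum_ahom_bilinear X X' P P' : bilin (@sum_ahom X X' P P').
Proof.
split=> [v|u] c x y; congr pair.
- by apply: (ahom_bilinear _ _ _ _).1.
- by apply: (ahom_bilinear _ _ _ _).1.
- by apply: (ahom_bilinear _ _ _ _).2.
- by apply: (ahom_bilinear _ _ _ _).2.
Qed.

Definition sum_moduleCat : moduleCat C.
Proof.
refine (@ModuleCat C sum_linCat sum_aob sum_ahom sum_ahom_bilinear _ _
  sum_aalpha sum_alambda _ _ _ _ _ _).
- by move=> X P; congr pair; apply: ahom_id.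
- by move=> *; congr pair; apply: ahom_comp.
- by move=> X Y P; apply: sum_iso; apply: aalpha_iso.
- by move=> P; apply: sum_iso; apply: alambda_iso.
- by move=> *; congr pair; apply: aalpha_nat.
- by move=> *; congr pair; apply: alambda_nat.
- by move=> *; congr pair; apply: apentagon.
- by move=> *; congr pair; apply: atriangle.
Defined.

End DirectSum.
End Categories.

Section Modules.
Variable k : fieldType.

Record lmodule (A : falgType k) := LModule {
  lm_vect :> vectType k;
  lm_act : 'Hom(A, 'End(lm_vect));
  lm_act1 : lm_act 1 = \1%VF;
  lm_actM : forall a b : A, lm_act (a * b) = (lm_act a \o lm_act b)%VF }.

Section ModuleCategory.
Variable A : falgType k.
Implicit Types M N P : lmodule A.

Definition Ahoms M N : {vspace 'Hom(M, N)} :=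
  lker (linfun (fun f : 'Hom(M, N) =>
    linfun (fun a : A => ((f \o lm_act M a) - (lm_act N a \o f))%VF))).

Lemma AhomsP M N (f : 'Hom(M, N)) :
  (f \in Ahoms M N) <->
  (forall a, (f \o lm_act M a = lm_act N a \o f)%VF).
Proof.
have lin2 (g : 'Hom(M, N)) :
    linear (fun a : A => ((g \o lm_act M a) - (lm_act N a \o g))%VF).
  move=> c a b; rewrite !linearP /= comp_lfunDr comp_lfunDl -comp_lfunZr.
  by rewrite -comp_lfunZl scalerBr opprD addrACA.
have lin1 : linear (fun f : 'Hom(M, N) =>
    linfun (fun a : A => ((f \o lm_act M a) - (lm_act N a \o f))%VF)).
  move=> c g h; apply/lfunP=> a.
  rewrite add_lfunE scale_lfunE !linfun_linear //.
  rewrite comp_lfunDr comp_lfunDl -comp_lfunZr -comp_lfunZl.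
  by rewrite scalerBr opprD addrACA.
rewrite memv_ker linfun_linear //; split=> [/eqP/lfunP h a|h].
  by apply/eqP; rewrite -subr_eq0 -(linfun_linear (lin2 f)) h zero_lfunE.
by apply/eqP/lfunP=> a; rewrite linfun_linear // h subrr zero_lfunE.
Qed.

Definition Ahom M N : vectType k := subvs_of (Ahoms M N).

Fact Ahom_id_subproof M : \1%VF \in Ahoms M M.
Proof. by apply/AhomsP=> a; rewrite comp_lfun1l comp_lfun1r. Qed.

Fact Ahom_comp_subproof M N P (g : Ahom N P) (f : Ahom M N) :
  (vsval g \o vsval f)%VF \in Ahoms M P.
Proof.
apply/AhomsP=> a; rewrite -comp_lfunA (AhomsP _).1 ?subvsP //.
by rewrite !comp_lfunA (AhomsP _).1 ?subvsP.
Qed.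

Definition Ahom_id M : Ahom M M := Subvs (Ahom_id_subproof M).

Definition Ahom_comp M N P (g : Ahom N P) (f : Ahom M N) : Ahom M P :=
  Subvs (Ahom_comp_subproof g f).

Fact Ahom_comp_bilinear M N P : bilin (@Ahom_comp M N P).
Proof.
split=> [f|g] c x y; apply/val_inj => /=.
  by rewrite comp_lfunDl -comp_lfunZl.
by rewrite comp_lfunDr -comp_lfunZr.
Qed.

Fact Ahom_compA M N P Q (h : Ahom P Q) (g : Ahom N P) (f : Ahom M N) :
  Ahom_comp h (Ahom_comp g f) = Ahom_comp (Ahom_comp h g) f.
Proof. by apply/val_inj; rewrite /= comp_lfunA. Qed.

Fact Ahom_comp1l M N (f : Ahom M N) : Ahom_comp (Ahom_id N) f = f.
Proof. by apply/val_inj; rewrite /= comp_lfun1l. Qed.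

Fact Ahom_comp1r M N (f : Ahom M N) : Ahom_comp f (Ahom_id M) = f.
Proof. by apply/val_inj; rewrite /= comp_lfun1r. Qed.

Definition modules : linCat k :=
  LinCat (cob := lmodule A) (chom := Ahom)
    Ahom_comp_bilinear Ahom_compA Ahom_comp1l Ahom_comp1r.

Lemma Ahom_iso M N (f : Ahom M N) (g : 'Hom(N, M)) :
  (g \o vsval f = \1)%VF -> (vsval f \o g = \1)%VF -> is_iso (C := modules) f.
Proof.
move=> gf fg.
have gA : g \in Ahoms N M.
  apply/AhomsP=> a; have /AhomsP fA := subvsP f.
  rewrite -[LHS]comp_lfun1r -fg comp_lfunA -[X in (X \o g)%VF]comp_lfunA -fA.
  by rewrite comp_lfunA gf comp_lfun1l.
by exists (Subvs gA); split; apply/val_inj.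
Qed.

End ModuleCategory.

Section Action.
Variables (H : hopfAlgebra k) (A : comodAlgebra H).
Implicit Types (X Y : lmodule H) (M N : lmodule A).

(* a . (x (x) m) = a_(-1) x (x) a_(0) m *)
Definition tens_act X M : 'Hom(A, 'End(tens X M)) :=
  (tact (lm_act X) (lm_act M) \o coact A)%VF.

Lemma tens_actE X M a :
  tens_act X M a = tact (lm_act X) (lm_act M) (coact A a).
Proof. by rewrite comp_lfunE. Qed.

Lemma tactM (U V : falgType k) (X Y : vectType k) (rho : 'Hom(U, 'End(X)))
    (sigma : 'Hom(V, 'End(Y))) (s t : tens U V) :
    {morph rho : x y / x * y >-> (x \o y)%VF} ->
    {morph sigma : x y / x * y >-> (x \o y)%VF} ->
  tact rho sigma (tmul s t) = (tact rho sigma s \o tact rho sigma t)%VF.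
Proof.
move=> rhoM sigmaM.
rewrite -(linfun_linear (tmul_linearl t)).
elim/tens_ind: s => [|a b s IHs]; first by rewrite !linear0 comp_lfun0l.
rewrite !linearD /= comp_lfunDl IHs; congr (_ + _).
rewrite (linfun_linear (tmul_linearl t)) -(linfun_linear (tmul_linearr _)) {IHs}.
elim/tens_ind: t => [|a' b' t IHt]; first by rewrite !linear0 comp_lfun0r.
rewrite !linearD /= comp_lfunDr IHt; congr (_ + _).
rewrite (linfun_linear (tmul_linearr _)) tmulE !tactE rhoM sigmaM.
by rewrite tmap_comp.
Qed.

Fact tens_act1 X M : tens_act X M 1 = \1%VF.
Proof. by rewrite comp_lfunE coact1 tactE !lm_act1 tmap1. Qed.

Fact tens_actM X M (a b : A) :
  tens_act X M (a * b) = (tens_act X M a \o tens_act X M b)%VF.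
Proof. by rewrite !comp_lfunE coactM tactM //; apply: lm_actM. Qed.

Definition tens_module X M : lmodule A :=
  LModule (tens_act1 X M) (tens_actM X M).

Lemma tens_module_actE X M a :
  lm_act (tens_module X M) a = tact (lm_act X) (lm_act M) (coact A a).
Proof. exact: tens_actE. Qed.

Lemma tact_homs (U V : vectType k) (X X' Y Y' : vectType k)
    (rho : 'Hom(U, 'End(X))) (rho' : 'Hom(U, 'End(X')))
    (sigma : 'Hom(V, 'End(Y))) (sigma' : 'Hom(V, 'End(Y')))
    (f : 'Hom(X, X')) (g : 'Hom(Y, Y')) (t : tens U V) :
    (forall u, (f \o rho u = rho' u \o f)%VF) ->
    (forall v, (g \o sigma v = sigma' v \o g)%VF) ->
  (tmap f g \o tact rho sigma t = tact rho' sigma' t \o tmap f g)%VF.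
Proof.
move=> fA gA; elim/tens_ind: t => [|u v t IH].
  by rewrite !linear0 comp_lfun0l comp_lfun0r.
rewrite !linearD /= comp_lfunDl comp_lfunDr IH; congr (_ + _).
by rewrite !tactE !tmap_comp fA gA.
Qed.

Fact tens_hom_subproof X X' M M' (f : Ahom X X') (g : Ahom M M') :
  tmap (vsval f) (vsval g) \in Ahoms (tens_module X M) (tens_module X' M').
Proof.
have /AhomsP fH := subvsP f; have /AhomsP gA := subvsP g.
by apply/AhomsP=> a; rewrite /= !tens_actE (tact_homs _ fH gA).
Qed.

Definition tens_hom X X' M M' (f : Ahom X X') (g : Ahom M M') :
    Ahom (tens_module X M) (tens_module X' M') :=
  Subvs (tens_hom_subproof f g).

End Action.

Definition regular_comod (H : hopfAlgebra k) : comodAlgebra H :=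
  @ComodAlgebra k H H (comult H) (@comultA k H) (@counitl k H) (@comult1 k H)
    (@comultM k H).

(* The tensor product of _H M is the action of _H M on _A M for A = H. *)
Definition tensH (H : hopfAlgebra k) (X Y : lmodule H) : lmodule H :=
  tens_module (A := regular_comod H) X Y.

Lemma tensH_actE (H : hopfAlgebra k) (X Y : lmodule H) h :
  lm_act (tensH X Y) h = tact (lm_act X) (lm_act Y) (comult H h).
Proof. exact: (@tens_module_actE H (regular_comod H)). Qed.

Definition tensH_hom (H : hopfAlgebra k) (X X' Y Y' : lmodule H)
    (f : Ahom X X') (g : Ahom Y Y') : Ahom (tensH X Y) (tensH X' Y') :=
  tens_hom (A := regular_comod H) f g.

Section Assoc.
Variables (H : hopfAlgebra k) (A : comodAlgebra H).
Local Notation RH := (regular_comod H).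
Implicit Types (X Y : lmodule H) (M N : lmodule A).

Fact assoc_subproof X Y M :
  tassoc X Y M \in Ahoms (tens_module (tensH X Y) M)
                         (tens_module X (tens_module Y M)).
Proof.
have eL t : tact (tact (lm_act X) (lm_act Y) \o comult H)%VF (lm_act M) t =
    tact (tact (lm_act X) (lm_act Y)) (lm_act M) (tmap (comult H) \1 t).
  by rewrite -comp_lfunE -tact_tmap comp_lfun1r.
have eR t : tact (lm_act X) (tact (lm_act Y) (lm_act M) \o coact A)%VF t =
    tact (lm_act X) (tact (lm_act Y) (lm_act M)) (tmap \1 (coact A) t).
  by rewrite -comp_lfunE -tact_tmap comp_lfun1r.
apply/AhomsP=> a; rewrite (tens_actE (tensH X Y)) tens_actE eL eR tact_assoc.
by rewrite coactA.
Qed.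

Definition tens_assoc X Y M :
    Ahom (tens_module (tensH X Y) M)
         (tens_module X (tens_module Y M)) :=
  Subvs (assoc_subproof X Y M).

Lemma tens_assoc_iso X Y M : is_iso (C := modules A) (tens_assoc X Y M).
Proof. by apply: Ahom_iso; [apply: tassocK | apply: tassocVK]. Qed.

Lemma tens_assoc_nat X X' Y Y' M M' (f : Ahom X X') (g : Ahom Y Y')
    (h : Ahom M M') :
  Ahom_comp (tens_assoc X' Y' M')
    (tens_hom (tensH_hom f g) h) =
  Ahom_comp (tens_hom f (tens_hom g h)) (tens_assoc X Y M).
Proof. by apply/val_inj; rewrite /= tassoc_nat. Qed.

End Assoc.

Section Unit.
Variable H : hopfAlgebra k.

Definition unit_act : 'Hom(H, 'End(k^o)) :=
  linfun (fun h => (counit H h : k) *: \1%VF).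

Lemma unit_actE h : unit_act h = (counit H h : k) *: \1%VF.
Proof. by rewrite linfun_linear // => c x y; rewrite linearP scalerDl scalerA. Qed.

Fact unit_act1 : unit_act 1 = \1%VF.
Proof. by rewrite unit_actE counit1 scale1r. Qed.

Fact unit_actM x y : unit_act (x * y) = (unit_act x \o unit_act y)%VF.
Proof.
by rewrite !unit_actE counitM -comp_lfunZl -comp_lfunZr comp_lfun1l scalerA.
Qed.

Definition unit_module : lmodule H := LModule unit_act1 unit_actM.

End Unit.

Section Unitors.
Variable V : vectType k.

Definition tunitl : 'Hom(tens k^o V, V) :=
  tlift (fun (c : k^o) v => (c : k) *: v).
Definition tunitr : 'Hom(tens V k^o, V) :=
  tlift (fun v (c : k^o) => (c : k) *: v).
Definition tunitl_inv : 'Hom(V, tens k^o V) :=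
  linfun (fun v => (1 : k^o) \ox v).
Definition tunitr_inv : 'Hom(V, tens V k^o) :=
  linfun (fun v => v \ox (1 : k^o)).

Lemma tunitlE (c : k^o) (v : V) : tunitl (c \ox v) = (c : k) *: v.
Proof.
rewrite tliftE //; split=> [w|w] d x y /=; first by rewrite scalerDl scalerA.
by rewrite scalerDr !scalerA mulrC.
Qed.

Lemma tunitrE (c : k^o) (v : V) : tunitr (v \ox c) = (c : k) *: v.
Proof.
rewrite tliftE //; split=> [w|w] d x y /=; last by rewrite scalerDl scalerA.
by rewrite scalerDr !scalerA mulrC.
Qed.

Lemma tpureZ1 (c : k^o) (v : V) : (1 : k^o) \ox ((c : k) *: v) = c \ox v.
Proof. by rewrite tpureZr -tpureZl [_ *: _]mulr1. Qed.

Lemma tpure1Z (c : k^o) (v : V) : ((c : k) *: v) \ox (1 : k^o) = v \ox c.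
Proof. by rewrite tpureZl -tpureZr [_ *: _]mulr1. Qed.

Lemma tunitlK : (tunitl_inv \o tunitl)%VF = \1%VF.
Proof.
apply: tens_ext => c v; rewrite comp_lfunE tunitlE linfun_linear ?tpureZ1 ?id_lfunE //.
by move=> d x y; apply: tpurePr.
Qed.

Lemma tunitlVK : (tunitl \o tunitl_inv)%VF = \1%VF.
Proof.
apply/lfunP=> v; rewrite comp_lfunE [tunitl_inv v]linfun_linear ?tunitlE ?scale1r ?id_lfunE //.
by move=> d x y; apply: tpurePr.
Qed.

Lemma tunitrK : (tunitr_inv \o tunitr)%VF = \1%VF.
Proof.
apply: tens_ext => v c; rewrite comp_lfunE tunitrE linfun_linear ?tpure1Z ?id_lfunE //.
by move=> d x y; apply: tpurePl.
Qed.

Lemma tunitrVK : (tunitr \o tunitr_inv)%VF = \1%VF.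
Proof.
apply/lfunP=> v; rewrite comp_lfunE [tunitr_inv v]linfun_linear ?tunitrE ?scale1r ?id_lfunE //.
by move=> d x y; apply: tpurePl.
Qed.

End Unitors.

Section ComodModules.
Variables (H : hopfAlgebra k) (A : comodAlgebra H).
Local Notation RH := (regular_comod H).

Fact tens_unitl_subproof (M : lmodule A) :
  tunitl M \in Ahoms (tens_module (unit_module H) M) M.
Proof.
have e t : (tunitl M \o tact (unit_act H) (lm_act M) t)%VF =
    (lm_act M (tlift (fun h b => (counit H h : k) *: b) t) \o tunitl M)%VF.
  elim/tens_ind: t => [|h a t IH].
    by rewrite !linear0 comp_lfun0l comp_lfun0r.
  rewrite !linearD /= comp_lfunDl comp_lfunDr IH; congr (_ + _).
  apply: tens_ext => c m; rewrite !comp_lfunE tliftE; last first.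
    by split=> [?|?] d x y; rewrite linearP ?scalerDl ?scalerDr ?scalerA // mulrC.
  rewrite tactE tmapE unit_actE scale_lfunE id_lfunE !tunitlE.
  by rewrite !linearZ /= scale_lfunE scalerA mulrC.
by apply/AhomsP=> a; rewrite tens_module_actE e coact_counit.
Qed.

Definition tens_unitl (M : lmodule A) :
    Ahom (tens_module (unit_module H) M) M :=
  Subvs (tens_unitl_subproof M).

Fact tens_unitr_subproof (X : lmodule H) :
  tunitr X \in Ahoms (tensH X (unit_module H)) X.
Proof.
have e t : (tunitr X \o tact (lm_act X) (unit_act H) t)%VF =
    (lm_act X (tlift (fun h h' => (counit H h' : k) *: h) t) \o tunitr X)%VF.
  elim/tens_ind: t => [|h a t IH].
    by rewrite !linear0 comp_lfun0l comp_lfun0r.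
  rewrite !linearD /= comp_lfunDl comp_lfunDr IH; congr (_ + _).
  apply: tens_ext => c m; rewrite !comp_lfunE tliftE; last first.
    by split=> [?|?] d x y; rewrite linearP ?scalerDl ?scalerDr ?scalerA // mulrC.
  rewrite tactE tmapE unit_actE scale_lfunE id_lfunE !tunitrE.
  by rewrite !linearZ /= scale_lfunE scalerA mulrC.
by apply/AhomsP=> h; rewrite tensH_actE e counitr.
Qed.

Definition tens_unitr (X : lmodule H) :
    Ahom (tensH X (unit_module H)) X :=
  Subvs (tens_unitr_subproof X).

Fact tens_hom_bilinear (X X' : lmodule H) (M M' : lmodule A) :
  bilin (@tens_hom H A X X' M M').
Proof.
by split=> [g|f] c x y; apply/val_inj; rewrite /= ?tmapPl ?tmapPr.
Qed.

Fact tens_hom_id (X : lmodule H) (M : lmodule A) :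
  tens_hom (Ahom_id X) (Ahom_id M) = Ahom_id (tens_module X M).
Proof. by apply/val_inj; rewrite /= tmap1. Qed.

Fact tens_hom_comp (X X' X'' : lmodule H) (M M' M'' : lmodule A)
    (f' : Ahom X' X'') (f : Ahom X X') (g' : Ahom M' M'') (g : Ahom M M') :
  tens_hom (Ahom_comp f' f) (Ahom_comp g' g) =
  Ahom_comp (tens_hom f' g') (tens_hom f g).
Proof. by apply/val_inj; rewrite /= tmap_comp. Qed.

Fact tens_unitl_iso (M : lmodule A) : is_iso (C := modules A) (tens_unitl M).
Proof. by apply: Ahom_iso; [apply: tunitlK | apply: tunitlVK]. Qed.

Fact tens_unitr_iso (X : lmodule H) : is_iso (C := modules H) (tens_unitr X).
Proof. by apply: Ahom_iso; [apply: tunitrK | apply: tunitrVK]. Qed.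

Fact tens_unitl_nat (M M' : lmodule A) (f : Ahom M M') :
  Ahom_comp (tens_unitl M') (tens_hom (Ahom_id (unit_module H)) f) =
  Ahom_comp f (tens_unitl M).
Proof.
apply/val_inj; rewrite /=; apply: tens_ext => c m.
by rewrite !comp_lfunE tmapE !tunitlE id_lfunE linearZ.
Qed.

Fact tens_unitr_nat (X X' : lmodule H) (f : Ahom X X') :
  Ahom_comp (tens_unitr X')
    (tensH_hom f (Ahom_id (unit_module H))) =
  Ahom_comp f (tens_unitr X).
Proof.
apply/val_inj; rewrite /=; apply: tens_ext => x c.
by rewrite !comp_lfunE tmapE !tunitrE id_lfunE linearZ.
Qed.

Fact tens_pentagon (X Y Z : lmodule H) (M : lmodule A) :
  Ahom_comp (tens_assoc X Y (tens_module Z M))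
    (tens_assoc (tensH X Y) Z M) =
  Ahom_comp
    (Ahom_comp (tens_hom (Ahom_id X) (tens_assoc Y Z M))
       (tens_assoc X (tensH Y Z) M))
    (tens_hom (tens_assoc (A := RH) X Y Z : Ahom (A := H) _ _) (Ahom_id M)).
Proof.
apply/val_inj; rewrite /=; apply: tens_ext4 => x y z m.
by rewrite !comp_lfunE !(tassocE, tmapE, id_lfunE).
Qed.

Fact tens_triangle (X : lmodule H) (M : lmodule A) :
  Ahom_comp (tens_hom (Ahom_id X) (tens_unitl M))
    (tens_assoc X (unit_module H) M) =
  tens_hom (tens_unitr X) (Ahom_id M).
Proof.
apply/val_inj; rewrite /=; apply: tens_ext3 => x c m.
by rewrite !comp_lfunE !(tassocE, tmapE, id_lfunE) tunitlE tunitrE tpureZl tpureZr.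
Qed.

End ComodModules.

Definition rep (H : hopfAlgebra k) : monCat k :=
  @MonCat k (modules H) (@tensH H) (@tensH_hom H)
    (@tens_hom_bilinear H (regular_comod H)) (@tens_hom_id H (regular_comod H))
    (@tens_hom_comp H (regular_comod H)) (unit_module H)
    (@tens_assoc H (regular_comod H)) (@tens_unitl H (regular_comod H))
    (@tens_unitr H)
    (@tens_assoc_iso H (regular_comod H)) (@tens_unitl_iso H (regular_comod H))
    (@tens_unitr_iso H)
    (@tens_assoc_nat H (regular_comod H)) (@tens_unitl_nat H (regular_comod H))
    (@tens_unitr_nat H)
    (@tens_pentagon H (regular_comod H)) (@tens_triangle H (regular_comod H)).

Definition comod_modules (H : hopfAlgebra k) (A : comodAlgebra H) :
    moduleCat (rep H) :=
  @ModuleCat k (rep H) (modules A) (@tens_module H A) (@tens_hom H A)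
    (@tens_hom_bilinear H A) (@tens_hom_id H A) (@tens_hom_comp H A)
    (@tens_assoc H A) (@tens_unitl H A)
    (@tens_assoc_iso H A) (@tens_unitl_iso H A)
    (@tens_assoc_nat H A) (@tens_unitl_nat H A)
    (@tens_pentagon H A) (@tens_triangle H A).

Definition equivariant_Morita (H : hopfAlgebra k) (A B : comodAlgebra H) : Prop :=
  module_equivalent (comod_modules A) (comod_modules B).

End Modules.

Section ExactModuleCategories.
Variable k : fieldType.

(* A k-linear category is finite (abelian) if it is equivalent to the category
   of finite-dimensional modules over a finite-dimensional algebra, as in
   Etingof-Gelaki-Nikshych-Ostrik, Tensor Categories, Section 1.8.  A [falgType]
   is nonzero, so the zero category is excluded. *)
Definition finite_linCat (C : linCat k) : Prop :=
  exists (R : falgType k) (F : linFunctor C (modules R)), is_equivalence F.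

Definition nontrivial_linCat (C : linCat k) : Prop :=
  exists X : C, cid X <> 0.

Definition action_exact (C : monCat k) (N : moduleCat C) : Prop :=
  forall (X Y Z : C) (f : chom X Y) (g : chom Y Z) (P : N),
    short_exact f g -> short_exact (ahom f (cid P)) (ahom g (cid P)).

(* Exactness of the action in the second variable is automatic when objects of
   C have duals, as they do in [rep H]. *)
Definition finite_moduleCat (C : monCat k) (N : moduleCat C) : Prop :=
  finite_linCat N /\ action_exact N.

Definition exact_moduleCat (C : monCat k) (N : moduleCat C) : Prop :=
  forall (P : C) (Q : N), projective P -> projective (aob P Q).

Definition indecomposable_moduleCat (C : monCat k) (N : moduleCat C) : Prop :=
  nontrivial_linCat N /\
  ~ exists N1 N2 : moduleCat C,
      [/\ finite_moduleCat N1 /\ nontrivial_linCat N1,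
          finite_moduleCat N2 /\ nontrivial_linCat N2 &
          module_equivalent N (sum_moduleCat N1 N2)].

Definition complete_AM_representatives (H : hopfAlgebra k)
    (X : comodAlgebra H -> Prop) : Prop :=
  (forall A, X A -> AM_exact A) /\
  (forall N : moduleCat (rep H),
     finite_moduleCat N -> exact_moduleCat N -> indecomposable_moduleCat N ->
   exists2 A, X A & module_equivalent N (comod_modules A)).

Definition Loewy_over (H : coradGradedHopf k)
    (X0 : comodAlgebra (coradical_part H) -> Prop) (A : LoewyGraded H) : Prop :=
  exists2 B, X0 B & comod_iso (comod_deg0 A) B.

End ExactModuleCategories.

(* Main.v *)
(* Let A0 = A(0).  It is right H0-simple with trivial coinvariants, so its
   modules form a finite exact indecomposable module category over H0-mod, which
   by completeness is equivalent to C-mod for some C in X0.  Transporting the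
   comodule (C, lambda) over the coalgebra H0 of H0-mod along the equivalence
   gives a relative Hopf module Q over A0 with C = End_A0(Q)^op as comodule
   algebras.

   The coaction embeds Q into H (x) Q, on which A acts through A -> A0 on the
   second factor; let Q' be the graded A-submodule generated by Q there.  Then
   B = End_A(Q')^op is a graded H-comodule algebra with B(0) = End_A0(Q)^op = C,
   and it is Loewy-graded because H (x) Q is cofree.  It is equivariantly Morita
   equivalent to A because Q' is a progenerator: over a right simple comodule
   algebra every nonzero relative Hopf module is one.  This last fact, which also
   gives exactness of A0-mod, is proved by counting dimensions: the ratio
   dim Hom_A(Q', W) / dim W is the same for all A-modules W. *)

Require Import Defs.
From HB Require Import structures.
From mathcomp Require Import all_boot all_algebra all_field.
From mathcomp Require Import zify.
From Stdlib Require Import Classical.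

Set Implicit Arguments.
Unset Strict Implicit.
Unset Printing Implicit Defensive.

Import GRing.Theory.
Local Open Scope ring_scope.

(** Everything rests on one natural map, [str] :
    $X\otimes\mathrm{Hom}_A(Q,M)\to\mathrm{Hom}_A(Q,X\otimes M)$, for a relative Hopf module $Q$.
    The antipode makes it injective over any comodule algebra, and this inequality drives the
    dimension count. For right simple $A$ the count yields, besides projectivity and generation,
    that [str] is bijective; its inverse is then both the source of the coaction on
    $\mathrm{End}_A(Q)^{op}$ and the module functor structure of $\mathrm{Hom}_A(Q,-)$.

    The obstacle is that completeness of $X_0$ gives an equivalence over $H_0$ only. Encoding it by
    a relative Hopf module turns it into something that can be induced: $Q'$ is generated by $Q$ in
    degree zero, so a morphism out of $Q'$ is determined by its values on $Q$, and identities in $B$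
    are checked there. Right simplicity serves twice: for $A(0)$ to get exactness, and for $A$ to
    make $Q'$ a progenerator. *)

Local Notation dimT V := (\dim {:V}%VS).

(** * Linear algebra and tensor products *)


Section LinearAlgebra.
Variable k : fieldType.
Import VectorInternalTheory.
Implicit Types U V W X Y Z : vectType k.

Lemma dimT_le_inj U V (f : 'Hom(U, V)) : injective f -> (dimT U <= dimT V)%N.
Proof.
move=> /lker0P/eqP f0; have <- : \dim (limg f) = dimT U.
  by apply: limg_dim_eq; rewrite f0 capv0.
exact/dimvS/subvf.
Qed.

Lemma dimT_ge_surj U V (f : 'Hom(U, V)) :
  (forall v, exists u, f u = v) -> (dimT V <= dimT U)%N.
Proof.
move=> fs; have := limg_ker_dim f fullv.
have -> : limg f = fullv.
  by apply/vspaceP=> v; rewrite memvf; have [u <-] := fs v; rewrite memv_img ?memvf.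
by move<-; rewrite leq_addl.
Qed.

Lemma dimT_subvs V (U : {vspace V}) : dimT (subvs_of U) = \dim U.
Proof. by rewrite dimvf. Qed.

Lemma dimT_tens U V : dimT (tens U V) = (dimT U * dimT V)%N.
Proof. by rewrite !dimvf [LHS]dim_matrix. Qed.

Lemma dimT_hom U V : dimT 'Hom(U, V) = (dimT U * dimT V)%N.
Proof. by rewrite !dimvf. Qed.

Lemma dimT_gt0 V (v : V) : v != 0 -> (0 < dimT V)%N.
Proof.
move=> v0; rewrite lt0n dimv_eq0; apply: contra v0 => /eqP V0.
by rewrite -memv0 -V0 memvf.
Qed.

Lemma dimT_gt0_ex V : (0 < dimT V)%N -> exists v : V, v != 0.
Proof. by rewrite lt0n dimv_eq0 -vpick0 => v0; exists (vpick {:V}%VS). Qed.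

Lemma dim_ker_img U V (f : 'Hom(U, V)) :
  (\dim (lker f) + \dim (limg f) = dimT U)%N.
Proof. by rewrite -(limg_ker_dim f fullv) capfv. Qed.

Lemma inj_dim_surj U V (f : 'Hom(U, V)) :
  injective f -> dimT U = dimT V -> forall v, exists u, f u = v.
Proof.
move=> fi dUV v; have : limg f = fullv.
  apply/eqP; rewrite eqEdim subvf /= -dUV.
  by rewrite limg_dim_eq // (eqP (introT lker0P fi)) capv0.
by move=> e; have := memvf v; rewrite -e => /memv_imgP[u _ ->]; exists u.
Qed.

Lemma tpureDl U V (u u' : U) (v : V) : (u + u') \ox v = u \ox v + u' \ox v.
Proof. by rewrite -[u]scale1r tpurePl !scale1r. Qed.

Lemma tpureDr U V (u : U) (v v' : V) : u \ox (v + v') = u \ox v + u \ox v'.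
Proof. by rewrite -[v]scale1r tpurePr !scale1r. Qed.

Lemma tpure_suml U V I (r : seq I) (F : I -> U) (v : V) :
  (\sum_(i <- r) F i) \ox v = \sum_(i <- r) F i \ox v.
Proof. by elim/big_rec2: _ => [|i y x _ <-]; rewrite ?tpure0l ?tpureDl. Qed.

Lemma tpure_sumr U V I (r : seq I) (u : U) (F : I -> V) :
  u \ox (\sum_(i <- r) F i) = \sum_(i <- r) u \ox F i.
Proof. by elim/big_rec2: _ => [|i y x _ <-]; rewrite ?tpure0r ?tpureDr. Qed.

(** The slice map $\xi\otimes\mathrm{id}$. With $\xi$ the counit it expresses the counit axiom; with
    $\xi$ running over coordinates it reduces statements about $U\otimes V$ to statements about
    $V$. *)
Definition tev U V (xi : 'Hom(U, k^o)) : 'Hom(tens U V, V) :=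
  tlift (fun u v => (xi u : k) *: v).

Lemma tevE U V (xi : 'Hom(U, k^o)) (u : U) (v : V) :
  tev V xi (u \ox v) = (xi u : k) *: v.
Proof.
rewrite tliftE //; split=> [?|?] c x y; last by rewrite scalerDr !scalerA mulrC.
by rewrite linearP scalerDl scalerA.
Qed.

Lemma tens_extE U V W (f g : 'Hom(tens U V, W)) :
  (forall u v, f (u \ox v) = g (u \ox v)) -> f =1 g.
Proof. by move/tens_ext->. Qed.

Definition coordf U (i : 'I_(dim U)) : 'Hom(U, k^o) :=
  linfun (fun u => v2r u 0 i : k^o).

Lemma coordfE U (i : 'I_(dim U)) (u : U) : coordf i u = v2r u 0 i.
Proof. by rewrite linfun_linear // => c x y; rewrite linearP !mxE. Qed.

Lemma tens_slices U V (t : tens U V) :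
  t = \sum_i tbasis i \ox tev V (coordf i) t.
Proof.
elim/tens_ind: t => [|u v t IH].
  by rewrite big1 // => i _; rewrite linear0 tpure0r.
under eq_bigr => i _ do rewrite linearD tpureDr.
rewrite big_split -IH /=; congr (_ + _).
rewrite {1}(tbasis_sum u) tpure_suml; apply: eq_bigr => i _.
by rewrite tevE coordfE tpureZr tpureZl.
Qed.

Lemma tens0_slices U V (t : tens U V) :
  (forall i, tev V (coordf i) t = 0) -> t = 0.
Proof.
by move=> t0; rewrite [t]tens_slices big1 // => i _; rewrite t0 tpure0r.
Qed.

Lemma tev_tmap U V V' (xi : 'Hom(U, k^o)) (g : 'Hom(V, V')) t :
  tev V' xi (tmap \1 g t) = g (tev V xi t).
Proof.
rewrite -!comp_lfunE; congr (fun_of_lfun _ _); apply: tens_ext => u v.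
by rewrite !comp_lfunE tmapE !tevE id_lfunE linearZ.
Qed.

Lemma tens_sum_seq U V (t : tens U V) :
  exists s : seq (U * V), t = \sum_(p <- s) p.1 \ox p.2.
Proof.
elim/tens_ind: t => [|u v _ [s ->]]; first by exists [::]; rewrite big_nil.
by exists ((u, v) :: s); rewrite big_cons.
Qed.

Lemma tmapDl U U' V V' (f f' : 'Hom(U, U')) (g : 'Hom(V, V')) :
  tmap (f + f') g = tmap f g + tmap f' g.
Proof. by rewrite -[f]scale1r tmapPl !scale1r. Qed.

Lemma tmapDr U U' V V' (f : 'Hom(U, U')) (g g' : 'Hom(V, V')) :
  tmap f (g + g') = tmap f g + tmap f g'.
Proof. by rewrite -[g]scale1r tmapPr !scale1r. Qed.

Lemma tmap0l U U' V V' (g : 'Hom(V, V')) : tmap (0 : 'Hom(U, U')) g = 0.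
Proof. by apply: tens_ext => u v; rewrite tmapE !zero_lfunE tpure0l. Qed.

Lemma tmap0r U U' V V' (f : 'Hom(U, U')) : tmap f (0 : 'Hom(V, V')) = 0.
Proof. by apply: tens_ext => u v; rewrite tmapE !zero_lfunE tpure0r. Qed.

Lemma tmap_suml U U' V V' I (r : seq I) (F : I -> 'Hom(U, U')) (g : 'Hom(V, V')) :
  tmap (\sum_(i <- r) F i) g = \sum_(i <- r) tmap (F i) g.
Proof. by elim/big_rec2: _ => [|i y x _ <-]; rewrite ?tmap0l ?tmapDl. Qed.

Lemma tmap_sumr U U' V V' I (r : seq I) (f : 'Hom(U, U')) (G : I -> 'Hom(V, V')) :
  tmap f (\sum_(i <- r) G i) = \sum_(i <- r) tmap f (G i).
Proof. by elim/big_rec2: _ => [|i y x _ <-]; rewrite ?tmap0r ?tmapDr. Qed.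

Lemma tmap_inj U U' V V' (f : 'Hom(U, U')) (g : 'Hom(V, V')) :
  injective f -> injective g -> injective (tmap f g).
Proof.
by move=> /lker0P f0 /lker0P g0; apply: tmap_sectionK; apply: lker0_compVf.
Qed.

Lemma memv_tensv U V (U' : {vspace U}) (V' : {vspace V}) u v :
  u \in U' -> v \in V' -> u \ox v \in tensv U' V'.
Proof.
move=> /coord_vbasis-> /coord_vbasis->.
rewrite tpure_suml; apply: memv_suml => i _; rewrite tpure_sumr; apply: memv_suml => j _.
rewrite tpureZl tpureZr !memvZ // memv_span //; apply/allpairsP.
by exists ((vbasis U')`_i, (vbasis V')`_j); rewrite !mem_nth // size_tuple.
Qed.

Lemma tensv_ind U V (U' : {vspace U}) (V' : {vspace V}) W (f g : 'Hom(tens U V, W)) :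
  (forall u v, u \in U' -> v \in V' -> f (u \ox v) = g (u \ox v)) ->
  {in tensv U' V', f =1 g}.
Proof.
move=> fg t; suff /subvP h : (tensv U' V' <= lker (f - g))%VS by move/h/eqlfunP.
apply/span_subvP=> _ /allpairsP[[u v] /= [uU vV ->]].
by apply/eqlfunP/fg; apply: vbasis_mem.
Qed.

Lemma tensv_sub U V (U' : {vspace U}) (V' : {vspace V}) (T : {vspace tens U V}) :
  (forall u v, u \in U' -> v \in V' -> u \ox v \in T) -> (tensv U' V' <= T)%VS.
Proof.
move=> h; apply/span_subvP=> _ /allpairsP[[u v] /= [uU vV ->]].
by apply: h; apply: vbasis_mem.
Qed.

Lemma memv_tensv_slices U V (V' : {vspace V}) (t : tens U V) :
  (forall i, tev V (coordf i) t \in V') -> t \in tensv fullv V'.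
Proof.
move=> h; rewrite [t]tens_slices; apply: memv_suml => i _.
by apply: memv_tensv; rewrite ?memvf.
Qed.

Lemma exists_section U V (f : 'Hom(U, V)) :
  (forall v, exists u, f u = v) -> (f \o f^-1 = \1)%VF.
Proof.
move=> fs; apply/lfunP=> v; rewrite comp_lfunE id_lfunE; apply: limg_lfunVK.
by have [u <-] := fs v; rewrite memv_img ?memvf.
Qed.

End LinearAlgebra.

(** * Relative Hopf modules *)

Section RegularModule.
Variables (k : fieldType) (A : falgType k).

Definition reg_act : 'Hom(A, 'End(A)) := linfun (@amull k A).

Lemma reg_actE a x : reg_act a x = a * x.
Proof. by rewrite /reg_act lfunE /= lfunE. Qed.

Fact reg_act1 : reg_act 1 = \1%VF.
Proof. by apply/lfunP=> x; rewrite reg_actE id_lfunE mul1r. Qed.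

Fact reg_actM a b : reg_act (a * b) = (reg_act a \o reg_act b)%VF.
Proof. by apply/lfunP=> x; rewrite comp_lfunE !reg_actE mulrA. Qed.

Definition reg_module : lmodule A := LModule reg_act1 reg_actM.

Lemma reg_module_actE a (x : reg_module) : lm_act reg_module a x = a * x :> A.
Proof. exact: reg_actE. Qed.

Lemma AhomE (M N : lmodule A) (f : Ahom M N) a m :
  vsval f (lm_act M a m) = lm_act N a (vsval f m).
Proof. by have /AhomsP/(_ a)/lfunP/(_ m) := subvsP f; rewrite !comp_lfunE. Qed.

Lemma AhomP (M N : lmodule A) (f : 'Hom(M, N)) :
  (forall a m, f (lm_act M a m) = lm_act N a (f m)) -> f \in Ahoms M N.
Proof. by move=> h; apply/AhomsP=> a; apply/lfunP=> m; rewrite !comp_lfunE h. Qed.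

Lemma Ahom_eqP (M N : lmodule A) (f g : Ahom M N) :
  (forall m, vsval f m = vsval g m) -> f = g.
Proof. by move=> h; apply/val_inj/lfunP. Qed.

Lemma lm_act1E (M : lmodule A) m : lm_act M 1 m = m.
Proof. by rewrite lm_act1 id_lfunE. Qed.

Lemma lm_actME (M : lmodule A) a b m : lm_act M (a * b) m = lm_act M a (lm_act M b m).
Proof. by rewrite lm_actM comp_lfunE. Qed.

Definition ev_lfun (M : lmodule A) (m : M) : 'Hom(A, M) :=
  linfun (fun a => lm_act M a m).

Lemma ev_lfunE (M : lmodule A) (m : M) a : ev_lfun m a = lm_act M a m.
Proof. by rewrite linfun_linear // => c x y; rewrite linearP add_lfunE scale_lfunE. Qed.

Fact ev_subproof (M : lmodule A) (m : M) : ev_lfun m \in Ahoms reg_module M.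
Proof. by apply: AhomP => a x; rewrite /= !ev_lfunE reg_actE lm_actME. Qed.

(** The identification of $M$ with $\mathrm{Hom}_A(A,M)$; it lets elements enter constructions that
    take morphisms, such as [tens_hom]. *)
Definition ev (M : lmodule A) (m : M) : Ahom reg_module M := Subvs (ev_subproof m).

Lemma evE (M : lmodule A) (m : M) a : vsval (ev m) a = lm_act M a m.
Proof. exact: ev_lfunE. Qed.

Lemma ev_linear (M : lmodule A) : linear (@ev M).
Proof.
move=> c x y; apply: Ahom_eqP => a.
by rewrite /= add_lfunE scale_lfunE !ev_lfunE linearP.
Qed.

Lemma amulrE (a x : A) : amulr a x = x * a.
Proof. by rewrite /amulr lfunE. Qed.

Lemma ev_reg (a : A) : ev_lfun (a : reg_module) = amulr a :> 'End(A).
Proof. by apply/lfunP=> x; rewrite amulrE; have := ev_lfunE (a : reg_module) x; rewrite reg_actE. Qed.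

End RegularModule.

Section HopfModules.
Variables (k : fieldType) (H : hopfAlgebra k) (A : comodAlgebra H).
Local Notation RH := (reg_module H).

(* The objects of {}^H_A M, seen as comodules over the coalgebra H of [rep H]
   in the module category _A M. *)
Record hopfModule := HopfModule {
  hm_mod :> lmodule A;
  hm_co : Ahom hm_mod (tens_module RH hm_mod);
  hm_coA : forall q : hm_mod,
    tassoc _ _ _ (tmap (comult H) \1 (vsval hm_co q)) =
    tmap \1 (vsval hm_co) (vsval hm_co q);
  hm_counit : forall q : hm_mod, tev _ (counit H) (vsval hm_co q) = q }.

Variable Q : hopfModule.
Implicit Types (X : lmodule H) (M N W : lmodule A).
Local Notation del := (vsval (hm_co Q)).

Lemma tens_act_pure X M a (s : seq (H * A)) x m :
  coact A a = \sum_(p <- s) p.1 \ox p.2 ->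
  lm_act (tens_module X M) a (x \ox m) =
  \sum_(p <- s) lm_act X p.1 x \ox lm_act M p.2 m.
Proof.
move=> e; rewrite tens_module_actE e linear_sum sum_lfunE.
by apply: eq_bigr => p _; rewrite /= tactE tmapE.
Qed.

(* x (x) f |-> (q |-> q_(-1) x (x) f(q_(0))) *)
Definition str X M : 'Hom(tens X (Ahom Q M), Ahom Q (tens_module X M)) :=
  tlift (fun x f => Ahom_comp (tens_hom (ev x) f) (hm_co Q)).

Lemma strE X M x (f : Ahom Q M) :
  str X M (x \ox f) = Ahom_comp (tens_hom (ev x) f) (hm_co Q).
Proof.
rewrite tliftE //; split=> [g|y] c u v.
  by rewrite ev_linear (tens_hom_bilinear _ _ _ _).1 (Ahom_comp_bilinear _ _ _).1.
by rewrite (tens_hom_bilinear _ _ _ _).2 (Ahom_comp_bilinear _ _ _).1.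
Qed.

Lemma strEq X M x (f : Ahom Q M) q :
  vsval (str X M (x \ox f)) q = tmap (ev_lfun x) (vsval f) (del q).
Proof. by rewrite strE /= comp_lfunE. Qed.

Let mu X M : 'Hom(tens H (tens X M), tens X M) :=
  tlift (fun h t => tmap (lm_act X (antipode H h)) \1 t).

Let muE X M h t : mu X M (h \ox t) = tmap (lm_act X (antipode H h)) \1 t.
Proof.
rewrite tliftE //; split=> [?|?] c x y; rewrite ?linearP //.
by rewrite tmapPl add_lfunE scale_lfunE.
Qed.

Let str_ev X M (q : Q) : 'Hom(tens X (Ahom Q M), tens X M) :=
  tmap \1 (linfun (fun f : Ahom Q M => vsval f q)).

Let str_evE X M (q : Q) x f : str_ev X M q (x \ox f) = x \ox vsval f q.
Proof.
rewrite tmapE id_lfunE linfun_linear // => c u v.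
by rewrite /= add_lfunE scale_lfunE.
Qed.

(* S(q_(-2)) q_(-1) x (x) f(q_(0)) = x (x) f(q): a left inverse of [str]. *)
Let str_retract X M t q : mu X M (tmap \1 (vsval (str X M t)) (del q)) = str_ev X M q t.
Proof.
elim/tens_ind: t => [|x f t IH].
  by rewrite !linear0 tmap0r zero_lfunE linear0.
rewrite !linearD /= tmapDr add_lfunE linearD /= IH; congr (_ + _).
(* Coassociativity replaces the second coaction by $\Delta$, so that $q_{(-2)}$ and $q_{(-1)}$ come
   from a single comultiplication and the antipode axiom applies. *)
have -> : tmap \1 (vsval (str X M (x \ox f))) (del q) =
    tmap \1 (tmap (ev_lfun x) (vsval f))
      (tassoc _ _ _ (tmap (comult H) \1 (del q))).
  by rewrite strE /= hm_coA -[RHS]comp_lfunE tmap_comp comp_lfun1l.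
rewrite str_evE -[q in RHS]hm_counit; move: (del q) => s.
elim/tens_ind: s => [|h v s IHs]; first by rewrite !linear0 tpure0r.
rewrite !linearD /= IHs tpureDr; congr (_ + _).
rewrite tmapE id_lfunE tevE linearZ tpureZr -tpureZl /=.
have <- : lm_act X (tlift (fun a b => antipode H a * b) (comult H h)) x =
    (counit H h : k) *: x by rewrite antipodel linearZ scale_lfunE lm_act1E.
elim/tens_ind: (comult H h) => [|a b u IHu].
  by rewrite !(tpure0l, linear0, zero_lfunE).
rewrite tpureDl !linearD /= add_lfunE tpureDl IHu; congr (_ + _).
rewrite tassocE !tmapE id_lfunE muE tmapE id_lfunE ev_lfunE -lm_actME.
rewrite tliftE //; split=> [?|?] c y z; first by rewrite linearP mulrDl scalerAl.
by rewrite mulrDr scalerAr.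
Qed.

(** By [str_retract], [str t = 0] makes the evaluation of $t$ at every $q$ vanish in $X\otimes M$;
    slicing along a basis of $X$ then kills the components of $t$ in $\mathrm{Hom}_A(Q,M)$. *)
Lemma str_inj X M : injective (str X M).
Proof.
apply/lker0P; rewrite -subv0; apply/subvP=> t; rewrite memv_ker memv0 => /eqP t0.
apply/eqP/tens0_slices => i; apply: Ahom_eqP => q.
have := str_retract t q; rewrite t0 linear0.
rewrite tmap0r zero_lfunE linear0.
move/esym/(congr1 (tev M (coordf i))); rewrite tev_tmap linear0 linfun_linear.
  by move->; rewrite zero_lfunE.
by move=> c u v; rewrite /= add_lfunE scale_lfunE.
Qed.

End HopfModules.

(** * Submodules, quotients and powers *)

Section InducedModules.
Variables (k : fieldType) (A : falgType k).
Implicit Types (M N P W : lmodule A) (V : vectType k).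

Section Along.
Variables (V : vectType k) (W : lmodule A).

(** Serves submodules and quotients alike: one of [i], [j] is the given map and the other its
    generalized inverse, which is then a one-sided inverse. *)
Definition conj_act (j : 'Hom(W, V)) (i : 'Hom(V, W)) : 'Hom(A, 'End(V)) :=
  linfun (fun a => (j \o lm_act W a \o i)%VF).

Lemma conj_actE j i a v : conj_act j i a v = j (lm_act W a (i v)).
Proof.
rewrite /conj_act linfun_linear ?comp_lfunE //= ?comp_lfunE //.
move=> c x y; apply/lfunP=> u.
by rewrite !(linearP, comp_lfunE, add_lfunE, scale_lfunE).
Qed.

Section Sub.
Variables (i : 'Hom(V, W)) (i_inj : injective i)
  (i_st : forall a v, lm_act W a (i v) \in limg i).

Fact sub_act1 : conj_act i^-1 i 1 = \1%VF.
Proof.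
apply/lfunP=> v; rewrite conj_actE lm_act1E id_lfunE lker0_lfunK //.
exact/lker0P.
Qed.

Fact sub_actM a b :
  conj_act i^-1 i (a * b) = (conj_act i^-1 i a \o conj_act i^-1 i b)%VF.
Proof.
apply/lfunP=> v; rewrite comp_lfunE !conj_actE lm_actME.
by rewrite [X in _ = _ (lm_act W a X)]limg_lfunVK.
Qed.

Definition sub_module : lmodule A := LModule sub_act1 sub_actM.

Fact sub_module_incl_subproof : (i : 'Hom(sub_module, W)) \in Ahoms sub_module W.
Proof. by apply: AhomP => a v; rewrite /= conj_actE limg_lfunVK. Qed.

Definition sub_module_incl : Ahom sub_module W := Subvs sub_module_incl_subproof.

End Sub.

Section Quotient.
Variables (p : 'Hom(W, V)) (p_surj : forall v, exists w, p w = v)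
  (p_st : forall a w, p w = 0 -> p (lm_act W a w) = 0).

Let pK v : p ((p^-1)%VF v) = v.
Proof. by rewrite -comp_lfunE exists_section // id_lfunE. Qed.

Let p_act a w : p (lm_act W a ((p^-1)%VF (p w))) = p (lm_act W a w).
Proof. by apply/eqP; rewrite -subr_eq0 -!linearB /= p_st ?linearB /= ?pK ?subrr. Qed.

Fact quot_act1 : conj_act p p^-1 1 = \1%VF.
Proof. by apply/lfunP=> v; rewrite conj_actE lm_act1E id_lfunE pK. Qed.

Fact quot_actM a b :
  conj_act p p^-1 (a * b) = (conj_act p p^-1 a \o conj_act p p^-1 b)%VF.
Proof. by apply/lfunP=> v; rewrite comp_lfunE !conj_actE lm_actME p_act. Qed.

Definition quot_module : lmodule A := LModule quot_act1 quot_actM.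

Fact quot_module_proj_subproof : (p : 'Hom(W, quot_module)) \in Ahoms W quot_module.
Proof. by apply: AhomP => a v; rewrite /= conj_actE p_act. Qed.

Definition quot_module_proj : Ahom W quot_module := Subvs quot_module_proj_subproof.

End Quotient.
End Along.

Lemma submodule_ex W (U : {vspace W}) :
    (forall a w, w \in U -> lm_act W a w \in U) ->
  exists N (i : Ahom N W), injective (vsval i) /\ limg (vsval i) = U.
Proof.
move=> st; pose i : 'Hom(subvs_of U, W) := linfun vsval.
have iE v : i v = vsval v by rewrite lfunE.
have i_inj : injective i by move=> x y; rewrite !iE => /val_inj.
have i_img : limg i = U.
  apply/vspaceP=> w; apply/memv_imgP/idP; first by case=> u _ ->; rewrite iE subvsP.
  by move=> wU; exists (vsproj U w); rewrite ?memvf // iE vsprojK.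
have i_st a v : lm_act W a (i v) \in limg i by rewrite i_img st // iE subvsP.
by exists (sub_module i_inj i_st), (sub_module_incl i_inj i_st).
Qed.

Lemma quotient_ex W (U : {vspace W}) :
    (forall a w, w \in U -> lm_act W a w \in U) ->
  exists N (p : Ahom W N), (forall n, exists w, vsval p w = n) /\
    (forall w, vsval p w = 0 <-> w \in U).
Proof.
move=> st; pose p : 'Hom(W, subvs_of (U^C)%VS) :=
  (linfun (vsproj (U^C)%VS) \o daddv_pi (U^C) U)%VF.
have capC : (U^C :&: U = 0)%VS by rewrite capvC capv_compl.
have pE w : vsval (p w) = daddv_pi (U^C) U w.
  by rewrite comp_lfunE lfunE /= vsprojK ?memv_pi.
have p_surj v : exists w, p w = v.
  by exists (vsval v); apply: val_inj; rewrite /= pE daddv_pi_id ?subvsP.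
have p0 w : p w = 0 <-> w \in U.
  have wE : daddv_pi (U^C) U w + daddv_pi U (U^C) w = w.
    by apply: daddv_pi_add; rewrite // addvC addv_complf memvf.
  split=> [/(congr1 val)|wU]; first by rewrite /= pE -{2}wE => ->; rewrite add0r memv_pi.
  apply: val_inj; rewrite /= pE; apply/eqP; rewrite -memv0 -capC memv_cap memv_pi.
  by move/(canRL (addrK _)): wE => ->; rewrite memvB ?memv_pi.
have p_st a w : p w = 0 -> p (lm_act W a w) = 0 by rewrite !p0; apply: st.
by exists (quot_module p_surj p_st), (quot_module_proj p_surj p_st).
Qed.

Lemma Ahom_factor_inj M N W (i : Ahom N W) (f : Ahom M W) :
    injective (vsval i) -> (forall m, vsval f m \in limg (vsval i)) ->
  exists g : Ahom M N, Ahom_comp i g = f.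
Proof.
move=> i_inj fi.
have fE m : vsval i (((vsval i)^-1 \o vsval f)%VF m) = vsval f m.
  by rewrite comp_lfunE limg_lfunVK.
have gA : ((vsval i)^-1 \o vsval f)%VF \in Ahoms M N.
  by apply: AhomP => a m; apply: i_inj; rewrite AhomE !fE AhomE.
by exists (Subvs gA); apply: Ahom_eqP => m; rewrite /= comp_lfunE fE.
Qed.

Lemma Ahom_factor_surj M N W (p : Ahom W N) (f : Ahom W M) :
    (forall n, exists w, vsval p w = n) ->
    (forall w, vsval p w = 0 -> vsval f w = 0) ->
  exists g : Ahom N M, Ahom_comp g p = f.
Proof.
move=> p_surj pf; have pK v : vsval p (((vsval p)^-1)%VF v) = v.
  by rewrite -comp_lfunE exists_section // id_lfunE.
have fE w : (vsval f \o (vsval p)^-1)%VF (vsval p w) = vsval f w.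
  apply/eqP; rewrite -subr_eq0 comp_lfunE -linearB; apply/eqP/pf.
  by rewrite linearB /= pK subrr.
have gA : (vsval f \o (vsval p)^-1)%VF \in Ahoms N M.
  by apply: AhomP => a n; have [w <-] := p_surj n; rewrite -AhomE !fE AhomE.
by exists (Subvs gA); apply: Ahom_eqP => m; rewrite /= -fE !comp_lfunE.
Qed.

Definition postcomp Q M N (g : Ahom M N) : 'Hom(Ahom Q M, Ahom Q N) :=
  linfun (@Ahom_comp k A Q M N g).

Lemma postcompE Q M N (g : Ahom M N) f : postcomp Q g f = Ahom_comp g f.
Proof. by rewrite linfun_linear //; apply: (Ahom_comp_bilinear _ _ _).2. Qed.

Definition short_exact_seq N W P (i : Ahom N W) (p : Ahom W P) : Prop :=
  [/\ injective (vsval i), forall n, exists w, vsval p w = n &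
      forall w, vsval p w = 0 <-> w \in limg (vsval i)].

Lemma ses_dim N W P (i : Ahom N W) (p : Ahom W P) :
  short_exact_seq i p -> dimT W = (dimT N + dimT P)%N.
Proof.
case=> i_inj p_surj ip; rewrite -(dim_ker_img (vsval p)).
have -> : lker (vsval p) = limg (vsval i).
  by apply/vspaceP=> w; rewrite memv_ker; apply/eqP/idP => /ip.
rewrite limg_dim_eq ?(eqP (introT lker0P i_inj)) ?capv0 //; congr (_ + \dim _)%N.
by apply/vspaceP=> v; rewrite memvf; have [u <-] := p_surj v; rewrite memv_img ?memvf.
Qed.

(** Left exactness of $\mathrm{Hom}_A(Q,-)$. The rank of the last map is kept, rather than bounded
    by $\dim\mathrm{Hom}_A(Q,P)$, because lifting along [p] is later deduced from it. *)
Lemma ses_hom_dim Q N W P (i : Ahom N W) (p : Ahom W P) :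
  short_exact_seq i p ->
  (dimT (Ahom Q W) <= dimT (Ahom Q N) + \dim (limg (postcomp Q p)))%N.
Proof.
case=> i_inj p_surj ip; rewrite -(dim_ker_img (postcomp Q p)) leq_add2r.
have : (lker (postcomp Q p) <= limg (postcomp Q i))%VS.
  apply/subvP=> f; rewrite memv_ker postcompE => /eqP/(congr1 vsval) /= pf.
  have [|g <-] := @Ahom_factor_inj _ _ _ i f i_inj; last first.
    by rewrite -postcompE memv_img ?memvf.
  by move=> m; apply/ip; rewrite -comp_lfunE pf zero_lfunE.
move/dimvS/leq_trans; apply.
by rewrite -(dim_ker_img (postcomp Q i)) leq_addl.
Qed.

Lemma ses_sub W (U : {vspace W}) : (forall a w, w \in U -> lm_act W a w \in U) ->
  exists N P (i : Ahom N W) (p : Ahom W P),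
    short_exact_seq i p /\ limg (vsval i) = U.
Proof.
move=> st; have [N [i [i_inj iU]]] := submodule_ex st.
have [P [p [p_surj pU]]] := quotient_ex st.
by exists N, P, i, p; split=> //; split=> // w; rewrite iU.
Qed.

Lemma ses_inj N W (i : Ahom N W) : injective (vsval i) ->
  exists P (p : Ahom W P), short_exact_seq i p.
Proof.
move=> i_inj; have st a w : w \in limg (vsval i) -> lm_act W a w \in limg (vsval i).
  by case/memv_imgP=> v _ ->; rewrite -AhomE memv_img ?memvf.
have [P [p [p_surj pU]]] := quotient_ex st.
by exists P, p; split.
Qed.

Lemma ses_surj W P (p : Ahom W P) : (forall n, exists w, vsval p w = n) ->
  exists N (i : Ahom N W), short_exact_seq i p.
Proof.
move=> p_surj; have st a w : w \in lker (vsval p) -> lm_act W a w \in lker (vsval p).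
  by rewrite !memv_ker AhomE => /eqP->; rewrite linear0.
have [N [i [i_inj iU]]] := submodule_ex st.
exists N, i; split=> // w; rewrite iU memv_ker; split=> [->|/eqP] //.
Qed.

Definition hom_act V W : 'Hom(A, 'End('Hom(V, W))) :=
  linfun (fun a => linfun (fun g : 'Hom(V, W) => (lm_act W a \o g)%VF)).

Lemma hom_actE V W a (g : 'Hom(V, W)) v : hom_act V W a g v = lm_act W a (g v).
Proof.
have lin2 b : linear (fun g : 'Hom(V, W) => (lm_act W b \o g)%VF).
  by move=> c x y; rewrite comp_lfunDr comp_lfunZr.
have lin1 : linear (fun a => linfun (fun g : 'Hom(V, W) => (lm_act W a \o g)%VF)).
  move=> c x y; apply/lfunP=> h; rewrite add_lfunE scale_lfunE !linfun_linear //.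
  by rewrite linearP comp_lfunDl comp_lfunZl.
by rewrite /hom_act (linfun_linear lin1) (linfun_linear (lin2 a)) comp_lfunE.
Qed.

Fact hom_act1 V W : hom_act V W 1 = \1%VF.
Proof. by apply/lfunP=> g; apply/lfunP=> v; rewrite hom_actE lm_act1E id_lfunE. Qed.

Fact hom_actM V W a b : hom_act V W (a * b) = (hom_act V W a \o hom_act V W b)%VF.
Proof.
by apply/lfunP=> g; apply/lfunP=> v; rewrite comp_lfunE !hom_actE lm_actME.
Qed.

(** The power $W^{\dim V}$ in coordinate-free form: with $V=W$, the action map $A\to\mathrm{End}(V)$
    is itself a morphism from $A$ into this power. *)
Definition hom_module V W : lmodule A := LModule (hom_act1 V W) (hom_actM V W).

Lemma hom_module_actE V W a (g : hom_module V W) v :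
  (lm_act (hom_module V W) a g : 'Hom(V, W)) v = lm_act W a ((g : 'Hom(V, W)) v).
Proof. exact: hom_actE. Qed.

Lemma hom_module_eqP V W (g h : hom_module V W) :
  (forall v, (g : 'Hom(V, W)) v = (h : 'Hom(V, W)) v) -> g = h.
Proof. by move=> gh; apply/(lfunP (g : 'Hom(V, W)))/gh. Qed.

(** Exchanging arguments embeds $\mathrm{Hom}(V,\mathrm{Hom}_A(Q,W))$ into
    $\mathrm{Hom}_A(Q,\mathrm{Hom}(V,W))$. *)
Lemma hom_module_dim Q V W :
  (dimT V * dimT (Ahom Q W) <= dimT (Ahom Q (hom_module V W)))%N.
Proof.
have flin (G : 'Hom(V, Ahom Q W)) q : linear (fun v => vsval (G v) q).
  by move=> c x y; rewrite linearP /= add_lfunE scale_lfunE.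
have flin2 (G : 'Hom(V, Ahom Q W)) :
    linear (fun q => linfun (fun v => vsval (G v) q) : 'Hom(V, W)).
  move=> c x y; apply/lfunP=> v.
  by rewrite add_lfunE scale_lfunE !linfun_linear // linearP.
have fA (G : 'Hom(V, Ahom Q W)) :
    linfun (fun q => linfun (fun v => vsval (G v) q) : hom_module V W)
      \in Ahoms Q (hom_module V W).
  apply: AhomP => a q; apply: hom_module_eqP => v; rewrite hom_module_actE.
  by rewrite !(linfun_linear (flin2 G)) !(linfun_linear (flin G _)) AhomE.
pose F (G : 'Hom(V, Ahom Q W)) := Subvs (fA G).
have FE G q v : (vsval (F G) q : 'Hom(V, W)) v = vsval (G v) q.
  by rewrite /F [vsval _]/= (linfun_linear (flin2 G)) (linfun_linear (flin G _)).
have Flin : linear F.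
  move=> c G G'; apply: Ahom_eqP => q; apply: hom_module_eqP => v.
  by rewrite FE [vsval (c *: _ + _)]/= !(add_lfunE, scale_lfunE) !FE.
rewrite -dimT_hom; apply: (@dimT_le_inj _ _ _ (linfun F)) => G G'.
rewrite !(linfun_linear Flin) => e; apply/lfunP=> v; apply: Ahom_eqP => q.
by rewrite -!FE e.
Qed.

End InducedModules.

Section FreeCover.
Variables (k : fieldType) (A : falgType k) (W : lmodule A).
Import VectorInternalTheory.
Local Notation F := (hom_module W (reg_module A)).

(** A map $g$ stands for the family of coefficients $g(e_i)$, so this is the free cover $A^{\dim
    W}\to W$ on the basis $(e_i)$. *)
Let cover_fun (g : F) : W := \sum_i lm_act W ((g : 'Hom(W, A)) (tbasis i)) (tbasis i).

Let cover_linear : linear cover_fun.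
Proof.
move=> c g h; rewrite /cover_fun scaler_sumr -big_split; apply: eq_bigr => i _ /=.
have -> : (c *: g + h : 'Hom(W, A)) (tbasis i) =
    c *: (g : 'Hom(W, A)) (tbasis i) + (h : 'Hom(W, A)) (tbasis i).
  by rewrite add_lfunE scale_lfunE.
by rewrite linearP add_lfunE scale_lfunE.
Qed.

Let cover_in : linfun cover_fun \in Ahoms F W.
Proof.
apply: AhomP => a g; rewrite !(linfun_linear cover_linear) /cover_fun linear_sum.
apply: eq_bigr => i _; rewrite /= -lm_actME; congr (lm_act W _ _).
by have := hom_module_actE a g (tbasis i); rewrite /= reg_actE.
Qed.

Definition free_cover : Ahom F W := Subvs cover_in.

Lemma free_coverE (g : F) :
  vsval free_cover g = \sum_i lm_act W ((g : 'Hom(W, A)) (tbasis i)) (tbasis i).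
Proof. exact: (linfun_linear cover_linear). Qed.

Lemma free_cover_surj w : exists g, vsval free_cover g = w.
Proof.
(* Pairing with the coordinates of [w], so that $g(e_i)$ is the scalar $w_i$. *)
pose g : 'Hom(W, A) := linfun (fun u : W => (\sum_i v2r u 0 i * v2r w 0 i)%:A).
have gE u : g u = (\sum_i v2r u 0 i * v2r w 0 i)%:A.
  rewrite /g linfun_linear // => c x y; rewrite linearP scalerA -scalerDl.
  congr (_ *: _); rewrite mulr_sumr -big_split; apply: eq_bigr => i _ /=.
  by rewrite !mxE mulrDl mulrA.
exists g; rewrite free_coverE [RHS]tbasis_sum; apply: eq_bigr => i _.
have -> : (g : 'Hom(W, A)) (tbasis i) = (v2r w 0 i)%:A.
  rewrite gE (bigD1 i) //= big1 => [|j ji].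
    by rewrite r2vK mxE !eqxx mul1r addr0.
  by rewrite r2vK mxE (negPf ji) andbF mul0r.
by rewrite linearZ scale_lfunE lm_act1E.
Qed.

End FreeCover.

(** * Relative Hopf modules over simple comodule algebras are progenerators *)

Lemma bounded_max (P : nat -> Prop) (B : nat) :
    (exists n, P n) -> (forall n, P n -> (n <= B)%N) ->
  exists2 n, P n & forall m, P m -> (m <= n)%N.
Proof.
case=> n0 Pn0 PB; have [b bP] : exists b, forall n, P n -> (n <= b)%N by exists B.
elim: b bP => [|b IH] bP.
  by exists n0 => // m /bP; rewrite leqn0 => /eqP->.
have [Pb|nPb] := classic (P b.+1); first by exists b.+1.
apply: IH => n Pn; have := bP n Pn; rewrite leq_eqVlt ltnS => /orP[/eqP e|//].
by rewrite e in Pn.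
Qed.

(* The dimension ratio is subadditive in W.  If it is maximal at [W0] then, by
   [str_inj], it is also maximal at H (x) W0, which is faithful as A is simple;
   so A embeds in a power of it, and the ratio is maximal at A and everywhere. *)
Section Skryabin.
Variables (k : fieldType) (H : hopfAlgebra k) (A : comodAlgebra H).
Import VectorInternalTheory.
Hypothesis A_simple : right_simple A.
Implicit Types (M N W : lmodule A).
Local Notation RH := (reg_module H).

(** The annihilator of $H\otimes W$ consists of the $b$ with $b_{(-1)}\otimes b_{(0)}w=0$ for all
    $w$. It is a right ideal and, by coassociativity, stable under the coaction, so it is $0$ or
    $A$; the latter is excluded because $1$ fixes a nonzero $w$. *)
Lemma tens_reg_faithful W a : (0 < dimT W)%N ->
  (forall t, lm_act (tens_module RH W) a t = 0) -> a = 0.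
Proof.
move=> W_gt0 a0.
pose evw (w : W) : 'Hom(A, W) := ev_lfun w.
have annP b : (forall t, lm_act (tens_module RH W) b t = 0) <->
    (forall w, tmap \1 (evw w) (coact A b) = 0).
  have E w h : lm_act (tens_module RH W) b (h \ox w) =
      tmap (amulr h) \1 (tmap \1 (evw w) (coact A b)).
    rewrite tens_module_actE; elim/tens_ind: (coact A b) => [|x y t IH].
      by rewrite !linear0 zero_lfunE.
    rewrite !linearD /= add_lfunE IH; congr (_ + _).
    by rewrite tactE !tmapE !id_lfunE /evw ev_lfunE amulrE /= reg_actE.
  split=> [b0 w|b0 t]; last first.
    elim/tens_ind: t => [|h w t IH]; first by rewrite linear0.
    by rewrite linearD /= IH E b0 linear0 addr0.
  have := b0 (1 \ox w); rewrite E (_ : amulr 1 = \1%VF) ?tmap1 ?id_lfunE //.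
  by apply/lfunP=> h; rewrite amulrE mulr1 id_lfunE.
pose J : {vspace A} := lker (lm_act (tens_module RH W)).
have JP b : b \in J <-> (forall t, lm_act (tens_module RH W) b t = 0).
  rewrite memv_ker; split=> [/eqP-> t|b0]; first by rewrite zero_lfunE.
  by apply/eqP/lfunP=> t; rewrite b0 zero_lfunE.
suff [J0|Jf] : J = 0%VS \/ J = fullv.
- by apply/eqP; rewrite -memv0 -J0; apply/JP.
- have [w w0] := dimT_gt0_ex W_gt0.
  have /JP/annP/(_ w) : (1 : A) \in J by rewrite Jf memvf.
  rewrite coact1 tmapE id_lfunE [evw w 1]ev_lfunE lm_act1E.
  move/(congr1 (tev W (counit H))); rewrite linear0 tevE counit1 scale1r => w00.
  by rewrite w00 eqxx in w0.
apply: A_simple.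
  apply/prodvP=> b c /JP b0 _; apply/JP => t.
  by rewrite lm_actME b0.
apply/subvP=> _ /memv_imgP[b /JP/annP b0 ->]; apply: memv_tensv_slices => i.
apply/JP/annP => w.
(* Membership of a slice of $\lambda(b)$ involves a second coaction. Coassociativity trades it for
   $\Delta$ on the first factor, which then acts on $b_{(-1)}\otimes b_{(0)}w=0$. *)
have <- : tev _ (coordf i) (tmap \1 (tmap \1 (evw w)) (tmap \1 (coact A) (coact A b))) =
    tmap \1 (evw w) (coact A (tev A (coordf i) (coact A b))).
  by rewrite !tev_tmap.
rewrite -coactA; have /lfunP/(_ (tmap (comult H) \1 (coact A b))) :=
  tassoc_nat (\1 : 'End(H)) (\1 : 'End(H)) (evw w).
rewrite !comp_lfunE tmap1 => <-; rewrite -[tmap _ _ (tmap _ _ _)]comp_lfunE.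
rewrite tmap_comp comp_lfun1l comp_lfun1r.
rewrite (_ : tmap _ _ = (tmap (comult H) \1 \o tmap \1 (evw w))%VF).
  by rewrite comp_lfunE b0 !linear0.
by rewrite tmap_comp comp_lfun1r comp_lfun1l.
Qed.

Variable Q : hopfModule A.
Local Notation hd W := (dimT (Ahom Q W)).

(** Up to dimension $\dim A$ only finitely many ratios occur, so one is largest. Larger modules
    cannot exceed it, since they are extensions by a cyclic submodule, whose dimension is at most
    $\dim A$. *)
Lemma hom_dim_ratio_max : exists W0 : lmodule A, (0 < dimT W0)%N /\
  forall W, (hd W * dimT W0 <= hd W0 * dimT W)%N.
Proof.
pose D := dimT A; pose R := reg_module A.
have D_gt0 : (0 < D)%N by apply: (dimT_gt0 (v := 1)); apply: oner_neq0.
(* Multiplying the ratios by $D!$ clears all denominators up to $D$, so a maximum can be taken among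
   natural numbers. *)
pose P n := exists2 W : lmodule A, (0 < dimT W <= D)%N &
  n = (hd W * (D`! %/ dimT W))%N.
have fE d : (0 < d <= D)%N -> (D`! %/ d * d = D`!)%N.
  by move=> dD; rewrite divnK // dvdn_fact.
have hd_le W : (hd W <= dimT Q * dimT W)%N.
  by rewrite dimT_subvs -dimT_hom; apply/dimvS/subvf.
have [|_ [W WD ->]|n [W0 W0D ->] nmax] := @bounded_max P (dimT Q * D * D`!)%N.
- by exists (hd R * (D`! %/ dimT R))%N, R; rewrite // D_gt0 leqnn.
- apply: leq_mul; last by rewrite leq_div.
  by apply: leq_trans (hd_le W) _; rewrite leq_mul2l; case/andP: WD => _ ->; rewrite orbT.
have W0_gt0 : (0 < dimT W0)%N by case/andP: W0D.
exists W0; split=> // W.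
have [m] := ubnP (dimT W); elim: m W => // m IH W; rewrite ltnS => Wm.
have [W0'|W_gt0] := posnP (dimT W).
  by have := hd_le W; rewrite W0' muln0 leqn0 => /eqP->.
have [WD|WD] := leqP (dimT W) D.
  have /nmax : P (hd W * (D`! %/ dimT W))%N by exists W; rewrite // W_gt0.
  set e := (D`! %/ dimT W)%N; set e0 := (D`! %/ dimT W0)%N.
  have eE : (e * dimT W = e0 * dimT W0)%N by rewrite !fE // W_gt0.
  have e_gt0 : (0 < e * dimT W)%N by rewrite fE ?fact_gt0 ?W_gt0.
  move/(leq_mul (leqnn (dimT W * dimT W0)%N)) => h; rewrite -(leq_pmul2l e_gt0).
  have -> : (e * dimT W * (hd W * dimT W0) = dimT W * dimT W0 * (hd W * e))%N by lia.
  apply: leq_trans h _; rewrite {1}eE; lia.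
(* Here $\dim W>D$, so the nonzero submodule $Aw$ is proper and induction applies to it and to the
   quotient. *)
have [w w0] := dimT_gt0_ex W_gt0.
have st a v : v \in limg (ev_lfun w) -> lm_act W a v \in limg (ev_lfun w).
  by case/memv_imgP=> b _ ->; rewrite ev_lfunE -lm_actME -ev_lfunE memv_img ?memvf.
have [N [M [i [p [ex iU]]]]] := ses_sub st.
have dW := ses_dim ex; have := ses_hom_dim Q ex.
have N_gt0 : (0 < dimT N)%N.
  rewrite lt0n dimv_eq0; apply: contra w0 => /eqP N0.
  have : w \in limg (vsval i) by rewrite iU -[w in w \in _](lm_act1E) -ev_lfunE memv_img ?memvf.
  by rewrite N0 limg0 memv0.
have N_le : (dimT N <= D)%N.
  have : (\dim (limg (vsval i)) <= D)%N.
    by rewrite iU /D -(dim_ker_img (ev_lfun w)) leq_addl.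
  by case: ex => i_inj _ _; rewrite limg_dim_eq // (eqP (introT lker0P i_inj)) capv0.
have IHN := IH N (leq_ltn_trans N_le (leq_trans WD Wm)).
have IHM : (hd M * dimT W0 <= hd W0 * dimT M)%N.
  by apply: IH; apply: leq_trans Wm; rewrite dW -addn1 addnC leq_add2r.
have pM : (\dim (limg (postcomp Q p)) <= hd M)%N by apply/dimvS/subvf.
move=> le; rewrite dW mulnDr; apply: leq_trans (leq_add IHN IHM).
by rewrite -mulnDl leq_mul2r (leq_trans le) ?orbT // leq_add2l.
Qed.

Lemma hom_dim_ratio : exists h0 d0, (0 < d0)%N /\
  forall W, (hd W * d0 = h0 * dimT W)%N.
Proof.
have [W0 [W0_gt0 hmax]] := hom_dim_ratio_max.
pose V0 := tens_module RH W0; pose W1 := hom_module V0 V0.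
exists (hd W0), (dimT W0); split=> //.
pose tight W := (hd W * dimT W0 = hd W0 * dimT W)%N.
(* Both ends obey the maximal bound; if the middle term attains it, subadditivity leaves no slack
   and both ends attain it too. *)
have tight_ses N W P (i : Ahom N W) (p : Ahom W P) :
    short_exact_seq i p -> tight W -> tight N /\ tight P.
  move=> ex; rewrite /tight (ses_dim ex) mulnDr => e.
  have le : (hd W <= hd N + hd P)%N.
    apply: leq_trans (ses_hom_dim Q ex) _; rewrite leq_add2l.
    exact/dimvS/subvf.
  have := hmax N; have := hmax P.
  have : (hd W * dimT W0 <= (hd N + hd P) * dimT W0)%N by rewrite leq_mul2r le orbT.
  by rewrite e mulnDl; lia.
have hV0 : (dimT H * hd W0 <= hd V0)%N.
  by rewrite -dimT_tens; apply: dimT_le_inj (@str_inj _ _ _ Q RH W0).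
(* The ratio of $V_0$ is at least that of $W_0$ by [str_inj], and passing to a power does not lower
   it. *)
have tightW1 : tight W1.
  apply/eqP; rewrite eqn_leq hmax /= dimT_hom.
  apply: leq_trans (_ : dimT V0 * hd V0 * dimT W0 <= _)%N.
    have eV : dimT V0 = (dimT H * dimT W0)%N := dimT_tens _ _.
    have := leq_mul (leqnn (dimT V0 * dimT W0)) hV0.
    set v := dimT V0 in eV *; set hv := hd V0; set h0 := hd W0.
    by rewrite {3}eV; lia.
  by rewrite leq_mul2r hom_module_dim orbT.
(* Faithfulness of $V_0$ makes this an embedding of $A$ into a tight module, so that $A$ is tight;
   then free modules are tight, and so are all their quotients. *)
have rhoA : (lm_act V0 : 'Hom(A, W1)) \in Ahoms (reg_module A) W1.
  apply: AhomP => a x; apply: hom_module_eqP => v.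
  by rewrite hom_module_actE /= reg_actE -[LHS]/(lm_act V0 (a * x) v) lm_actME.
have tightA : tight (reg_module A).
  pose rho : Ahom (reg_module A) W1 := Subvs rhoA.
  have [|P [p ex]] := @ses_inj _ _ _ _ rho; last by case: (tight_ses _ _ _ _ _ ex).
  move=> a b /= ab; apply/eqP; rewrite -subr_eq0; apply/eqP.
  apply: (tens_reg_faithful W0_gt0) => t.
  have := congr1 (fun f : 'End(V0) => f t) ab.
  by rewrite linearB add_lfunE opp_lfunE => ->; rewrite subrr.
move=> W; have tightWA : tight (hom_module W (reg_module A)).
  apply/eqP; rewrite eqn_leq hmax /= dimT_hom.
  apply: leq_trans (_ : dimT W * hd (reg_module A) * dimT W0 <= _)%N.
    by rewrite -mulnA tightA mulnCA.
  by rewrite leq_mul2r hom_module_dim orbT.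
have [N [i ex]] := ses_surj (@free_cover_surj k A W).
by case: (tight_ses _ _ _ _ _ ex).
Qed.

(** As $\dim\mathrm{Hom}_A(Q,W)$ is proportional to $\dim W$, it is additive on short exact
    sequences; together with left exactness this leaves no room for a cokernel, so $Q$ is
    projective. *)
Lemma hopf_module_lift M N (e : Ahom M N) : (forall n, exists m, vsval e m = n) ->
  forall f : Ahom Q N, exists g : Ahom Q M, Ahom_comp e g = f.
Proof.
move=> e_surj f; have [h0 [d0 [d0_gt0 hE]]] := hom_dim_ratio.
have [K [i ex]] := ses_surj e_surj.
have : limg (postcomp Q e) = fullv.
  apply/eqP; rewrite eqEdim subvf /= -(leq_pmul2r d0_gt0) hE.
  have := ses_hom_dim Q ex; rewrite -(leq_pmul2r d0_gt0) hE mulnDl hE.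
  by rewrite (ses_dim ex) mulnDr leq_add2l.
by have := memvf f => /[swap] <- /memv_imgP[g _ ->]; exists g; rewrite postcompE.
Qed.

(** The functionals are the coordinates of a splitting of the free cover of $Q$. *)
Lemma hopf_module_dual_basis :
  exists s : seq (Ahom Q (reg_module A) * Q),
    forall q, q = \sum_(p <- s) lm_act Q (vsval p.1 q) p.2.
Proof.
have [g gE] := hopf_module_lift (@free_cover_surj k A Q) (Ahom_id Q).
have lin i : linear (fun q => (vsval g q : 'Hom(Q, A)) i).
  by move=> c x y; rewrite linearP add_lfunE scale_lfunE.
have uA i : (linfun (fun q => (vsval g q : 'Hom(Q, A)) i) : 'Hom(Q, reg_module A))
    \in Ahoms Q (reg_module A).
  by apply: AhomP => a q; rewrite !(linfun_linear (lin i)) AhomE; apply: hom_module_actE.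
exists [seq (Subvs (uA (tbasis i)) : Ahom Q (reg_module A), tbasis i) |
         i <- index_enum 'I_(dim Q)] => q.
rewrite big_map -[LHS]id_lfunE -[\1%VF]/(vsval (Ahom_id Q)) -gE /= comp_lfunE.
rewrite [LHS](free_coverE (vsval g q)); apply: eq_bigr => i _.
by rewrite /= (linfun_linear (lin _)).
Qed.

(** Every $Q\to A$ takes values in the trace ideal $T$, so $\mathrm{Hom}_A(Q,A)$ and
    $\mathrm{Hom}_A(Q,T)$ have the same dimension. The constant of proportionality is positive
    because $\mathrm{id}_Q\neq0$; hence $\dim T=\dim A$. *)
Lemma hopf_module_generator : (0 < dimT Q)%N ->
  exists s : seq (Ahom Q (reg_module A) * Q),
    \sum_(p <- s) vsval p.1 p.2 = 1 :> A.
Proof.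
move=> Q_gt0; have [h0 [d0 [d0_gt0 hE]]] := hom_dim_ratio; pose R := reg_module A.
have h0_gt0 : (0 < h0)%N.
  have [q q0] := dimT_gt0_ex Q_gt0.
  have : (0 < hd Q)%N.
    apply: (dimT_gt0 (v := Ahom_id Q)); apply: contra q0 => /eqP/(congr1 vsval) /= e.
    by rewrite -[q]id_lfunE e zero_lfunE.
  by move=> hQ; have := hE Q; case: h0 {hE} => //; lia.
pose evT : 'Hom(tens (Ahom Q R) Q, R) := tlift (fun (f : Ahom Q R) q => vsval f q).
have evTE f q : evT (f \ox q) = vsval f q.
  rewrite tliftE //; split=> [w|w] c x y; rewrite ?linearP //=.
  by rewrite add_lfunE scale_lfunE.
have st a w : w \in limg evT -> lm_act R a w \in limg evT.
  case/memv_imgP=> t _ ->; elim/tens_ind: t => [|f q t IH].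
    by rewrite !linear0 mem0v.
  have e : lm_act R a (evT (f \ox q)) = evT (f \ox lm_act Q a q).
    by rewrite !evTE AhomE.
  by rewrite !linearD memvD //; move: e => /= ->; rewrite memv_img ?memvf.
have [N [P [i [p [ex iU]]]]] := ses_sub st; have [i_inj _ _] := ex.
suff : (1 : A) \in limg evT.
  case/memv_imgP=> t _ ->; have [s ->] := tens_sum_seq t; exists s.
  by rewrite linear_sum; apply: eq_bigr => j _; rewrite /= evTE.
have : (hd R <= hd N)%N.
  apply: (@dimT_ge_surj _ _ _ (postcomp Q i)) => f.
  have [|g <-] := @Ahom_factor_inj _ _ _ _ _ i f i_inj; last by exists g; rewrite postcompE.
  by move=> q; rewrite iU -evTE memv_img ?memvf.
rewrite -(leq_pmul2r d0_gt0) !hE leq_pmul2l // => RN.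
have : limg evT = fullv; last by move->; rewrite memvf.
apply/eqP; rewrite eqEdim subvf /= -iU (leq_trans RN) //.
by rewrite limg_dim_eq // (eqP (introT lker0P i_inj)) capv0.
Qed.

End Skryabin.

(** * The opposite endomorphism algebra *)

Section EndAlgebra.
Variables (k : fieldType) (A : falgType k) (Q : lmodule A) (Q_gt0 : (0 < dimT Q)%N).

(** The proof that $Q\neq0$ is an index of the type, because the ring structure attached to it
    requires $1\neq0$. *)
Definition endop of (0 < dimT Q)%N : Type := Ahom Q Q.
Local Notation B := (endop Q_gt0).

HB.instance Definition _ := Vector.copy B (Ahom Q Q).

(** The opposite product makes precomposition a left action on $\mathrm{Hom}_A(Q,M)$. *)
Definition endop_mul (f g : B) : B := Ahom_comp g f.
Definition endop_one : B := Ahom_id Q.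

Fact endop_mulA : associative endop_mul.
Proof. by move=> f g h; rewrite /endop_mul Ahom_compA. Qed.

Fact endop_mul1l : left_id endop_one endop_mul.
Proof. by move=> f; apply: Ahom_comp1r. Qed.

Fact endop_mul1r : right_id endop_one endop_mul.
Proof. by move=> f; apply: Ahom_comp1l. Qed.

Fact endop_mulDl : left_distributive endop_mul +%R.
Proof.
by move=> f g h; have := (Ahom_comp_bilinear Q Q Q).2 h 1 f g; rewrite !scale1r.
Qed.

Fact endop_mulDr : right_distributive endop_mul +%R.
Proof.
by move=> f g h; have := (Ahom_comp_bilinear Q Q Q).1 f 1 g h; rewrite !scale1r.
Qed.

Fact endop_one_neq0 : endop_one != 0.
Proof.
have [q q0] := dimT_gt0_ex Q_gt0; apply: contra q0 => /eqP/(congr1 vsval) /= e.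
by rewrite -[q]id_lfunE e zero_lfunE.
Qed.

HB.instance Definition _ := GRing.Zmodule_isNzRing.Build B
  endop_mulA endop_mul1l endop_mul1r endop_mulDl endop_mulDr endop_one_neq0.

Fact endop_scaleAl (c : k) (f g : B) : c *: (f * g) = (c *: f) * g.
Proof.
by apply: Ahom_eqP => q; rewrite /= comp_lfunZr.
Qed.

Fact endop_scaleAr (c : k) (f g : B) : c *: (f * g) = f * (c *: g).
Proof. by apply: Ahom_eqP => q; rewrite /= comp_lfunZl. Qed.

HB.instance Definition _ := GRing.Lmodule_isLalgebra.Build k B endop_scaleAl.
HB.instance Definition _ := GRing.Lalgebra_isAlgebra.Build k B endop_scaleAr.
HB.instance Definition _ := Algebra_isFalgebra.Build k B.

End EndAlgebra.

(** * Coherence and bijectivity of $X\otimes\mathrm{Hom}_A(Q,M)\to\mathrm{Hom}_A(Q,X\otimes M)$ *)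

Section Structure.
Variables (k : fieldType) (H : hopfAlgebra k) (A : comodAlgebra H).
Variable Q : hopfModule A.
Implicit Types (X Y : lmodule H) (M N : lmodule A).
Local Notation RH := (reg_module H).
Local Notation del := (vsval (hm_co Q)).

Lemma str_natl X X' M (f : Ahom X X') t :
  str Q X' M (tmap (vsval f) \1 t) =
  Ahom_comp (tens_hom f (Ahom_id M)) (str Q X M t).
Proof.
rewrite -postcompE -!comp_lfunE; apply: tens_extE => {t} x g.
rewrite !comp_lfunE tmapE id_lfunE postcompE; apply: Ahom_eqP => q.
rewrite strEq /= comp_lfunE strEq -[RHS]comp_lfunE tmap_comp comp_lfun1l.
congr (tmap _ _ _); apply/lfunP=> h.
by rewrite comp_lfunE !ev_lfunE AhomE.
Qed.

Lemma str_natr X M N (g : Ahom M N) t :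
  str Q X N (tmap \1 (postcomp Q g) t) =
  Ahom_comp (tens_hom (Ahom_id X) g) (str Q X M t).
Proof.
rewrite -postcompE -!comp_lfunE; apply: tens_extE => {t} x f.
rewrite !comp_lfunE tmapE id_lfunE !postcompE; apply: Ahom_eqP => q.
by rewrite strEq /= comp_lfunE strEq -[RHS]comp_lfunE tmap_comp comp_lfun1l.
Qed.

Lemma ev_tensH X Y (x : X) (y : Y) :
  ev_lfun (x \ox y : tensH X Y) = (tmap (ev_lfun x) (ev_lfun y) \o comult H)%VF.
Proof.
apply/lfunP=> h; rewrite ev_lfunE tensH_actE comp_lfunE.
elim/tens_ind: (comult H h) => [|a b t IH]; first by rewrite !linear0 zero_lfunE.
rewrite !linearD /= add_lfunE IH; congr (_ + _).
by rewrite tactE !tmapE !ev_lfunE.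
Qed.

(** This is the coassociativity of $Q$, while [str_unit] below is its counit axiom. *)
Lemma str_assoc X Y M t :
  Ahom_comp (tens_assoc X Y M) (str Q (tensH X Y) M t) =
  str Q X (tens_module Y M) (tmap \1 (str Q Y M) (tassoc X Y (Ahom Q M) t)).
Proof.
rewrite -postcompE -!comp_lfunE; congr (fun_of_lfun _ t).
apply: tens_ext3 => {t} x y f.
rewrite !comp_lfunE postcompE tassocE tmapE id_lfunE; apply: Ahom_eqP => q.
rewrite strEq /= comp_lfunE (@strEq _ _ _ Q (tensH X Y) M (x \ox y) f) ev_tensH.
rewrite -{1}[vsval f]comp_lfun1r -tmap_comp.
rewrite comp_lfunE -[LHS]comp_lfunE tassoc_nat comp_lfunE hm_coA.
by rewrite -[LHS]comp_lfunE tmap_comp comp_lfun1r strE.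
Qed.

Lemma str_unit M t :
  Ahom_comp (tens_unitl M) (str Q (unit_module H) M t) = tunitl (Ahom Q M) t.
Proof.
rewrite -postcompE -!comp_lfunE; apply: tens_extE => {t} c f.
rewrite !comp_lfunE postcompE tunitlE; apply: Ahom_eqP => q.
rewrite /= comp_lfunE (@strEq _ _ _ Q (unit_module H) M c f) scale_lfunE.
rewrite -{2}[q]hm_counit; elim/tens_ind: (del q) => [|h p t IH].
  by rewrite !linear0.
rewrite !linearD /= IH; congr (_ + _).
rewrite tmapE tunitlE tevE (ev_lfunE (c : unit_module H)) /= unit_actE.
by rewrite scale_lfunE id_lfunE !linearZ /= !scalerA; congr (_ *: _); apply: mulrC.
Qed.

Hypothesis A_simple : right_simple A.

(** By [hom_dim_ratio], source and target of the injection [str] have the same dimension, as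
    $\dim(X\otimes M)=\dim X\cdot\dim M$. *)
Lemma str_surj X M g : exists t, str Q X M t = g.
Proof.
apply: inj_dim_surj (@str_inj _ _ _ Q X M) _ _.
have [h0 [d0 [d0_gt0 hE]]] := hom_dim_ratio A_simple Q.
apply/eqP; rewrite -(eqn_pmul2r d0_gt0) hE !dimT_tens.
by rewrite -mulnA hE mulnCA.
Qed.

Definition str_inv X M : 'Hom(Ahom Q (tens_module X M), tens X (Ahom Q M)) :=
  ((str Q X M)^-1)%VF.

Lemma str_invK X M g : str Q X M (str_inv X M g) = g.
Proof.
by apply: limg_lfunVK; have [t <-] := @str_surj X M g; rewrite memv_img ?memvf.
Qed.

Lemma strK X M t : str_inv X M (str Q X M t) = t.
Proof. by apply: str_inj; rewrite str_invK. Qed.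

End Structure.

(** * Morita equivalence *)

Section Morita.
Variables (k : fieldType) (A : falgType k).
Implicit Types (M N : lmodule A).

Fact Ahom_inv_subproof (C : falgType k) (M N : lmodule C) (f : Ahom M N) :
    injective (vsval f) -> (forall n, exists m, vsval f m = n) ->
  (vsval f)^-1%VF \in Ahoms N M.
Proof.
move=> f_inj f_surj; have fVK n : vsval f ((vsval f)^-1%VF n) = n.
  by rewrite -comp_lfunE exists_section // id_lfunE.
by apply: AhomP => a n; apply: f_inj; rewrite AhomE !fVK.
Qed.

Lemma Ahom_bij_iso (C : falgType k) (M N : lmodule C) (f : Ahom M N) :
    injective (vsval f) -> (forall n, exists m, vsval f m = n) ->
  is_iso (C := modules C) f.
Proof.
move=> f_inj f_surj; apply: (Ahom_iso (g := (vsval f)^-1%VF)).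
  by apply: lker0_compVf; apply/lker0P.
exact: exists_section.
Qed.

Variables (Q : lmodule A) (Q_gt0 : (0 < dimT Q)%N).
Local Notation B := (endop Q_gt0).
Local Notation RA := (reg_module A).

Definition homf_act M : 'Hom(B, 'End(Ahom Q M)) :=
  linfun (fun b : B => linfun (fun f : Ahom Q M => Ahom_comp f (b : Ahom Q Q))).

Lemma homf_actE M (b : B) (f : Ahom Q M) : homf_act M b f = Ahom_comp f (b : Ahom Q Q).
Proof.
have lin2 (b' : B) : linear (fun f : Ahom Q M => Ahom_comp f (b' : Ahom Q Q)).
  exact: (Ahom_comp_bilinear Q Q M).1.
rewrite /homf_act linfun_linear ?linfun_linear // => c x y; apply/lfunP=> g.
rewrite add_lfunE scale_lfunE !linfun_linear //.
exact: (Ahom_comp_bilinear Q Q M).2.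
Qed.

Fact homf_act1 M : homf_act M 1 = \1%VF.
Proof. by apply/lfunP=> f; rewrite homf_actE id_lfunE; apply: Ahom_comp1r. Qed.

Fact homf_actM M (a b : B) : homf_act M (a * b) = (homf_act M a \o homf_act M b)%VF.
Proof. by apply/lfunP=> f; rewrite comp_lfunE !homf_actE; apply: Ahom_compA. Qed.

Definition homf_module M : lmodule B := LModule (homf_act1 M) (homf_actM M).

Fact homf_hom_subproof M N (g : Ahom M N) :
  (postcomp Q g : 'Hom(homf_module M, homf_module N)) \in Ahoms (homf_module M) (homf_module N).
Proof. by apply: AhomP => b f; rewrite /= !homf_actE !postcompE Ahom_compA. Qed.

Definition homf_hom M N (g : Ahom M N) : Ahom (homf_module M) (homf_module N) := Subvs (homf_hom_subproof g).

Lemma homf_homE M N (g : Ahom M N) (f : Ahom Q M) : vsval (homf_hom g) f = Ahom_comp g f.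
Proof. exact: postcompE. Qed.

Fact homf_linear M N : linear (@homf_hom M N).
Proof.
move=> c f g; apply: Ahom_eqP => u; rewrite [vsval (c *: _ + _)]/=.
rewrite add_lfunE scale_lfunE !homf_homE; exact: (Ahom_comp_bilinear Q M N).1.
Qed.

Fact homf_id M : homf_hom (Ahom_id M) = Ahom_id (homf_module M).
Proof. by apply: Ahom_eqP => u; rewrite homf_homE /= id_lfunE Ahom_comp1l. Qed.

Fact homf_comp M N P (g : Ahom N P) (f : Ahom M N) :
  homf_hom (Ahom_comp g f) = Ahom_comp (homf_hom g) (homf_hom f).
Proof.
by apply: Ahom_eqP => u; rewrite [RHS]comp_lfunE !homf_homE Ahom_compA.
Qed.

Definition homFunctor : linFunctor (modules A) (modules B) :=
  @LinFunctor k (modules A) (modules B) homf_module homf_hom homf_linear homf_id homf_comp.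

Local Notation QA := (homf_module RA).

Lemma ev_comp M (a : A) (m : M) : Ahom_comp (ev m) (ev (a : RA)) = ev (lm_act M a m).
Proof.
by apply: Ahom_eqP => x; rewrite [LHS]comp_lfunE !evE reg_module_actE lm_actME.
Qed.

Lemma ev_natural M N (f : Ahom M N) (m : M) : Ahom_comp f (ev m) = ev (vsval f m).
Proof. by apply: Ahom_eqP => x; rewrite /= comp_lfunE !ev_lfunE AhomE. Qed.

(** The quasi-inverse is $\mathrm{Hom}_B(Q^\vee,-)$ with $Q^\vee=\mathrm{Hom}_A(Q,A)$, in place of
    $Q\otimes_B-$, so no tensor product over $B$ has to be formed. The algebra $A$ acts through
    right multiplication on the values of elements of $Q^\vee$. *)
Definition cohomf_act (N : lmodule B) : 'Hom(A, 'End(Ahom QA N)) :=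
  linfun (fun a : A => linfun (fun g : Ahom QA N => Ahom_comp g (homf_hom (ev (a : RA))))).

Lemma cohomf_actE (N : lmodule B) (a : A) (g : Ahom QA N) :
  cohomf_act N a g = Ahom_comp g (homf_hom (ev (a : RA))).
Proof.
have lin2 (a' : A) : linear (fun g : Ahom QA N => Ahom_comp g (homf_hom (ev (a' : RA)))).
  exact: (Ahom_comp_bilinear QA QA N).1.
rewrite /cohomf_act linfun_linear ?linfun_linear // => c x y; apply/lfunP=> h.
rewrite add_lfunE scale_lfunE !linfun_linear //.
rewrite [ev _](@ev_linear _ _ RA) homf_linear.
exact: (Ahom_comp_bilinear QA QA N).2.
Qed.

Fact cohomf_act1 (N : lmodule B) : cohomf_act N 1 = \1%VF.
Proof.
apply/lfunP=> g; rewrite cohomf_actE id_lfunE (_ : ev _ = Ahom_id RA).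
  by rewrite homf_id Ahom_comp1r.
by apply: Ahom_eqP => x; rewrite evE reg_module_actE mulr1 id_lfunE.
Qed.

Fact cohomf_actM (N : lmodule B) (a b : A) : cohomf_act N (a * b) = (cohomf_act N a \o cohomf_act N b)%VF.
Proof.
apply/lfunP=> g; rewrite comp_lfunE !cohomf_actE -Ahom_compA -homf_comp ev_comp.
by rewrite reg_module_actE.
Qed.

Definition cohomf_module (N : lmodule B) : lmodule A := LModule (cohomf_act1 N) (cohomf_actM N).

Fact cohomf_hom_subproof (M N : lmodule B) (g : Ahom M N) :
  (postcomp QA g : 'Hom(cohomf_module M, cohomf_module N)) \in Ahoms (cohomf_module M) (cohomf_module N).
Proof. by apply: AhomP => b f; rewrite /= !cohomf_actE !postcompE Ahom_compA. Qed.

Definition cohomf_hom (M N : lmodule B) (g : Ahom M N) : Ahom (cohomf_module M) (cohomf_module N) :=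
  Subvs (cohomf_hom_subproof g).

Lemma cohomf_homE (M N : lmodule B) (g : Ahom M N) (f : Ahom QA M) :
  vsval (cohomf_hom g) f = Ahom_comp g f.
Proof. exact: postcompE. Qed.

Fact cohomf_linear (M N : lmodule B) : linear (@cohomf_hom M N).
Proof.
move=> c f g; apply: Ahom_eqP => u; rewrite [vsval (c *: _ + _)]/=.
rewrite add_lfunE scale_lfunE !cohomf_homE; exact: (Ahom_comp_bilinear QA M N).1.
Qed.

Fact cohomf_id (M : lmodule B) : cohomf_hom (Ahom_id M) = Ahom_id (cohomf_module M).
Proof. by apply: Ahom_eqP => u; rewrite cohomf_homE /= id_lfunE Ahom_comp1l. Qed.

Fact cohomf_comp (M N P : lmodule B) (g : Ahom N P) (f : Ahom M N) :
  cohomf_hom (Ahom_comp g f) = Ahom_comp (cohomf_hom g) (cohomf_hom f).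
Proof.
by apply: Ahom_eqP => u; rewrite [RHS]comp_lfunE !cohomf_homE Ahom_compA.
Qed.

Definition coHomFunctor : linFunctor (modules B) (modules A) :=
  @LinFunctor k (modules B) (modules A) cohomf_module cohomf_hom cohomf_linear cohomf_id cohomf_comp.

Let eta_linear M : linear (fun m : M => homf_hom (ev m) : cohomf_module (homf_module M)).
Proof. by move=> c x y; rewrite ev_linear homf_linear. Qed.

Let eta_in M : linfun (fun m : M => homf_hom (ev m) : cohomf_module (homf_module M))
    \in Ahoms M (cohomf_module (homf_module M)).
Proof.
apply: AhomP => a m; rewrite !(linfun_linear (@eta_linear M)) /= cohomf_actE.
by rewrite -homf_comp ev_comp.
Qed.

Let eta M : Ahom M (cohomf_module (homf_module M)) := Subvs (@eta_in M).

Let etaE M m : vsval (eta M) m = homf_hom (ev m).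
Proof. exact: (linfun_linear (@eta_linear M)). Qed.

(* The Morita pairing with values in B. *)
Definition rank1 (u : Ahom Q RA) (q : Q) : B := Ahom_comp (ev q) u.

(** Innermost layer of $\kappa:N\to\mathrm{Hom}_A(Q,\mathrm{Hom}_B(Q^\vee,N))$, which maps $n$ to
    $q\mapsto(u\mapsto\langle u,q\rangle n)$ for the pairing [rank1]. The counit of the equivalence
    is obtained as the inverse of $\kappa$, since $\kappa$ is canonical whereas its inverse involves
    a dual basis. *)
Let kappa_fun (N : lmodule B) (n : N) (q : Q) : 'Hom(QA, N) :=
  linfun (fun u : QA => lm_act N (rank1 u q) n).

Let kappa_funE (N : lmodule B) (n : N) q u :
  kappa_fun n q u = lm_act N (rank1 u q) n.
Proof.
rewrite /kappa_fun linfun_linear // => c x y.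
rewrite /rank1 [Ahom_comp _ _](Ahom_comp_bilinear Q RA Q).2.
by rewrite linearP add_lfunE scale_lfunE.
Qed.

Let kappa_in1 (N : lmodule B) (n : N) q : kappa_fun n q \in Ahoms QA N.
Proof.
apply: AhomP => b u; rewrite !kappa_funE -lm_actME; congr (lm_act N _ n).
by rewrite /rank1 /= homf_actE; apply: Ahom_compA.
Qed.

Let kappa1 (N : lmodule B) (n : N) q : cohomf_module N := Subvs (kappa_in1 n q).

Let kappa1_linear (N : lmodule B) (n : N) : linear (kappa1 n).
Proof.
move=> c x y; apply: (@Ahom_eqP _ _ QA N) => u; rewrite [vsval (c *: _ + _)]/=.
rewrite add_lfunE scale_lfunE /= !kappa_funE /rank1 ev_linear.
rewrite [Ahom_comp _ _](Ahom_comp_bilinear Q RA Q).1.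
by rewrite linearP add_lfunE scale_lfunE.
Qed.

Let kappa_in2 (N : lmodule B) (n : N) : linfun (kappa1 n) \in Ahoms Q (cohomf_module N).
Proof.
apply: AhomP => a q; rewrite !(linfun_linear (kappa1_linear n)) /= cohomf_actE.
apply: (@Ahom_eqP _ _ QA N) => u; rewrite [RHS]comp_lfunE /= !kappa_funE homf_homE.
by rewrite /rank1 Ahom_compA ev_comp.
Qed.

Let kappa2 (N : lmodule B) (n : N) : homf_module (cohomf_module N) := Subvs (kappa_in2 n).

Let kappa2E (N : lmodule B) (n : N) q u :
  vsval (vsval (kappa2 n : Ahom Q (cohomf_module N)) q : Ahom QA N) u = lm_act N (rank1 u q) n.
Proof. by rewrite /kappa2 [vsval (Subvs _)]/= (linfun_linear (kappa1_linear n)) /= kappa_funE. Qed.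

Let kappa2_linear (N : lmodule B) : linear (@kappa2 N).
Proof.
move=> c x y; apply: (@Ahom_eqP _ _ Q (cohomf_module N)) => q.
apply: (@Ahom_eqP _ _ QA N) => u; rewrite kappa2E linearP [vsval (c *: _ + _)]/= add_lfunE scale_lfunE.
by rewrite [vsval (c *: _ + _)]/= add_lfunE scale_lfunE !kappa2E.
Qed.

Let kappa_in (N : lmodule B) : linfun (@kappa2 N) \in Ahoms N (homf_module (cohomf_module N)).
Proof.
apply: AhomP => b n; rewrite !(linfun_linear (@kappa2_linear N)) /= homf_actE.
apply: (@Ahom_eqP _ _ Q (cohomf_module N)) => q; apply: (@Ahom_eqP _ _ QA N) => u.
rewrite kappa2E [vsval (Ahom_comp _ _)]/= comp_lfunE kappa2E -lm_actME.
by congr (lm_act N _ n); rewrite /rank1 -ev_natural -Ahom_compA.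
Qed.

Let kappa (N : lmodule B) : Ahom N (homf_module (cohomf_module N)) := Subvs (@kappa_in N).

Let kappaE (N : lmodule B) n : vsval (kappa N) n = kappa2 n.
Proof. exact: (linfun_linear (@kappa2_linear N)). Qed.

Variable gen : seq (Ahom Q RA * Q).
Hypothesis genE : \sum_(p <- gen) vsval p.1 p.2 = 1 :> A.
Variable dual : seq (Ahom Q RA * Q).
Hypothesis dualE : forall q, q = \sum_(p <- dual) lm_act Q (vsval p.1 q) p.2.

(** As $1=\sum u(q)$ over [gen], $m$ is the sum of the $u(q)m$, and these are values of
    $\eta(m)$. *)
Let eta_inj M : injective (vsval (eta M)).
Proof.
apply/lker0P; rewrite -subv0; apply/subvP=> m; rewrite memv_ker memv0 etaE => /eqP m0.
rewrite -[m]lm_act1E -genE linear_sum sum_lfunE big1 // => -[u q] _ /=.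
have := congr1 (fun g : Ahom QA (homf_module M) => vsval (vsval g u : Ahom Q M) q) m0.
rewrite homf_homE [vsval (Ahom_comp _ _)]/= comp_lfunE evE => ->.
by rewrite !zero_lfunE.
Qed.

(** Mixed associativity of the Morita context: $\langle u,q\rangle v=u\cdot v(q)$. *)
Let ev_rank1 (u v : Ahom Q RA) (q : Q) :
  homf_act RA (rank1 u q) v = vsval (homf_hom (ev (vsval v q : RA))) u :> Ahom Q RA.
Proof. by rewrite homf_actE homf_homE -ev_natural /rank1 Ahom_compA. Qed.

Let homf_evE M (m : M) (u : Ahom Q RA) (q : Q) :
  vsval (vsval (homf_hom (ev m)) u : Ahom Q M) q = lm_act M (vsval u q) m.
Proof. by rewrite homf_homE [LHS]comp_lfunE evE. Qed.

Let eta_surj M g : exists m, vsval (eta M) m = g.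
Proof.
exists (\sum_(p <- gen) vsval (vsval (g : Ahom QA (homf_module M)) p.1 : Ahom Q M) p.2).
rewrite etaE; apply: (@Ahom_eqP _ _ QA (homf_module M)) => u; apply: (@Ahom_eqP _ _ Q M) => q.
rewrite homf_evE linear_sum.
(* Writing $u$ as $\sum u\cdot u_p(q_p)=\sum\langle u,q_p\rangle u_p$ lets the $B$-linearity of $g$
   reduce the claim to the values $g(u_p)$. *)
have {2}-> : u = \sum_(p <- gen) vsval (homf_hom (ev (vsval p.1 p.2 : RA))) u :> QA.
  apply: (@Ahom_eqP _ _ Q RA) => x; rewrite linear_sum sum_lfunE.
  rewrite (eq_bigr (fun p : Ahom Q RA * Q => lm_act RA (vsval u x) (vsval p.1 p.2))) => [|p _].
    rewrite -linear_sum genE; apply/esym/(etrans (reg_module_actE _ _)).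
    exact: mulr1.
  exact: homf_evE.
rewrite linear_sum [vsval (\sum_(i <- _) _)]linear_sum sum_lfunE.
apply: eq_bigr => p _; pose gp : Ahom Q M := vsval (g : Ahom QA (homf_module M)) p.1.
transitivity (vsval (vsval (g : Ahom QA (homf_module M)) (lm_act QA (rank1 u p.2) p.1) : Ahom Q M) q).
  rewrite (AhomE (g : Ahom QA (homf_module M))) [lm_act _ _ _]homf_actE [RHS]comp_lfunE.
  by rewrite [vsval (rank1 _ _) q]comp_lfunE evE (AhomE gp).
congr (vsval (vsval (g : Ahom QA (homf_module M)) _ : Ahom Q M) q); exact: ev_rank1.
Qed.

Let kappa_inj (N : lmodule B) : injective (vsval (kappa N)).
Proof.
apply/lker0P; rewrite -subv0; apply/subvP=> n; rewrite memv_ker memv0 kappaE => /eqP n0.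
(* The dual basis property of $Q$ says exactly that the identity is a sum of rank-one
   endomorphisms. *)
have e1 : 1 = \sum_(p <- dual) rank1 p.1 p.2 :> B.
  apply: (@Ahom_eqP _ _ Q Q) => q; rewrite [LHS]id_lfunE [LHS]dualE.
  rewrite linear_sum sum_lfunE; apply: eq_bigr => p _.
  by rewrite /rank1 /= comp_lfunE ev_lfunE.
rewrite -[n]lm_act1E e1 linear_sum sum_lfunE big1 // => -[u q] _ /=.
by rewrite -kappa2E n0 !zero_lfunE.
Qed.

Let kappa_surj (N : lmodule B) g : exists n, vsval (kappa N) n = g.
Proof.
exists (\sum_(p <- dual) vsval (vsval (g : Ahom Q (cohomf_module N)) p.2 : Ahom QA N) p.1).
rewrite kappaE; apply: (@Ahom_eqP _ _ Q (cohomf_module N)) => q; apply: (@Ahom_eqP _ _ QA N) => u.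
rewrite kappa2E linear_sum [in RHS](dualE q) linear_sum.
rewrite [vsval (\sum_(i <- _) _)]linear_sum sum_lfunE.
apply: eq_bigr => p _; pose gp : Ahom QA N := vsval (g : Ahom Q (cohomf_module N)) p.2.
apply: etrans (esym (AhomE gp (rank1 u q) p.1)) _.
rewrite [lm_act QA _ _](ev_rank1 u p.1 q).
transitivity (vsval (cohomf_act N (vsval p.1 q) gp : Ahom QA N) u).
  by rewrite cohomf_actE [RHS]comp_lfunE.
congr (vsval (_ : Ahom QA N) u); apply/esym.
exact: (AhomE (g : Ahom Q (cohomf_module N)) (vsval p.1 q) p.2).
Qed.

Theorem homFunctor_equivalence : is_equivalence homFunctor.
Proof.
exists coHomFunctor; split.
  exists eta; split=> [M|M N f]; first exact: Ahom_bij_iso.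
  apply: Ahom_eqP => m; rewrite [LHS]comp_lfunE [RHS]comp_lfunE !etaE.
  by rewrite cohomf_homE -homf_comp ev_natural.
pose eps (N : lmodule B) : Ahom (homf_module (cohomf_module N)) N :=
  Subvs (Ahom_inv_subproof (@kappa_inj N) (@kappa_surj N)).
have epsK (N : lmodule B) n : vsval (eps N) (vsval (kappa N) n) = n.
  by apply: lker0_lfunK; apply/lker0P/kappa_inj.
have kappaK (N : lmodule B) g : vsval (kappa N) (vsval (eps N) g) = g.
  by apply: limg_lfunVK; have [n <-] := @kappa_surj N g; rewrite memv_img ?memvf.
exists eps; split=> [N|M N f].
  apply: Ahom_bij_iso => [g h /(congr1 (vsval (kappa N)))|n]; first by rewrite !kappaK.
  by exists (vsval (kappa N) n).
apply: Ahom_eqP => g; rewrite [LHS]comp_lfunE [RHS]comp_lfunE.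
apply: kappa_inj; rewrite kappaK; have [n <-] := kappa_surj g; rewrite epsK.
rewrite !kappaE; apply: (@Ahom_eqP _ _ Q (cohomf_module N)) => q; apply: (@Ahom_eqP _ _ QA N) => u.
rewrite kappa2E homf_homE [RHS]/= comp_lfunE cohomf_homE [RHS]/= comp_lfunE kappa2E.
by rewrite AhomE.
Qed.

End Morita.

(** * The comodule algebra of endomorphisms of a relative Hopf module *)

Section EndComodAlgebra.
Variables (k : fieldType) (H : hopfAlgebra k).
Local Notation RH := (reg_module H).

Lemma tact_reg (U V : falgType k) (s t : tens U V) :
  tact (lm_act (reg_module U)) (lm_act (reg_module V)) s t = tmul s t.
Proof.
rewrite -(linfun_linear (tmul_linearl t)).
elim/tens_ind: s => [|a b s IH]; first by rewrite !linear0 zero_lfunE.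
rewrite !linearD /= add_lfunE IH; congr (_ + _).
rewrite (linfun_linear (tmul_linearl t)) -(linfun_linear (tmul_linearr _)).
elim/tens_ind: t {s IH} => [|x y t IH]; first by rewrite !linear0.
rewrite !linearD /= IH; congr (_ + _).
by rewrite (linfun_linear (tmul_linearr _)) tmulE tactE tmapE /= !reg_actE.
Qed.

Fact comult_hom_subproof : comult H \in Ahoms RH (tensH RH RH).
Proof. by apply: AhomP => h x; rewrite tensH_actE tact_reg reg_actE comultM. Qed.

Definition comult_hom : Ahom RH (tensH RH RH) := Subvs comult_hom_subproof.

Fact counit_hom_subproof : (counit H : 'Hom(RH, unit_module H)) \in Ahoms RH (unit_module H).
Proof.
by apply: AhomP => h x; rewrite /= unit_actE scale_lfunE id_lfunE reg_actE counitM.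
Qed.

Definition counit_hom : Ahom RH (unit_module H) := Subvs counit_hom_subproof.

Lemma tev_tunitl (V U : vectType k) (xi : 'Hom(U, k^o)) (t : tens U V) :
  tev V xi t = tunitl V (tmap xi \1 t).
Proof.
rewrite -comp_lfunE; apply: tens_extE => u v.
by rewrite comp_lfunE tmapE tunitlE tevE id_lfunE.
Qed.

Variable A : comodAlgebra H.
Implicit Types (X Y : lmodule H) (M N : lmodule A).

Definition free_co N : Ahom (tens_module RH N) (tens_module RH (tens_module RH N)) :=
  Ahom_comp (tens_assoc RH RH N) (tens_hom comult_hom (Ahom_id N)).

Lemma free_coE N t :
  vsval (free_co N) t = tassoc H H N (tmap (comult H) \1 t).
Proof. exact: comp_lfunE. Qed.

Fact free_coA N (t : tens_module RH N) :
  tassoc _ _ _ (tmap (comult H) \1 (vsval (free_co N) t)) =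
  tmap \1 (vsval (free_co N)) (vsval (free_co N) t).
Proof.
rewrite !free_coE.
have -> : vsval (free_co N) = (tassoc H H N \o tmap (comult H) \1)%VF by [].
elim/tens_ind: t => [|h n t IH]; first by rewrite !linear0.
rewrite !linearD /= IH; congr (_ + _).
rewrite !tmapE id_lfunE.
have e1 (u : tens H H) : tassoc H H (tens H N) (tmap (comult H) \1 (tassoc H H N (u \ox n))) =
    tmap \1 (tassoc H H N) (tassoc _ _ _ (tassoc _ _ _ (tmap (comult H) \1 u) \ox n)).
  elim/tens_ind: u => [|x y u IHu]; first by rewrite !(linear0, tpure0l).
  rewrite !(tpureDl, linearD) /= IHu; congr (_ + _).
  rewrite tmapE id_lfunE tassocE tmapE id_lfunE.
  elim/tens_ind: (comult H x) => [|x1 x2 v IHv]; first by rewrite !(linear0, tpure0l).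
  rewrite !(tpureDl, linearD) /= IHv; congr (_ + _).
  by rewrite !tassocE tmapE id_lfunE tassocE.
have e2 (u : tens H H) : tmap \1 (tassoc H H N \o tmap (comult H) \1) (tassoc H H N (u \ox n)) =
    tmap \1 (tassoc H H N) (tassoc _ _ _ (tmap \1 (comult H) u \ox n)).
  elim/tens_ind: u => [|x y u IHu]; first by rewrite !(linear0, tpure0l).
  rewrite !(tpureDl, linearD) /= IHu; congr (_ + _).
  by rewrite !(tassocE, tmapE, id_lfunE, comp_lfunE).
by rewrite e1 e2 comultA.
Qed.

Fact free_counit N (t : tens_module RH N) :
  tev _ (counit H) (vsval (free_co N) t) = t.
Proof.
rewrite free_coE; elim/tens_ind: t => [|h n t IH]; first by rewrite !linear0.
rewrite !linearD /= IH; congr (_ + _); rewrite tmapE id_lfunE.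
rewrite -[h in RHS]counitl; elim/tens_ind: (comult H h) => [|x y u IHu].
  by rewrite !(linear0, tpure0l).
rewrite !(tpureDl, linearD) /= IHu; congr (_ + _).
rewrite tassocE tevE tliftE -?tpureZl //.
by split=> [?|?] c v w; rewrite ?linearP ?scalerDl ?scalerDr ?scalerA // mulrC.
Qed.

(** Cofree as a comodule: $H\otimes N$ with coaction $\Delta\otimes\mathrm{id}$, the right adjoint
    to forgetting the coaction. *)
Definition free_hopf N : hopfModule A := HopfModule (@free_coA N) (@free_counit N).

Variable Q : hopfModule A.
Hypothesis A_simple : right_simple A.
Hypothesis Q_gt0 : (0 < dimT Q)%N.
Local Notation B := (endop Q_gt0).

(** The equation $\delta(b(q))=q_{(-1)}b_{(-1)}\otimes b_{(0)}(q_{(0)})$ determines the coaction of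
    $b$, because [str] is bijective. *)
Definition coactB : 'Hom(B, tens H B) :=
  (str_inv Q RH Q \o (postcomp Q (hm_co Q) : 'Hom(B, Ahom Q (tens_module RH Q))))%VF.

Lemma coactBE (b : B) : str Q RH Q (coactB b) = Ahom_comp (hm_co Q) b.
Proof. by rewrite [coactB b]comp_lfunE str_invK // postcompE. Qed.

(** After the injective maps [str], both sides become the twofold coaction of $Q$ composed with $b$,
    and these agree by coassociativity of $Q$. *)
Fact coactBA (b : B) :
  tassoc _ _ _ (tmap (comult H) \1 (coactB b)) = tmap \1 coactB (coactB b).
Proof.
have i1 : injective (tmap \1 (str Q RH Q) : 'Hom(tens H (tens H B), _)).
  by apply: tmap_inj (@str_inj _ _ _ Q RH Q) => x y; rewrite !id_lfunE.
apply: i1; apply: (@str_inj _ _ _ Q RH (tens_module RH Q)).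
rewrite -str_assoc (str_natl comult_hom) coactBE.
transitivity (Ahom_comp (tens_hom (Ahom_id RH) (hm_co Q)) (str Q RH Q (coactB b))).
  rewrite coactBE !Ahom_compA; congr (Ahom_comp _ b).
  apply: Ahom_eqP => q; rewrite [RHS]comp_lfunE /= -hm_coA.
  by rewrite !comp_lfunE.
rewrite -str_natr; congr (str Q RH (tens_module RH Q) _).
rewrite -[RHS]comp_lfunE tmap_comp comp_lfun1l.
congr (fun_of_lfun (tmap _ _) _); apply/lfunP=> c.
by rewrite [RHS]comp_lfunE postcompE; apply/esym/coactBE.
Qed.

Fact coactB_counit (b : B) : tev B (counit H) (coactB b) = b.
Proof.
rewrite tev_tunitl.
have e := str_unit (tmap (counit H) \1 (coactB b)).
rewrite -[LHS]e (str_natl counit_hom) coactBE Ahom_compA.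
rewrite -[RHS]Ahom_comp1l Ahom_compA; congr (Ahom_comp _ b).
apply: Ahom_eqP => q; rewrite /= !comp_lfunE id_lfunE -[RHS]hm_counit.
by rewrite tev_tunitl.
Qed.

Fact coactB1 : coactB 1 = 1 \ox 1.
Proof.
apply: (@str_inj _ _ _ Q RH Q); rewrite coactBE.
rewrite [RHS](strE (1 : RH) (Ahom_id Q)) [LHS]Ahom_comp1r.
apply: Ahom_eqP => q; rewrite /= comp_lfunE ev_reg (_ : amulr 1 = \1%VF).
  by rewrite tmap1 id_lfunE.
by apply/lfunP=> x; rewrite amulrE mulr1 id_lfunE.
Qed.

(** The right action of $H\otimes B$ on $H\otimes Q$. Since [str t] is this action of $t$ after the
    coaction of $Q$, multiplicativity of [coactB] reduces to [Ract_mul]. *)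
Let Ract : 'Hom(tens H B, Ahom (tens_module RH Q) (tens_module RH Q)) :=
  tlift (fun (h : RH) (f : Ahom Q Q) => tens_hom (ev h) f).

Let RactE (h : RH) (f : B) : Ract (h \ox f) = tens_hom (ev h) (f : Ahom Q Q).
Proof.
rewrite [LHS](tliftE) //; split=> [g|y] c u v.
  by rewrite ev_linear (tens_hom_bilinear _ _ _ _).1.
exact: (tens_hom_bilinear _ _ _ _).2.
Qed.

Let str_Ract t : str Q RH Q t = Ahom_comp (Ract t) (hm_co Q).
Proof.
elim/tens_ind: t => [|h f t IH].
  by rewrite !linear0; apply: Ahom_eqP => q; rewrite /= comp_lfun0l.
rewrite !linearD /= IH -[Ract (h \ox f)]scale1r.
rewrite (Ahom_comp_bilinear _ _ _).1 !scale1r RactE; congr (_ + _).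
exact: (strE (h : RH) (f : Ahom Q Q)).
Qed.

Let Ract_mul (s t : tens H B) : Ract (tmul s t) = Ahom_comp (Ract t) (Ract s).
Proof.
rewrite -(linfun_linear (tmul_linearl t)).
elim/tens_ind: s => [|a b s IH].
  by rewrite !linear0; apply: Ahom_eqP => q; rewrite /= comp_lfun0r.
rewrite !linearD /= IH -[Ract (a \ox b)]scale1r.
rewrite (Ahom_comp_bilinear _ _ _).2 !scale1r; congr (_ + _).
rewrite (linfun_linear (tmul_linearl t)) -(linfun_linear (tmul_linearr _)).
elim/tens_ind: t {s IH} => [|x y t IH].
  rewrite !linear0; apply: (@Ahom_eqP _ _ (tens_module RH Q) (tens_module RH Q)) => q.
  by rewrite /= comp_lfun0l.
rewrite !linearD /= IH -[Ract (x \ox y)]scale1r.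
rewrite (Ahom_comp_bilinear _ _ _).1 !scale1r; congr (_ + _).
rewrite (linfun_linear (tmul_linearr _)) tmulE !RactE.
rewrite -(@tens_hom_comp _ H A); congr (@tens_hom _ H A RH RH Q Q _ _).
by rewrite ev_natural evE reg_module_actE.
Qed.

Fact coactBM : {morph coactB : a b / a * b >-> tmul a b}.
Proof.
move=> a b; apply: (@str_inj _ _ _ Q RH Q); rewrite coactBE.
rewrite [RHS]str_Ract Ract_mul -Ahom_compA -[Ahom_comp (Ract _) (hm_co Q)]str_Ract.
by rewrite coactBE !Ahom_compA -str_Ract coactBE.
Qed.

Definition end_comod : comodAlgebra H :=
  @ComodAlgebra k H B coactB coactBA coactB_counit coactB1 coactBM.

End EndComodAlgebra.

(** * $\mathrm{Hom}_A(Q,-)$ as an equivalence of module categories *)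

Section EndMorita.
Variables (k : fieldType) (H : hopfAlgebra k) (A : comodAlgebra H).
Variables (Q : hopfModule A) (A_simple : right_simple A) (Q_gt0 : (0 < dimT Q)%N).
Implicit Types (X Y : lmodule H) (M N P : lmodule A).
Local Notation RH := (reg_module H).
Local Notation B := (end_comod A_simple Q_gt0).
Local Notation F M := (homf_module Q_gt0 M).
Local Notation FB M := (homf_module Q_gt0 M : lmodule B).

Lemma str_act X P (s : tens H B) x (f : F P) :
  str Q X P (tact (lm_act X) (lm_act (FB P)) s (x \ox f)) =
  Ahom_comp (tens_hom (ev x) (f : Ahom Q P)) (str Q RH Q s).
Proof.
elim/tens_ind: s => [|h b s IH].
  by rewrite !linear0 zero_lfunE linear0; apply: Ahom_eqP => q; rewrite /= comp_lfun0r.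
rewrite !linearD /= add_lfunE linearD /= IH.
have := (Ahom_comp_bilinear _ _ _).2 (tens_hom (ev x) (f : Ahom Q P)) 1
  (str Q RH Q (h \ox b)) (str Q RH Q s).
rewrite !scale1r => ->; congr (_ + _).
rewrite tactE tmapE; have -> : lm_act (FB P) b f = Ahom_comp f (b : Ahom Q Q) by apply: homf_actE.
rewrite (strE (lm_act X h x)) (strE (h : RH) (b : Ahom Q Q)) Ahom_compA.
by rewrite -(@tens_hom_comp _ H A) ev_comp.
Qed.

(** The defining equation of [coactB] is what turns the diagonal action of $B$ into precomposition,
    making [str] a morphism of $B$-modules. *)
Lemma str_actB X P (b : B) (t : tens X (F P)) :
  str Q X P (lm_act (tens_module X (FB P)) b t) = Ahom_comp (str Q X P t) (b : Ahom Q Q).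
Proof.
rewrite tens_module_actE; elim/tens_ind: t => [|x f t IH].
  by rewrite !linear0; apply: Ahom_eqP => q; rewrite /= comp_lfun0l.
rewrite !linearD /= IH.
have := (Ahom_comp_bilinear _ _ _).1 (b : Ahom Q Q) 1 (str Q X P (x \ox f)) (str Q X P t).
rewrite !scale1r => ->; congr (_ + _).
rewrite str_act coactBE //.
transitivity (Ahom_comp (Ahom_comp (tens_hom (ev x) (f : Ahom Q P)) (hm_co Q)) (b : Ahom Q Q)).
  exact (Ahom_compA (tens_hom (ev x) (f : Ahom Q P)) (hm_co Q) (b : Ahom Q Q)).
exact (congr1 (fun g => Ahom_comp g (b : Ahom Q Q)) (esym (strE x (f : Ahom Q P)))).
Qed.

Fact str_inv_subproof X P :
  (str_inv Q X P : 'Hom(FB (tens_module X P), tens_module X (FB P)))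
    \in Ahoms (FB (tens_module X P)) (tens_module X (FB P)).
Proof.
apply: AhomP => b g; apply: (@str_inj _ _ _ Q X P).
transitivity (Ahom_comp (g : Ahom Q (tens_module X P)) (b : Ahom Q Q)).
  exact (etrans (str_invK A_simple _) (homf_actE b g)).
rewrite str_actB; exact (congr1 (fun h => Ahom_comp h (b : Ahom Q Q)) (esym (str_invK A_simple g))).
Qed.

(** The inverse of [str], since structure maps of module functors go from $F(X\otimes P)$ to
    $X\otimes F(P)$. *)
Definition end_str X P : Ahom (FB (tens_module X P)) (tens_module X (FB P)) :=
  Subvs (str_inv_subproof X P).

Lemma end_strK X P g : str Q X P (vsval (end_str X P) g) = g.
Proof. exact: str_invK. Qed.

Fact end_str_iso X P : is_iso (C := modules B) (end_str X P).
Proof.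
apply: Ahom_bij_iso => [g h e|t]; first by rewrite -(end_strK g) e end_strK.
by exists (str Q X P t); apply: strK.
Qed.

Fact end_str_nat X X' P P' (f : Ahom X X') (g : Ahom P P') :
  Ahom_comp (end_str X' P') (homf_hom Q_gt0 (tens_hom f g) : Ahom (FB _) (FB _)) =
  Ahom_comp (tens_hom f (homf_hom Q_gt0 g : Ahom (FB P) (FB P'))) (end_str X P).
Proof.
apply: Ahom_eqP => u; rewrite [LHS]comp_lfunE [RHS]comp_lfunE.
apply: (@str_inj _ _ _ Q X' P'); rewrite end_strK homf_homE.
have [t <-] := str_surj A_simple u; rewrite [vsval (end_str _ _) _](strK A_simple).
rewrite /= -[vsval f]comp_lfun1r -[postcomp Q g]comp_lfun1l -tmap_comp comp_lfunE.
rewrite (str_natl f) (str_natr g) Ahom_compA -(@tens_hom_comp _ H A).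
by rewrite Ahom_comp1r Ahom_comp1l.
Qed.

Fact end_str_pentagon X Y P :
  Ahom_comp (tens_assoc X Y (FB P)) (end_str (tensH X Y) P) =
  Ahom_comp (Ahom_comp (tens_hom (Ahom_id X) (end_str Y P)) (end_str X (tens_module Y P)))
    (homf_hom Q_gt0 (tens_assoc X Y P) : Ahom (FB _) (FB _)).
Proof.
apply: Ahom_eqP => u; rewrite [LHS]comp_lfunE [RHS]comp_lfunE [RHS]comp_lfunE.
have [t <-] := str_surj A_simple u; rewrite [vsval (end_str _ _) _](strK A_simple).
rewrite homf_homE str_assoc [vsval (end_str X _) _](strK A_simple) /=.
rewrite -[RHS]comp_lfunE tmap_comp comp_lfun1l.
rewrite (_ : (_ \o _)%VF = \1%VF) ?tmap1 ?id_lfunE //.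
by apply/lfunP=> v; rewrite comp_lfunE id_lfunE; apply: strK.
Qed.

Fact end_str_triangle P :
  Ahom_comp (tens_unitl (FB P)) (end_str (unit_module H) P) =
  (homf_hom Q_gt0 (tens_unitl P) : Ahom (FB _) (FB _)).
Proof.
apply: Ahom_eqP => u; rewrite [LHS]comp_lfunE.
have [t <-] := str_surj A_simple u; rewrite [vsval (end_str _ _) _](strK A_simple).
by rewrite homf_homE str_unit.
Qed.

Definition end_functor : moduleFunctor (comod_modules A) (comod_modules B) :=
  @ModuleFunctor k (rep H) (comod_modules A) (comod_modules B) (homFunctor Q_gt0)
    end_str end_str_iso end_str_nat end_str_pentagon end_str_triangle.

Theorem end_comod_Morita : equivariant_Morita A B.
Proof.
have [gen genE] := hopf_module_generator A_simple Q_gt0.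
have [dual dualE] := hopf_module_dual_basis A_simple Q.
by exists end_functor; exact (homFunctor_equivalence Q_gt0 genE dualE).
Qed.

End EndMorita.

(** * Modules over a comodule algebra as a module category *)

Section Equivalences.
Variable k : fieldType.
Implicit Types C D : linCat k.
Local Notation "g \oc f" := (ccomp g f) (at level 40, left associativity).

Lemma iso_lcancel C (X Y Z : C) (i : chom Y Z) (f g : chom X Y) :
  is_iso i -> i \oc f = i \oc g -> f = g.
Proof.
case=> j [ji _] e; rewrite -[f](ccomp1l f) -[g](ccomp1l g) -ji.
by rewrite -!ccompA e.
Qed.

Lemma iso_rcancel C (X Y Z : C) (i : chom X Y) (f g : chom Y Z) :
  is_iso i -> f \oc i = g \oc i -> f = g.
Proof.
case=> j [_ ij] e; rewrite -[f](ccomp1r f) -[g](ccomp1r g) -ij.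
by rewrite !ccompA e.
Qed.

Lemma equivalence_faithful C D (F : linFunctor C D) : is_equivalence F ->
  forall (X Y : C) (f g : chom X Y), fhom F f = fhom F g -> f = g.
Proof.
case=> G [[eta [eta_iso eta_nat]] _] X Y f g e.
by apply: (iso_lcancel (eta_iso Y)); rewrite !eta_nat e.
Qed.

Lemma equivalence_full C D (F : linFunctor C D) : is_equivalence F ->
  forall (X Y : C) (g : chom (F X) (F Y)), exists f, fhom F f = g.
Proof.
case=> G [[eta [eta_iso eta_nat]] [eps [eps_iso eps_nat]]] X Y g.
have [j [ji ij]] := eta_iso Y; exists (j \oc (fhom G g \oc eta X)).
set f := _ \oc _; have e : fhom G (fhom F f) = fhom G g.
  apply: (iso_rcancel (eta_iso X)); rewrite -eta_nat /f ccompA ij.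
  by rewrite ccomp1l.
by apply: (iso_rcancel (eps_iso _)); rewrite !eps_nat e.
Qed.

Lemma ccomp0l C (X Y Z : C) (f : chom X Y) : (0 : chom Y Z) \oc f = 0.
Proof.
have := ccompPl (-1) (0 : chom Y Z) 0 f.
by rewrite scaler0 addr0 scaleN1r addNr.
Qed.

Lemma ccomp0r C (X Y Z : C) (g : chom Y Z) : g \oc (0 : chom X Y) = 0.
Proof.
have := ccompPr (-1) g (0 : chom X Y) 0.
by rewrite scaler0 addr0 scaleN1r addNr.
Qed.

Lemma ccompZl C (X Y Z : C) c (g : chom Y Z) (f : chom X Y) :
  (c *: g) \oc f = c *: (g \oc f).
Proof. by have := ccompPl c g 0 f; rewrite !addr0 ccomp0l addr0. Qed.

Lemma ccompZr C (X Y Z : C) c (g : chom Y Z) (f : chom X Y) :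
  g \oc (c *: f) = c *: (g \oc f).
Proof. by have := ccompPr c g f 0; rewrite !addr0 ccomp0r addr0. Qed.

Lemma fhomZ C D (F : linFunctor C D) (X Y : C) c (f : chom X Y) :
  fhom F (c *: f) = c *: fhom F f.
Proof.
have F0 : fhom F (0 : chom X Y) = 0.
  have := @fhom_linear _ _ _ F _ _ (-1) (0 : chom X Y) 0.
  by rewrite scaler0 addr0 scaleN1r addNr.
by have := @fhom_linear _ _ _ F _ _ c f 0; rewrite !addr0 F0 addr0.
Qed.

Lemma identity_finite (R : falgType k) : finite_linCat (modules R).
Proof.
have lin : forall X Y : modules R, linear (fun f : chom X Y => f) by [].
pose F := @LinFunctor k (modules R) (modules R) (fun M => M) (fun _ _ f => f)
  lin (fun _ => erefl) (fun _ _ _ _ _ => erefl).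
exists R, F, F; split; exists (fun M => cid (l := modules R) M); split=> [M|M N f].
- by exists (cid (l := modules R) M); split; apply: ccomp1l.
- by rewrite ccomp1l ccomp1r.
- by exists (cid (l := modules R) M); split; apply: ccomp1l.
- by rewrite ccomp1l ccomp1r.
Qed.

End Equivalences.

(** * Finiteness, exactness and indecomposability of ${}_A\mathcal{M}$ *)

Section ModuleCategoryOf.
Variable k : fieldType.

Lemma epi_surj (C : falgType k) (M N : lmodule C) (f : Ahom M N) :
  epi (C := modules C) f -> forall n, exists m, vsval f m = n.
Proof.
move=> f_epi n.
have st a w : w \in limg (vsval f) -> lm_act N a w \in limg (vsval f).
  by case/memv_imgP=> v _ ->; rewrite -AhomE memv_img ?memvf.
have [P [p [p_surj pU]]] := quotient_ex st.
have p0 : p = 0.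
  apply: (f_epi P p 0); rewrite ccomp0l; apply: Ahom_eqP => m.
  by rewrite [LHS]comp_lfunE zero_lfunE; apply/pU; rewrite memv_img ?memvf.
have /pU/memv_imgP[m _ ->] : vsval p n = 0 by rewrite p0 zero_lfunE.
by exists m.
Qed.

Lemma surj_epi (C : falgType k) (M N : lmodule C) (f : Ahom M N) :
  (forall n, exists m, vsval f m = n) -> epi (C := modules C) f.
Proof.
move=> f_surj Z g h gh; apply: Ahom_eqP => n; have [m <-] := f_surj n.
have := congr1 (fun u : Ahom M Z => vsval u m) gh.
by rewrite [LHS]comp_lfunE [RHS]comp_lfunE.
Qed.

Lemma short_exactP (C : falgType k) (X Y Z : lmodule C) (f : Ahom X Y) (g : Ahom Y Z) :
  short_exact (C := modules C) f g <-> short_exact_seq f g.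
Proof.
split=> [[[gf ker_f] [_ coker_g]]|[f_inj g_surj fg]].
  have kerE (U V : lmodule C) (h : Ahom U V) : exists (K : lmodule C) (i : Ahom K U),
      limg (vsval i) = lker (vsval h) /\ Ahom_comp h i = 0.
    have st a w : w \in lker (vsval h) -> lm_act U a w \in lker (vsval h).
      by rewrite !memv_ker AhomE => /eqP->; rewrite linear0.
    have [K [i [_ iU]]] := submodule_ex st; exists K, i; split=> //.
    apply: Ahom_eqP => x; rewrite [LHS]comp_lfunE zero_lfunE; apply/eqP.
    by rewrite -memv_ker -iU memv_img ?memvf.
  split.
  - apply/lker0P; have [K [i [<- fi]]] := kerE _ _ f.
    have [|u [_ u_uniq]] := ker_f K 0; first exact: ccomp0r.
    have -> : i = 0 by rewrite -(u_uniq 0 (ccomp0r _ _)) -(u_uniq i fi).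
    by rewrite lim0g.
  - have st a w : w \in limg (vsval g) -> lm_act Z a w \in limg (vsval g).
      by case/memv_imgP=> v _ ->; rewrite -AhomE memv_img ?memvf.
    have [P [p [_ pU]]] := quotient_ex st.
    have [|u [_ u_uniq]] := coker_g P 0; first exact: ccomp0l.
    have p0 : p = 0.
      rewrite -(u_uniq 0 (ccomp0l _ _)) -(u_uniq p) //.
      apply: Ahom_eqP => y; rewrite [LHS]comp_lfunE zero_lfunE; apply/pU.
      by rewrite memv_img ?memvf.
    move=> z; have /pU/memv_imgP[y _ ->] : vsval p z = 0 by rewrite p0 zero_lfunE.
    by exists y.
  move=> y; split=> [gy|/memv_imgP[x _ ->]]; last first.
    by rewrite -comp_lfunE -[(_ \o _)%VF]/(vsval (Ahom_comp g f)) [Ahom_comp g f]gf zero_lfunE.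
  have [K [i [iU gi]]] := kerE _ _ g.
  have [h [hE _]] := ker_f K i gi.
  have : y \in limg (vsval i) by rewrite iU memv_ker gy.
  case/memv_imgP=> x _ ->; have -> : vsval i x = vsval f (vsval (h : Ahom K X) x).
    by rewrite -hE; apply: comp_lfunE.
  by rewrite memv_img ?memvf.
have gf : Ahom_comp g f = 0.
  by apply: Ahom_eqP => x; rewrite [LHS]comp_lfunE zero_lfunE; apply/fg; rewrite memv_img ?memvf.
split; split=> // T h.
- move=> gh; have [|h' h'E] := @Ahom_factor_inj _ _ _ _ _ f h f_inj.
    by move=> m; apply/fg; have := congr1 (fun u : Ahom T Z => vsval u m) gh; rewrite comp_lfunE zero_lfunE.
  exists h'; split=> // h'' e; apply: Ahom_eqP => m; apply: f_inj.
  by rewrite -!comp_lfunE -[(_ \o vsval h')%VF]/(vsval (Ahom_comp f h')) h'E -e.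
move=> hf; have [|h' h'E] := @Ahom_factor_surj _ _ _ _ _ g h g_surj.
  move=> y /fg/memv_imgP[x _ ->].
  by have := congr1 (fun u : Ahom X T => vsval u x) hf; rewrite comp_lfunE zero_lfunE.
exists h'; split=> // h'' e; apply: Ahom_eqP => z; have [y <-] := g_surj z.
by rewrite -!comp_lfunE -[(vsval h' \o _)%VF]/(vsval (Ahom_comp h' g)) h'E -e.
Qed.

(** A linear splitting $fr+sg=\mathrm{id}$ survives tensoring with $P$, although $r$ and $s$ are not
    module maps in general. *)
Lemma tens_ses (H : hopfAlgebra k) (A : comodAlgebra H) (X Y Z : lmodule H)
    (P : lmodule A) (f : Ahom X Y) (g : Ahom Y Z) :
  short_exact_seq f g ->
  short_exact_seq (tens_hom f (Ahom_id P)) (tens_hom g (Ahom_id P)).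
Proof.
case=> f_inj g_surj fg; have gK := exists_section g_surj.
pose s : 'Hom(Z, Y) := (vsval g)^-1%VF; pose E : 'End(Y) := (s \o vsval g)%VF.
pose r : 'Hom(Y, X) := ((vsval f)^-1 \o (\1%VF - E))%VF.
have fgK : (vsval f \o r)%VF + E = \1%VF.
  apply/lfunP=> y; rewrite add_lfunE !comp_lfunE add_lfunE opp_lfunE id_lfunE.
  rewrite limg_lfunVK ?subrK ?comp_lfunE ?subrK //; apply/fg.
  by rewrite linearB /= -[vsval g (s _)]comp_lfunE gK id_lfunE subrr.
split.
- by apply: tmap_inj => // x y; rewrite !id_lfunE.
- move=> t; exists (tmap s \1%VF t).
  by rewrite /= -comp_lfunE tmap_comp gK comp_lfun1l tmap1 id_lfunE.
move=> t; split=> [gt|/memv_imgP[u _ ->]].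
  have -> : t = tmap (vsval f) \1 (tmap r \1 t) + tmap s \1 (tmap (vsval g) \1 t).
    rewrite -!comp_lfunE !tmap_comp comp_lfun1l -add_lfunE -tmapDl fgK tmap1.
    by rewrite id_lfunE.
  rewrite -[tmap (vsval g) _ t]/(vsval (tens_hom g (Ahom_id P)) t) gt linear0 addr0.
  by rewrite -[tmap _ _ _]/(vsval (tens_hom f (Ahom_id P)) (tmap r \1 t)) memv_img ?memvf.
rewrite /= -comp_lfunE tmap_comp (_ : (vsval g \o vsval f)%VF = 0) ?tmap0l ?zero_lfunE //.
by apply/lfunP=> x; rewrite comp_lfunE zero_lfunE; apply/fg; rewrite memv_img ?memvf.
Qed.

Lemma comod_modules_finite (H : hopfAlgebra k) (A : comodAlgebra H) :
  finite_moduleCat (comod_modules A).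
Proof.
split; first exact: identity_finite.
by move=> X Y Z f g P /short_exactP/(tens_ses P)/short_exactP.
Qed.

(** A projective $P$ is a summand of $H\otimes P$ via the counit, so $P\otimes Q$ is a summand of
    $(H\otimes P)\otimes Q\cong H\otimes(P\otimes Q)$. The latter is a cofree relative Hopf module,
    hence projective over $A$. *)
Lemma comod_modules_exact (H : hopfAlgebra k) (A : comodAlgebra H) :
  right_simple A -> exact_moduleCat (comod_modules A).
Proof.
move=> A_simple P Q P_proj M N e /epi_surj e_surj f; pose RH := reg_module H.
pose c : Ahom (tensH RH P) P :=
  Ahom_comp (tens_unitl (A := regular_comod H) P)
    (tens_hom (A := regular_comod H) (counit_hom H) (Ahom_id P)).
have c_epi : epi (C := modules H) c.
  apply: surj_epi => p; exists ((1 : H) \ox p).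
  by rewrite /= comp_lfunE tmapE tunitlE counit1 scale1r id_lfunE.
have [s cs] : exists s : Ahom P (tensH RH P), Ahom_comp c s = Ahom_id P.
  exact: (P_proj _ _ _ c_epi (Ahom_id P)).
have [j [ji _]] : exists j : Ahom (tens_module RH (tens_module P Q)) (tens_module (tensH RH P) Q),
    Ahom_comp j (tens_assoc RH P Q) = Ahom_id _ /\ Ahom_comp (tens_assoc RH P Q) j = Ahom_id _.
  exact: (tens_assoc_iso RH P Q).
pose r : Ahom (tens_module RH (tens_module P Q)) (tens_module P Q) :=
  Ahom_comp (tens_hom c (Ahom_id Q)) j.
have [g gE] := hopf_module_lift A_simple (Q := free_hopf (tens_module P Q)) e_surj (Ahom_comp f r).
exists (Ahom_comp g (Ahom_comp (tens_assoc RH P Q) (tens_hom s (Ahom_id Q)))).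
rewrite [LHS]Ahom_compA gE /r -!Ahom_compA [Ahom_comp j _]Ahom_compA.
rewrite ji Ahom_comp1l -tens_hom_comp cs Ahom_comp1l tens_hom_id.
exact: Ahom_comp1r.
Qed.

Lemma coinvariants_scalar (H : hopfAlgebra k) (A : comodAlgebra H) (z : A) :
  \dim (coinvariants A) = 1%N -> coact A z = 1 \ox z -> exists c : k, z = c%:A.
Proof.
move=> dim1 /coinvariantsP zco.
have sub : (<[1 : A]> <= coinvariants A)%VS.
  by rewrite -memvE; apply/coinvariantsP; rewrite coact1.
have /eqP e : (<[1 : A]> == coinvariants A)%VS.
  by rewrite eqEdim sub dim1 dim_vline oner_eq0.
by rewrite -e in zco; move/vlineP: zco.
Qed.

(* The idempotent of the identity functor cut out by a direct sum decomposition
   is multiplication by a central coinvariant, hence by a scalar. *)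
Lemma comod_modules_indecomposable (H : hopfAlgebra k) (A : comodAlgebra H) :
  \dim (coinvariants A) = 1%N -> indecomposable_moduleCat (comod_modules A).
Proof.
move=> dim1; pose R := reg_module A; pose RH := reg_module H; split.
  exists R => /(congr1 vsval) /= e.
  by have /eqP := oner_neq0 A; apply; rewrite -[1]id_lfunE e zero_lfunE.
case=> N1 [N2 [[_ [X1 X1_nz]] [_ [X2 X2_nz]] [F F_eq]]].
have faith := equivalence_faithful F_eq; have full := equivalence_full F_eq.
pose p1 (P : sum_moduleCat N1 N2) : chom P P := (cid P.1, 0).
have p1_nat (P P' : sum_moduleCat N1 N2) (f : chom P P') :
    ccomp (p1 P') f = ccomp f (p1 P).
  by congr pair; rewrite /= ?ccomp1l ?ccomp1r ?ccomp0l ?ccomp0r.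
have [z0 z0E] := full R R (p1 (F R)).
pose z : A := vsval (z0 : Ahom R R) 1.
(* Naturality of [p1] against all $A\to P$ forces its preimage to act on every module as
   multiplication by $z$. *)
have eE (P : lmodule A) (e : Ahom P P) : fhom F (e : chom (P : modules A) P) = p1 (F P) ->
    forall m, vsval e m = lm_act P z m.
  move=> eF m; have : Ahom_comp e (ev m) = Ahom_comp (ev m) (z0 : Ahom R R).
    apply: faith; rewrite !fhom_comp eF z0E; exact: p1_nat.
  move/(congr1 (fun u : Ahom R P => vsval u 1)).
  by rewrite [LHS]comp_lfunE [RHS]comp_lfunE !evE lm_act1E.
have [c zc] : exists c : k, z = c%:A.
  apply: coinvariants_scalar => //.
  have ahom0 (N : moduleCat (rep H)) (M : N) : Defs.ahom (@cid _ (rep H) RH) (0 : chom M M) = 0.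
    have [_ lin] := @ahom_bilinear _ _ N (RH : rep H) (RH : rep H) M M.
    have := lin (@cid _ (rep H) RH) (-1) 0 0.
    by rewrite scaler0 addr0 scaleN1r addNr.
  pose MA := comod_modules A; pose r : rep H := RH; pose x : MA := R.
  (* The action on a direct sum is componentwise, so the idempotent on $H\otimes A$ is
     $\mathrm{id}\otimes z_0$. Evaluated at $1\otimes1$ this gives $\lambda(z)=1\otimes z$. *)
  have eF : fhom F (@Defs.ahom _ _ MA r r x x (cid r) z0) = p1 (F (aob r x)).
    apply: (iso_lcancel (mf_str_iso F r x)); rewrite mf_str_nat z0E -p1_nat.
    by congr (ccomp _ _); congr pair; rewrite /= ?ahom_id ?ahom0.
  have e := eE (tens_module RH R) (tens_hom (Ahom_id RH) (z0 : Ahom R R)) eF ((1 : H) \ox (1 : A)).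
  transitivity (lm_act (tens_module RH R) z ((1 : H) \ox (1 : A))); last first.
    by rewrite -e /= tmapE id_lfunE.
  rewrite tens_module_actE; elim/tens_ind: (coact A z) => [|h a t IH].
    by rewrite !linear0 zero_lfunE.
  rewrite !linearD /= add_lfunE -IH; congr (_ + _).
  by rewrite tactE tmapE /= !reg_actE !mulr1.
have pE (P : lmodule A) : p1 (F P) = c *: cid (F P).
  have [e eF] := full P P (p1 (F P)); rewrite -eF -fhom_id -fhomZ; congr (fhom F _).
  apply: (@Ahom_eqP _ _ P P) => m; rewrite (eE P e eF) zc linearZ scale_lfunE lm_act1E.
  by rewrite [RHS]scale_lfunE id_lfunE.
have [G [_ [eps [eps_iso _]]]] := F_eq.
have kill (P : sum_moduleCat N1 N2) : p1 P = c *: cid P.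
  apply: (iso_rcancel (eps_iso P)).
  by rewrite p1_nat pE ccompZl ccomp1l ccompZr ccomp1r.
(* Now $(\mathrm{id},0)=(c\,\mathrm{id},c\,\mathrm{id})$: if $c=0$ the first summand is killed,
   otherwise the second one. *)
have := kill (X1, X2); have [->|c_nz] := eqVneq c 0.
  by rewrite scale0r => -[].
by case=> _ /esym/eqP; rewrite scaler_eq0 (negPf c_nz) => /eqP.
Qed.

End ModuleCategoryOf.

(** * Gradings and degree zero parts *)

Section Gradings.
Variables (k : fieldType).

(** A grading given by its homogeneous projections: statements about degrees become equalities of
    linear maps, which can be tensored and checked on pure tensors. *)
Definition gproj (V : vectType k) (p : nat -> 'End(V)) (N : nat) : Prop :=
  [/\ forall i j v, p i (p j v) = if i == j then p j v else 0,
      forall n, (N <= n)%N -> p n = 0 &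
      forall v, \sum_(i < N) p i v = v].

Lemma gproj_limg (V : vectType k) (p : nat -> 'End(V)) N n v :
  gproj p N -> reflect (p n v = v) (v \in limg (p n)).
Proof.
case=> pp _ _; apply: (iffP memv_imgP) => [[w _ ->]|<-]; first by rewrite pp eqxx.
by exists v; rewrite ?memvf.
Qed.

Lemma gproj_grading (V : vectType k) (p : nat -> 'End(V)) N :
  gproj p N -> grading (fun n => limg (p n)).
Proof.
move=> gp; have [pp _ sp] := gp; split=> [n|].
  apply/directv_sum_independent => u uP u0 i _.
  have := congr1 (p i) u0; rewrite linear0 linear_sum (bigD1 i) //= big1 => [|j ji].
    by rewrite addr0; have /(gproj_limg _ _ gp)-> := uP i isT.
  have /(gproj_limg _ _ gp)<- := uP j isT; rewrite pp (_ : (i == j :> nat) = false) //.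
  by rewrite eq_sym; exact: negPf ji.
exists N; apply/vspaceP=> v; rewrite memvf -[v]sp memv_suml // => i _.
apply: subvP (memv_img _ (memvf v)); exact: (sumv_sup i).
Qed.

Lemma grading_gproj (V : vectType k) (G : nat -> {vspace V}) : grading G ->
  exists p N, gproj p N /\ forall n v, (v \in G n) <-> p n v = v.
Proof.
case=> dG [N fN].
(* The parts below $N$ already span $V$, so independence kills all later ones. *)
have GN n v : (N <= n)%N -> v \in G n -> v = 0.
  move=> Nn vG; have := memvf v; rewrite -fN => /memv_sumP[u uP uE].
  pose w m := if insub m is Some i then u (i : 'I_N) else 0.
  have wG m : w m \in G m.
    by rewrite /w; case: insubP => [i _ <-|_]; rewrite ?mem0v ?uP.
  have wE : \sum_(i < n) w i = v.
    rewrite -(subnKC Nn) big_split_ord /= [X in _ + X]big1 ?addr0 => [|i _].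
      by rewrite uE; apply: eq_bigr => i _; rewrite /w /= (valK i).
    by rewrite /w insubF // ltnNge leq_addr.
  have /directv_sum_independent/(_ (fun i : 'I_n.+1 => if i == n :> nat then v else - w i)) := dG n.+1.
  move=> h; have := h _ _ ord_max isT; rewrite /= eqxx; apply=> [i _|].
    by case: eqP => [->|_]; rewrite ?memvN.
  rewrite big_ord_recr /= eqxx -{2}wE -big_split big1 //= => i _.
  by rewrite (ltn_eqF (ltn_ord i)) addNr.
pose p n : 'End(V) := if insub n is Some i then
  sumv_pi_for (erefl (\sum_(i < N) G i)%VS) (i : 'I_N) else 0.
have pG n v : p n v \in G n.
  rewrite /p; case: insubP => [i _ <-|_]; first exact: memv_sum_pi.
  by rewrite zero_lfunE mem0v.
have sp v : \sum_(i < N) p i v = v.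
  rewrite -[RHS](sumv_pi_sum (erefl (\sum_(i < N) G i)%VS)) ?fN ?memvf ?dG //.
  by apply: eq_bigr => i _; rewrite /p valK.
have pid n v : v \in G n -> forall i, p i v = if i == n then v else 0.
  move=> vG i; have [Ni|iN] := leqP N i.
    rewrite /p insubF ?ltnNge ?Ni // zero_lfunE; case: eqP => // e.
    by rewrite (GN i v) // e.
  apply/eqP; rewrite -subr_eq0; apply/eqP.
  have /directv_sum_independent/(_ (fun j : 'I_N => p j v - (if j == n :> nat then v else 0))) := dG N.
  move=> h; apply: (h _ _ (Ordinal iN) isT) => [j _|].
    by rewrite memvB //; case: eqP => [->|_]; rewrite ?mem0v.
  rewrite sumrB sp; have [nN|Nn] := ltnP n N; last first.
    by rewrite (GN n v) // big1 ?subr0 // => j _; rewrite if_same.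
  rewrite (bigD1 (Ordinal nN)) //= eqxx big1 ?addr0 ?subrr // => j jn.
  by rewrite (_ : (j == n :> nat) = false) //; exact: negPf jn.
exists p, N; split; last by move=> n v; split=> [/pid->|<-]; rewrite ?eqxx.
split=> // [i j v|n Nn]; first by rewrite (pid j).
by apply/lfunP=> v; rewrite zero_lfunE (GN n (p n v)).
Qed.

Variables (V : vectType k) (G : nat -> {vspace V}) (p : nat -> 'End(V)) (N : nat).
Hypotheses (gp : gproj p N) (pG : forall n v, (v \in G n) <-> p n v = v).

Lemma gproj_mem n v : p n v \in G n.
Proof. by apply/pG; case: gp => ->; rewrite eqxx. Qed.

Lemma gproj_neq i n v : v \in G n -> i != n -> p i v = 0.
Proof. by move=> /pG<- /negPf ni; case: gp => ->; rewrite ni. Qed.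

Lemma homog_ext (W : vectType k) (f g : 'Hom(V, W)) :
  (forall n v, v \in G n -> f v = g v) -> f =1 g.
Proof.
move=> fg v; have [_ _ sp] := gp; rewrite -[v]sp !linear_sum.
by apply: eq_bigr => i _; apply: fg (gproj_mem _ _).
Qed.

Lemma filtP n v : reflect (forall i, (n < i)%N -> p i v = 0) (v \in filt G n).
Proof.
have [pp pN sp] := gp.
apply: (iffP memv_sumP) => [[u uP ->] i ni|v0].
  rewrite linear_sum big1 // => j _; apply: gproj_neq (uP j isT) _.
  by rewrite neq_ltn orbC (leq_ltn_trans _ ni) // -ltnS.
exists (fun i : 'I_n.+1 => p i v) => [i _|]; first exact: gproj_mem.
have sM M : (N <= M)%N -> \sum_(i < M) p i v = v.
  move=> NM; rewrite -[RHS]sp; rewrite -(subnKC NM) big_split_ord /= [X in _ + X]big1 ?addr0 //.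
  by move=> i _; rewrite pN ?zero_lfunE // leq_addr.
rewrite -[LHS](sM (n.+1 + N)%N) ?leq_addl // big_split_ord /= [X in _ + X]big1 ?addr0 //.
by move=> i _; rewrite v0 // ltnS leq_addr.
Qed.

End Gradings.

Section GradedAlgebra.
Variables (k : fieldType) (A : falgType k) (G : nat -> {vspace A}).
Variables (p : nat -> 'End(A)) (N : nat).
Hypotheses (Gg : alg_graded G) (gp : gproj p N).
Hypothesis pG : forall n v, (v \in G n) <-> p n v = v.

Lemma deg_mul i j a b : a \in G i -> b \in G j -> a * b \in G (i + j)%N.
Proof. by case: Gg => _ _ GM aG bG; apply: (subvP (GM i j)); apply: memv_mul. Qed.

Lemma gproj_mull n d a b : a \in G d ->
  p n (a * b) = if (d <= n)%N then a * p (n - d)%N b else 0.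
Proof.
move=> aG; pose f := (p n \o amull a)%VF.
pose g := if (d <= n)%N then (amull a \o p (n - d)%N)%VF else 0.
have amE x : amull a x = a * x by rewrite /amull lfunE.
suff : f b = g b.
  by rewrite /f /g comp_lfunE amE => ->; case: ifP; rewrite ?comp_lfunE ?amE ?zero_lfunE.
apply: (homog_ext gp pG) => e {}b bG; rewrite /f /g comp_lfunE amE.
have abG := deg_mul aG bG.
have [dn|nd] := leqP d n; last first.
  by rewrite zero_lfunE (gproj_neq gp pG abG) // neq_ltn ltn_addr.
rewrite comp_lfunE amE; have [<-|ne] := eqVneq (d + e)%N n.
  by rewrite addKn (proj1 (pG _ _) bG) (proj1 (pG _ _) abG).
rewrite (gproj_neq gp pG abG) 1?eq_sym // (gproj_neq gp pG bG) ?mulr0 //.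
by apply: contra ne => /eqP <-; rewrite subnKC.
Qed.

Definition deg0_proj : 'Hom(A, subvs_of (deg0 Gg)) := (proj0 Gg \o p 0%N)%VF.

Lemma deg0_projE a : incl0 Gg (deg0_proj a) = p 0%N a.
Proof. by rewrite comp_lfunE incl0VK // (gproj_mem gp pG). Qed.

Lemma incl0_inj : injective (incl0 Gg).
Proof. by apply: (can_inj (g := proj0 Gg)) => x; rewrite -comp_lfunE incl0K id_lfunE. Qed.

Lemma deg0_projK a : deg0_proj (incl0 Gg a) = a.
Proof.
apply: incl0_inj; rewrite deg0_projE; apply/pG; exact: incl0_in.
Qed.

Lemma deg0_proj1 : deg0_proj 1 = 1.
Proof. by rewrite -[X in deg0_proj X](incl01 Gg) deg0_projK. Qed.

(** Degrees are natural numbers, so $i+j=0$ only for $i=j=0$: the part of positive degree is an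
    ideal. *)
Lemma deg0_projM : {morph deg0_proj : a b / a * b}.
Proof.
move=> a b; apply: incl0_inj; rewrite incl0M !deg0_projE.
have lin1 c : linear (fun x => p 0%N (c * x)).
  by move=> d x y; rewrite mulrDr -scalerAr linearP.
have lin2 c : linear (fun x => p 0%N c * p 0%N x).
  by move=> d x y; rewrite linearP mulrDr -scalerAr.
have lin3 c : linear (fun x => p 0%N (x * c)).
  by move=> d x y; rewrite mulrDl -scalerAl linearP.
have lin4 c : linear (fun x => p 0%N x * p 0%N c).
  by move=> d x y; rewrite linearP mulrDl -scalerAl.
rewrite -[LHS](linfun_linear (lin1 a)) -[RHS](linfun_linear (lin2 a)).
apply: (homog_ext gp pG) => j {}b bG; rewrite (linfun_linear (lin1 a)) (linfun_linear (lin2 a)).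
rewrite -[LHS](linfun_linear (lin3 b)) -[RHS](linfun_linear (lin4 b)).
apply: (homog_ext gp pG) => i {}a aG; rewrite (linfun_linear (lin3 b)) (linfun_linear (lin4 b)).
have abG := deg_mul aG bG; have [ij0|ij0] := eqVneq (i + j)%N 0%N.
  move/eqP: ij0; rewrite addn_eq0 => /andP[/eqP i0 /eqP j0]; subst i j.
  by move: aG bG abG => /pG-> /pG-> /pG->.
rewrite (gproj_neq gp pG abG) 1?eq_sym //.
have [i0|i0] := eqVneq i 0%N; last by rewrite (gproj_neq gp pG aG) 1?eq_sym // mul0r.
have [j0|j0] := eqVneq j 0%N; first by rewrite i0 j0 in ij0.
by rewrite (gproj_neq gp pG bG) 1?eq_sym // mulr0.
Qed.

End GradedAlgebra.

(** * AM-exactness passes to the degree-zero part *)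

Section LoewyDegreeZero.
Variables (k : fieldType) (H : coradGradedHopf k) (A : LoewyGraded H).
Local Notation Hg := (hopf_graded_alg (cgh_graded H)).
Local Notation Ag := (Loewy_grading_alg (lg_grading A)).
Local Notation A0 := (comod_deg0 A).

Lemma comod_deg0_coactE (a : A0) :
  tmap (incl0 Hg) (incl0 Ag) (coact A0 a) = coact A (incl0 Ag a).
Proof. exact: coact0E. Qed.

Lemma comod_deg0_coinvariants :
  \dim (coinvariants A) = 1%N -> \dim (coinvariants A0) = 1%N.
Proof.
move=> dimA; apply/eqP; rewrite eqn_leq; apply/andP; split.
  rewrite -dimA; have i_inj := incl0_inj (Gg := Ag).
  rewrite -[X in (X <= _)%N](@limg_dim_eq _ _ _ (incl0 Ag)); last first.
    by rewrite (eqP (introT lker0P i_inj)) capv0.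
  apply/dimvS/subvP=> _ /memv_imgP[a aA ->]; have aco := elimT (@coinvariantsP _ _ A0 a) aA.
  apply/coinvariantsP.
  by rewrite -comod_deg0_coactE aco tmapE incl01.
rewrite lt0n dimv_eq0; apply/eqP => e0.
have : (1 : A0) \in coinvariants A0 by apply/coinvariantsP; rewrite coact1.
by rewrite e0 memv0 oner_eq0.
Qed.

(** A stable right ideal $J_0$ of $A(0)$ generates the stable right ideal $J_0A$ of $A$, and it is
    recovered as the degree-zero part of $J_0A$. *)
Lemma comod_deg0_right_simple : right_simple A -> right_simple A0.
Proof.
move=> A_simple J0 J0r J0co; have [Agr _ _] := Ag.
have [p [N [gp pG]]] := grading_gproj Agr.
pose i : 'Hom(A0, A) := incl0 Ag; pose J := ((i @: J0) * fullv)%VS.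
have [||J_0|J_1] := A_simple J.
- by rewrite /J -prodvA prodvSr ?subvf.
- have sub : (J <= coact A @^-1: tensv fullv J)%VS.
    apply/prodvP=> _ b /memv_imgP[x xJ ->] _; rewrite -memv_preim coactM.
    rewrite -[coact A (i x)]comod_deg0_coactE.
    pose f : 'Hom(tens (coradical_part H) A0, tens H A) :=
      (linfun (fun t : tens H A => tmul t (coact A b)) \o tmap (incl0 Hg) i)%VF.
    have fE s : f s = tmul (tmap (incl0 Hg) i s) (coact A b).
      by rewrite comp_lfunE (linfun_linear (tmul_linearl _)).
    rewrite -fE memv_preim; suff /subvP : (tensv fullv J0 <= f @^-1: tensv fullv J)%VS.
      by apply; apply: (subvP J0co); apply: memv_img.
    apply: tensv_sub => h y _ yJ; rewrite -memv_preim fE tmapE.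
    rewrite -(linfun_linear (tmul_linearr _)).
    elim/tens_ind: (coact A b) => [|g c t IH]; first by rewrite linear0 mem0v.
    rewrite linearD memvD //= (linfun_linear (tmul_linearr _)) tmulE.
    by apply: memv_tensv; rewrite ?memvf // memv_mul ?memvf // memv_img.
  by apply/subvP=> _ /memv_imgP[b /(subvP sub) bJ ->]; rewrite memv_preim.
- left; apply/eqP; rewrite -subv0; apply/subvP=> x xJ; rewrite memv0; apply/eqP.
  apply: (incl0_inj (Gg := Ag)); rewrite linear0; apply/eqP; rewrite -memv0 -J_0.
  by rewrite -[incl0 _ x]mulr1 memv_mul ?memvf // memv_img.
right; apply/vspaceP=> y; rewrite memvf.
have sub : (J <= deg0_proj p Ag @^-1: J0)%VS.
  apply/prodvP=> _ b /memv_imgP[x xJ ->] _.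
  rewrite -memv_preim (deg0_projM Ag gp pG) (deg0_projK gp pG).
  by apply: (subvP J0r); apply: memv_mul; rewrite ?memvf.
have : (1 : A) \in J by rewrite J_1 memvf.
move/(subvP sub); rewrite -memv_preim (deg0_proj1 Ag gp pG) => J01.
by rewrite -[y]mul1r (subvP J0r) // memv_mul ?memvf.
Qed.

End LoewyDegreeZero.

(** * Transport of comodules along an equivalence *)

Section TransportComodule.
Variables (k : fieldType) (C : monCat k) (M N : moduleCat C) (F : moduleFunctor M N).
Hypothesis F_eq : is_equivalence F.
Local Notation "g \oc f" := (ccomp g f) (at level 40, left associativity).
Local Notation "f \oa g" := (Defs.ahom f g) (at level 35).

(** A comodule in a module category over the coalgebra $(K,D,e)$ of $C$. Stated abstractly because
    an equivalence sees only this structure; for $K=H$ in [rep H] it is a relative Hopf module. *)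
Definition comodule_obj (L : moduleCat C) (K : C) (D : chom K (tob K K))
    (e : chom K (tunit C)) (P : L) (d : chom P (aob K P)) : Prop :=
  aalpha K K P \oc (D \oa cid P) \oc d = (cid K \oa d) \oc d /\
  alambda P \oc (e \oa cid P) \oc d = cid P.

Variables (K : C) (D : chom K (tob K K)) (e : chom K (tunit C)).
Variables (Q : M) (P : N) (i : chom (F Q) P) (j : chom P (F Q)).
Hypotheses (ji : j \oc i = cid (F Q)) (ij : i \oc j = cid P).
Variable d : chom P (aob K P).
Hypothesis dP : comodule_obj D e d.

(** Fullness of $F$ produces the coaction; its axioms hold because they hold after the faithful $F$,
    where the pentagon and triangle of the module functor reduce them to those of $P$. *)
Lemma transport_comodule : exists2 d' : chom Q (aob K Q),
  mf_str F K Q \oc fhom F d' = (cid K \oa j) \oc d \oc i & comodule_obj D e d'.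
Proof.
have str_iso X Y := mf_str_iso F X Y; have [dA de] := dP.
have [s [s1 s2]] := str_iso K Q.
have [d' d'E] := equivalence_full F_eq (s \oc ((cid K \oa j) \oc (d \oc i))).
have Fd' : mf_str F K Q \oc fhom F d' = (cid K \oa j) \oc (d \oc i).
  by rewrite d'E ccompA s2 ccomp1l.
have ahom_compr (L : moduleCat C) (X : C) (Y Y' Y'' : L) (g : chom Y' Y'') (f : chom Y Y') :
    (cid X \oa g) \oc (cid X \oa f) = cid X \oa (g \oc f).
  by rewrite -ahom_comp ccomp1l.
have ahom_swap (L : moduleCat C) (X X' : C) (Y Y' : L) (f : chom X X') (g : chom Y Y') :
    (f \oa cid Y') \oc (cid X \oa g) = (cid X' \oa g) \oc (f \oa cid Y).
  by rewrite -!ahom_comp !ccomp1l !ccomp1r.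
have nat_str X X' Y Y' T (f : chom X X') (g : chom Y Y') (r : chom T _) :
    mf_str F X' Y' \oc (fhom F (f \oa g) \oc r) = (f \oa fhom F g) \oc (mf_str F X Y \oc r).
  by rewrite !ccompA mf_str_nat.
have nat_j (Y : N) (r : chom Y _) : aalpha K K (F Q) \oc ((cid (tob K K) \oa j) \oc r) =
    (cid K \oa (cid K \oa j)) \oc (aalpha K K P \oc r).
  by rewrite -thom_id !ccompA aalpha_nat.
exists d'; first by rewrite Fd' ccompA.
split; apply: (equivalence_faithful F_eq).
  (* The canonical isomorphism from $F(K\otimes(K\otimes Q))$ to $K\otimes(K\otimes F(Q))$; after
     it, both sides are expressed through [d]. *)
  have K_iso : is_iso ((cid K \oa mf_str F K Q) \oc mf_str F K (aob K Q)).
    have [u [u1 u2]] := str_iso K (aob K Q).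
    exists (u \oc (cid K \oa s)); split.
      rewrite -ccompA (ccompA (cid K \oa s)) ahom_compr s1 Defs.ahom_id ccomp1l.
      exact: u1.
    rewrite -ccompA (ccompA _ u) u2 ccomp1l ahom_compr s2; exact: Defs.ahom_id.
  apply: (iso_lcancel K_iso); rewrite !fhom_comp -!ccompA.
  transitivity ((cid K \oa (cid K \oa j)) \oc ((cid K \oa d) \oc (d \oc i))).
    rewrite [LHS]ccompA [LHS]ccompA -mf_pentagon -ccompA nat_str fhom_id Fd'.
    rewrite (ccompA (D \oa _)) ahom_swap -ccompA nat_j; congr (_ \oc _).
    by rewrite !ccompA dA.
  rewrite nat_str Fd' !ccompA !ahom_compr; congr (_ \oc _ \oc _); congr (_ \oa _).
  by rewrite Fd' -!ccompA ij ccomp1r.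
rewrite !fhom_comp -mf_triangle fhom_id -!ccompA nat_str Fd' fhom_id.
rewrite (ccompA (e \oa _)) ahom_swap -ccompA (ccompA (alambda _)) alambda_nat -ccompA.
by rewrite (ccompA (e \oa _)) (ccompA (alambda _)) (ccompA (alambda _)) de ccomp1l.
Qed.

End TransportComodule.

(** * Recovering $C$ as an endomorphism algebra over $A$ *)

Section TransportAlgebra.
Variables (k : fieldType) (H : hopfAlgebra k) (A C : comodAlgebra H).
Variable F : moduleFunctor (comod_modules A) (comod_modules C).
Hypothesis F_eq : is_equivalence F.
Local Notation RH := (reg_module H).
Local Notation RC := (reg_module C).

Fact coact_hom_subproof : (coact C : 'Hom(RC, tens_module RH RC)) \in Ahoms RC (tens_module RH RC).
Proof. by apply: AhomP => c x; rewrite tens_module_actE tact_reg reg_actE coactM. Qed.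

Definition coact_hom : Ahom RC (tens_module RH RC) := Subvs coact_hom_subproof.

Lemma coact_comodule :
  @comodule_obj _ _ (comod_modules C) RH (comult_hom H) (counit_hom H) RC coact_hom.
Proof.
split; apply: (@Ahom_eqP _ _ RC) => c.
  rewrite [LHS]comp_lfunE [RHS]comp_lfunE [X in X _]/= comp_lfunE; exact: coactA.
rewrite [LHS]comp_lfunE [X in X _]/= comp_lfunE /= -tev_tunitl id_lfunE.
exact: coact_counit.
Qed.

(** Right multiplication in $H\otimes C$, as [W_mul] shows, packaged as module endomorphisms. *)
Let W : 'Hom(tens H C, Ahom (tens_module RH RC) (tens_module RH RC)) :=
  tlift (fun (h : RH) (c : RC) => tens_hom (ev h) (ev c)).

Let WE (h : RH) (c : RC) : W (h \ox c) = tens_hom (ev h) (ev c).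
Proof.
rewrite [LHS]tliftE //; split=> [x|x] a u v.
  by rewrite ev_linear (tens_hom_bilinear _ _ _ _).1.
by rewrite ev_linear (tens_hom_bilinear _ _ _ _).2.
Qed.

Let W_mul s t : vsval (W t) s = tmul s t.
Proof.
rewrite -(linfun_linear (tmul_linearl t)).
elim/tens_ind: s => [|a b s IH]; first by rewrite !linear0.
rewrite !linearD /= IH; congr (_ + _).
rewrite (linfun_linear (tmul_linearl t)) -(linfun_linear (tmul_linearr _)).
elim/tens_ind: t {s IH} => [|x y t IH]; first by rewrite !linear0 zero_lfunE.
rewrite !linearD /= add_lfunE IH; congr (_ + _).
rewrite (linfun_linear (tmul_linearr _)) tmulE WE.
by rewrite [LHS](tmapE (ev_lfun (x : RH)) (ev_lfun (y : RC))) !ev_lfunE !reg_module_actE.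
Qed.

(* In Sweedler notation the last clause reads
   delta (phi c q) = q_(-1) c_(-1) (x) phi c_(0) (q_(0)). *)
Theorem transport_algebra :
  exists (Q : hopfModule A) (phi : 'Hom(C, Ahom Q Q)),
  [/\ bijective phi, phi 1 = Ahom_id Q,
      forall c c', phi (c * c') = Ahom_comp (phi c') (phi c) &
      forall c, Ahom_comp (hm_co Q) (phi c) = str Q RH Q (tmap \1 phi (coact C c))].
Proof.
have [G [_ [eps [eps_iso _]]]] := F_eq.
pose Qo : comod_modules A := G RC; pose Q : lmodule A := Qo; pose FQ : lmodule C := F Q.
have [i [j [ji ij]]] : exists (i : Ahom FQ RC) (j : Ahom RC FQ),
    Ahom_comp j i = Ahom_id FQ /\ Ahom_comp i j = Ahom_id RC.
  by have [j [ji ij]] := eps_iso RC; exists (eps RC), j.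
have [d dE [dA de]] := transport_comodule F_eq ji ij coact_comodule.
have faith := equivalence_faithful F_eq; have full := equivalence_full F_eq.
have dA' (q : Q) : tassoc _ _ _ (tmap (comult H) \1 (vsval (d : Ahom Q (tens_module RH Q)) q)) =
    tmap \1 (vsval (d : Ahom Q (tens_module RH Q))) (vsval (d : Ahom Q (tens_module RH Q)) q).
  have := congr1 (fun u : Ahom Q (tens_module RH (tens_module RH Q)) => vsval u q) dA.
  by rewrite [LHS]comp_lfunE [RHS]comp_lfunE [X in X _ = _]/= comp_lfunE.
have de' (q : Q) : tev _ (counit H) (vsval (d : Ahom Q (tens_module RH Q)) q) = q.
  have := congr1 (fun u : Ahom Q Q => vsval u q) de.
  by rewrite [LHS]comp_lfunE [X in X _ = _]/= comp_lfunE /= -tev_tunitl id_lfunE.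
pose QH : hopfModule A := HopfModule dA' de'.
pose Fl : 'Hom(Ahom Q Q, Ahom FQ FQ) := linfun (fun f : Ahom Q Q => fhom F (f : chom Qo Qo)).
have FlE f : Fl f = fhom F (f : chom Qo Qo).
  exact: (linfun_linear (@fhom_linear _ _ _ F Qo Qo)).
have Fl_inj : injective Fl by move=> f g; rewrite !FlE => /faith.
have FlK g : Fl ((Fl^-1)%VF g) = g.
  by apply: limg_lfunVK; have [f <-] := full Qo Qo g; rewrite -FlE memv_img ?memvf.
(* Conjugate of right multiplication by $c$ under $F(Q)\cong C$; these exhaust $\mathrm{End}_C(C)$,
   which is $C^{op}$. *)
pose Phi_fun (c : C) : Ahom FQ FQ := Ahom_comp j (Ahom_comp (ev (c : RC)) i).
have Phi_lin : linear Phi_fun.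
  move=> a x y; rewrite /Phi_fun [ev _](@ev_linear _ _ RC).
  by rewrite (Ahom_comp_bilinear _ _ _).1 (Ahom_comp_bilinear _ _ _).2.
pose phi : 'Hom(C, Ahom Q Q) := (Fl^-1 \o linfun Phi_fun)%VF.
have phiE c : Fl (phi c) = Phi_fun c by rewrite /phi comp_lfunE (linfun_linear Phi_lin) FlK.
have Phi_inj : injective Phi_fun.
  move=> c c' /(congr1 (fun u => Ahom_comp (Ahom_comp i u) j)).
  rewrite /Phi_fun !Ahom_compA ij !Ahom_comp1l -!Ahom_compA ij !Ahom_comp1r.
  by move/(congr1 (fun u : Ahom RC RC => vsval u 1)); rewrite !evE !reg_module_actE !mul1r.
have phi_inj : injective phi by move=> c c' /(congr1 Fl); rewrite !phiE => /Phi_inj.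
have phi_surj g : exists c, phi c = g.
  pose u : Ahom RC RC := Ahom_comp i (Ahom_comp (Fl g) j).
  exists (vsval u 1); apply: Fl_inj; rewrite phiE /Phi_fun.
  have -> : ev (vsval u 1 : RC) = u.
    apply: Ahom_eqP => x; rewrite evE -AhomE; congr (vsval u _).
    exact: (etrans (reg_module_actE _ _) (mulr1 _)).
  by rewrite /u !Ahom_compA ji Ahom_comp1l -Ahom_compA ji Ahom_comp1r.
exists QH, phi; split.
- exists (phi^-1)%VF; first by apply: lker0_lfunK; apply/lker0P.
  by move=> g; apply: limg_lfunVK; have [c <-] := phi_surj g; rewrite memv_img ?memvf.
- apply: Fl_inj; rewrite phiE FlE fhom_id /Phi_fun (_ : ev _ = Ahom_id RC).
    by rewrite Ahom_comp1l ji.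
  by apply: Ahom_eqP => x; rewrite evE reg_module_actE mulr1 id_lfunE.
- move=> c c'; apply: Fl_inj; rewrite phiE FlE fhom_comp -!FlE !phiE /Phi_fun.
  rewrite [RHS](_ : _ = Ahom_comp j (Ahom_comp (Ahom_comp (ev (c' : RC)) (ev (c : RC))) i)).
    by rewrite ev_comp reg_module_actE.
  by rewrite [LHS](_ : _ = Ahom_comp (Phi_fun c') (Phi_fun c)) //
    /Phi_fun -!Ahom_compA (Ahom_compA i) ij Ahom_comp1l.
move=> c; apply: faith; apply: (iso_lcancel (mf_str_iso F (RH : rep H) Q)).
rewrite fhom_comp ccompA dE -FlE phiE.
pose m := mf_str F (RH : rep H) Qo.
pose F2 : 'Hom(Ahom Q (tens_module RH Q), Ahom FQ (F (tens_module RH Q) : lmodule C)) :=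
  linfun (fun f : Ahom Q (tens_module RH Q) => fhom F (f : chom Qo (tens_module RH Q))).
have F2E f : F2 f = fhom F (f : chom Qo (tens_module RH Q)).
  exact: (linfun_linear (@fhom_linear _ _ _ F Qo (tens_module RH Q))).
pose pre : 'Hom(Ahom RC (tens_module RH RC), Ahom FQ (tens_module RH RC)) :=
  linfun (fun f => Ahom_comp f i).
pose pre' : 'Hom(Ahom (tens_module RH RC) (tens_module RH RC), Ahom RC (tens_module RH RC)) :=
  linfun (fun f => Ahom_comp f coact_hom).
have preE f : pre f = Ahom_comp f i.
  exact: (linfun_linear ((Ahom_comp_bilinear _ _ _).1 i)).
have preE' f : pre' f = Ahom_comp f coact_hom.
  exact: (linfun_linear ((Ahom_comp_bilinear _ _ _).1 coact_hom)).
(* Both sides are extended to linear maps on all of $H\otimes C$, where they can be compared on pure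
   tensors before specializing to $\lambda(c)$. *)
pose lhs : 'Hom(tens H C, Ahom FQ (tens_module RH FQ)) :=
  (postcomp FQ (m : Ahom _ (tens_module RH FQ)) \o F2 \o str QH RH QH \o tmap \1 phi)%VF.
pose rhs : 'Hom(tens H C, Ahom FQ (tens_module RH FQ)) :=
  (postcomp FQ (tens_hom (Ahom_id RH) j) \o pre \o pre' \o W)%VF.
have key : lhs =1 rhs.
  apply: tens_extE => h x; rewrite ![lhs _]comp_lfunE ![rhs _]comp_lfunE.
  rewrite !comp_lfunE !postcompE preE preE' F2E tmapE id_lfunE (WE h x).
  rewrite (@strE _ _ _ QH RH QH (h : RH) (phi x)).
  transitivity (ccomp m (ccomp (fhom F
    (@Defs.ahom _ _ (comod_modules A) (RH : rep H) (RH : rep H) Qo Qo (ev (h : RH)) (phi x))) (fhom F d))).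
    by rewrite -fhom_comp.
  rewrite ccompA mf_str_nat -ccompA dE -FlE phiE /Phi_fun.
  have -> : ccomp (ccomp (Defs.ahom (@cid _ (rep H) RH) (j : chom (RC : comod_modules C) FQ)) coact_hom) i =
    Ahom_comp (tens_hom (Ahom_id RH) j) (Ahom_comp coact_hom i) by rewrite Ahom_compA.
  have e : Ahom_comp (tens_hom (ev (h : RH)) (Ahom_comp j (Ahom_comp (ev (x : RC)) i)))
      (tens_hom (Ahom_id RH) j) =
    Ahom_comp (tens_hom (Ahom_id RH) j) (tens_hom (ev (h : RH)) (ev (x : RC))).
    by rewrite -!tens_hom_comp Ahom_comp1l Ahom_comp1r -!Ahom_compA ij Ahom_comp1r.
  rewrite [LHS]Ahom_compA [X in Ahom_comp X _]e -!Ahom_compA; reflexivity.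
transitivity (rhs (coact C c)); last first.
  by rewrite -key ![lhs _]comp_lfunE !comp_lfunE postcompE F2E.
rewrite ![rhs _]comp_lfunE !comp_lfunE postcompE preE preE'.
(* Multiplicativity of the coaction: $\lambda(x)\lambda(c)=\lambda(xc)$. *)
have -> : Ahom_comp (W (coact C c)) coact_hom = Ahom_comp coact_hom (ev (c : RC)).
  apply: (@Ahom_eqP _ _ RC) => x; rewrite [LHS]comp_lfunE [RHS]comp_lfunE W_mul.
  by rewrite -[X in tmul X _]/(coact C x) -coactM evE reg_module_actE.
rewrite /Phi_fun.
have -> : ccomp (ccomp (Defs.ahom (@cid _ (rep H) RH) (j : chom (RC : comod_modules C) FQ)) coact_hom) i =
  Ahom_comp (Ahom_comp (tens_hom (Ahom_id RH) j) coact_hom) i by [].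
rewrite [LHS](_ : _ = Ahom_comp (Ahom_comp (Ahom_comp (tens_hom (Ahom_id RH) j) coact_hom) i)
  (Ahom_comp j (Ahom_comp (ev (c : RC)) i))) //.
by rewrite -!Ahom_compA (Ahom_compA i) ij Ahom_comp1l.
Qed.

End TransportAlgebra.

(** * Inducing from degree zero *)

Section SubHopfModule.
Variables (k : fieldType) (H : hopfAlgebra k) (A : comodAlgebra H) (E : hopfModule A).
Local Notation RH := (reg_module H).

Lemma sub_hopfModule (U : {vspace E}) :
    (forall a w, w \in U -> lm_act E a w \in U) ->
    (forall w, w \in U -> vsval (hm_co E) w \in tensv fullv U) ->
  exists (Q : hopfModule A) (j : Ahom Q E),
    [/\ injective (vsval j), limg (vsval j) = U &
        forall q, vsval (hm_co E) (vsval j q) = tmap \1 (vsval j) (vsval (hm_co Q) q)].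
Proof.
move=> stA stC; have [N [j [j_inj jU]]] := submodule_ex stA.
have j2_inj : injective (vsval (tens_hom (Ahom_id RH) j)).
  by apply: tmap_inj => // x y; rewrite !id_lfunE.
have [|d dE] := @Ahom_factor_inj _ _ _ _ _ _ (Ahom_comp (hm_co E) j) j2_inj.
  move=> m; rewrite [X in X \in _]comp_lfunE.
  have jm : vsval j m \in U by rewrite -jU memv_img ?memvf.
  suff /subvP : (tensv fullv U <= limg (vsval (tens_hom (Ahom_id RH) j)))%VS.
    by apply; apply: stC.
  apply: tensv_sub => h y _; rewrite -jU => /memv_imgP[n _ ->].
  have -> : h \ox vsval j n = vsval (tens_hom (Ahom_id RH) j) (h \ox n).
    by rewrite /= tmapE id_lfunE.
  exact: memv_img (memvf _).
have dE' q : tmap \1 (vsval j) (vsval d q) = vsval (hm_co E) (vsval j q).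
  have := congr1 (fun u : Ahom N (tens_module RH E) => vsval u q) dE.
  by rewrite [LHS]comp_lfunE [RHS]comp_lfunE.
have dA q : tassoc _ _ _ (tmap (comult H) \1 (vsval d q)) = tmap \1 (vsval d) (vsval d q).
  apply: (tmap_inj (f := \1%VF) (g := tmap \1 (vsval j))) => [x y|x y|].
  - by rewrite !id_lfunE.
  - exact: j2_inj.
  have -> : tmap \1 (tmap \1 (vsval j)) (tmap \1 (vsval d) (vsval d q)) =
      tmap \1 (vsval (hm_co E)) (tmap \1 (vsval j) (vsval d q)).
    rewrite -[LHS]comp_lfunE -[RHS]comp_lfunE !tmap_comp comp_lfun1l.
    congr (fun_of_lfun (tmap _ _) _); apply/lfunP=> x.
    by rewrite [LHS]comp_lfunE [RHS]comp_lfunE; apply: dE'.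
  rewrite dE' -hm_coA -dE'; elim/tens_ind: (vsval d q) => [|h n t IHt].
    by rewrite !linear0.
  rewrite !linearD /= IHt; congr (_ + _); rewrite !tmapE !id_lfunE.
  elim/tens_ind: (comult H h) => [|x y u IH]; first by rewrite !(tpure0l, linear0).
  by rewrite !(tpureDl, linearD) /= IH !(tassocE, tmapE, id_lfunE).
have de q : tev _ (counit H) (vsval d q) = q.
  by apply: j_inj; rewrite -tev_tmap dE' hm_counit.
by exists (HopfModule dA de), j; split.
Qed.

End SubHopfModule.

Section Induction.
Variables (k : fieldType) (H : coradGradedHopf k) (A : LoewyGraded H).
Local Notation Hg := (hopf_graded_alg (cgh_graded H)).
Local Notation Ag := (Loewy_grading_alg (lg_grading A)).
Local Notation H0 := (coradical_part H).
Local Notation A0 := (comod_deg0 A).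
Local Notation RH := (reg_module H).
Local Notation iH := (incl0 Hg : 'Hom(H0, H)).
Local Notation iA := (incl0 Ag : 'Hom(A0, A)).
Variables (pH : nat -> 'End(H)) (NH : nat) (pA : nat -> 'End(A)) (NA : nat).
Hypotheses (gpH : gproj pH NH) (pHG : forall n v, (v \in hdeg H n) <-> pH n v = v).
Hypotheses (gpA : gproj pA NA) (pAG : forall n v, (v \in ldeg A n) <-> pA n v = v).
Variable Q : hopfModule A0.
Local Notation co0 := (vsval (hm_co Q)).

(** The interface between the construction of $Q'$ and its use. In [ge_Loewy] a homogeneous element
    of degree $n$ is determined by the $H(n)\otimes Q'(0)$ part of its coaction; [ge_extend] will
    embed $C$ into the endomorphisms of $Q'$. *)
Record graded_extension (Qh : hopfModule A) (inc : 'Hom(Q, Qh))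
    (pQ : nat -> 'End(Qh)) (N : nat) : Prop := GradedExtension {
  ge_inj : injective inc;
  ge_act : forall (a : A0) q, inc (lm_act Q a q) = lm_act Qh (iA a) (inc q);
  ge_co : forall q, vsval (hm_co Qh) (inc q) = tmap iH inc (co0 q);
  ge_gen : forall (W : vectType k) (f g : 'Hom(Qh, W)),
    (forall a q, f (lm_act Qh a (inc q)) = g (lm_act Qh a (inc q))) -> f =1 g;
  ge_gproj : gproj pQ N;
  ge_deg0 : forall q, pQ 0%N (inc q) = inc q;
  ge_deg0_img : forall y, exists q, pQ 0%N y = inc q;
  ge_act_deg : forall n d a y, a \in ldeg A d ->
    pQ n (lm_act Qh a y) = if (d <= n)%N then lm_act Qh a (pQ (n - d)%N y) else 0;
  ge_co_deg : forall i l n y, (i + l)%N != n -> pQ n y = y ->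
    tmap (pH i) (pQ l) (vsval (hm_co Qh) y) = 0;
  ge_Loewy : forall n y, pQ n y = y ->
    tmap (pH n) (pQ 0%N) (vsval (hm_co Qh) y) = 0 -> y = 0;
  ge_extend : forall (C : comodAlgebra H0) (phi : 'Hom(C, Ahom Q Q)),
    (forall c, Ahom_comp (hm_co Q) (phi c) =
       str Q (reg_module H0) Q (tmap \1 phi (coact C c))) ->
    exists Psi : 'Hom(C, Ahom Qh Qh), forall c q,
      vsval (Psi c) (inc q) = inc (vsval (phi c) q) }.

Local Notation pi := (deg0_proj pA Ag : 'Hom(A, A0)).

Let piM a b : pi (a * b) = pi a * pi b.
Proof. exact: (deg0_projM Ag gpA pAG). Qed.

Let pi1 : pi 1 = 1.
Proof. exact: (deg0_proj1 Ag gpA pAG). Qed.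

Let piK (a : A0) : pi (iA a) = a.
Proof. exact: (deg0_projK gpA pAG). Qed.

Let pi_deg n a : a \in ldeg A n -> n != 0%N -> pi a = 0.
Proof.
move=> aG n0; apply: (incl0_inj (Gg := Ag)).
by rewrite (deg0_projE Ag gpA pAG) (gproj_neq gpA pAG aG) 1?eq_sym ?linear0.
Qed.

Let infl_actE a : (lm_act Q \o pi)%VF a = lm_act Q (pi a).
Proof. exact: comp_lfunE. Qed.

Fact infl_act1 : (lm_act Q \o pi)%VF 1 = \1%VF.
Proof. by rewrite infl_actE pi1 lm_act1. Qed.

Fact infl_actM a b :
  (lm_act Q \o pi)%VF (a * b) = ((lm_act Q \o pi)%VF a \o (lm_act Q \o pi)%VF b)%VF.
Proof. by rewrite !infl_actE piM lm_actM. Qed.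

Definition inflation : lmodule A := LModule infl_act1 infl_actM.

Local Notation E := (free_hopf inflation).

(** The coaction embeds $Q$ into $H\otimes Q$ linearly over $A(0)$, so $Q'$ is the $A$-submodule
    generated by its image. *)
Let del : 'Hom(Q, E) := (tmap iH \1 \o co0)%VF.

Let delE q : del q = tmap iH \1 (co0 q).
Proof. exact: comp_lfunE. Qed.

Let del_counit q : tev Q (counit H) (del q) = q.
Proof.
rewrite delE -[RHS]hm_counit; elim/tens_ind: (co0 q) => [|h x t IH]; first by rewrite !linear0.
by rewrite !linearD /= IH tmapE !tevE id_lfunE comp_lfunE.
Qed.

Let del_act (a : A0) q : del (lm_act Q a q) = lm_act E (iA a) (del q).
Proof.
rewrite !delE AhomE; move: (co0 q) => t.
rewrite tens_module_actE tens_module_actE -[coact A _]comod_deg0_coactE.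
elim/tens_ind: t => [|h x t IH]; first by rewrite !linear0.
rewrite !linearD /= IH; congr (_ + _); rewrite tmapE id_lfunE.
elim/tens_ind: (coact A0 a) => [|g b s IHs].
  by rewrite !linear0 !zero_lfunE linear0.
rewrite !linearD /= !add_lfunE linearD /= IHs; congr (_ + _).
rewrite !tactE !tmapE !tactE !tmapE /= !reg_actE id_lfunE infl_actE piK.
by rewrite incl0M.
Qed.

Let del_co q : vsval (hm_co E) (del q) = tmap \1 del (del q).
Proof.
rewrite [vsval (hm_co E) _]free_coE delE.
have -> : tmap \1 del (tmap iH \1 (co0 q)) = tmap iH (tmap iH \1) (tmap \1 co0 (co0 q)).
  by rewrite -!comp_lfunE !tmap_comp !(comp_lfun1l, comp_lfun1r).
rewrite -hm_coA; elim/tens_ind: (co0 q) => [|h x t IH]; first by rewrite !linear0.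
rewrite !linearD /= IH; congr (_ + _); rewrite !tmapE !id_lfunE.
have -> : comult H (iH h) = tmap iH iH (comult H0 h) by rewrite [RHS]comult0E.
elim/tens_ind: (comult H0 h) => [|u v s IHs]; first by rewrite !(linear0, tpure0l).
by rewrite !(linearD, tpureDl) /= IHs !(tmapE, tassocE, id_lfunE).
Qed.

Let pE n : 'End(E) := tmap (pH n) \1.

Let pE_gproj : gproj pE NH.
Proof.
have [pp pN sp] := gpH; split=> [m n v|n Nn|v].
- rewrite -comp_lfunE tmap_comp comp_lfun1l; elim/tens_ind: v => [|h q t IH].
    by rewrite !linear0 if_same.
  rewrite !linearD /= IH !tmapE id_lfunE comp_lfunE pp.
  by case: (m == n); rewrite // ?tpure0l ?addr0.
- by rewrite /pE pN // tmap0l.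
rewrite -sum_lfunE -tmap_suml (_ : \sum_(i < NH) pH i = \1%VF) ?tmap1 ?id_lfunE //.
by apply/lfunP=> h; rewrite sum_lfunE sp id_lfunE.
Qed.

Let pE_del n q : pE n (del q) = if n == 0%N then del q else 0.
Proof.
rewrite delE -comp_lfunE tmap_comp comp_lfun1l.
have [->|n0] := eqVneq n 0%N.
  congr (fun_of_lfun (tmap _ _) _); apply/lfunP=> h; rewrite comp_lfunE.
  by apply/pHG; apply: incl0_in.
rewrite (_ : (pH n \o iH)%VF = 0) ?tmap0l ?zero_lfunE //.
apply/lfunP=> h; rewrite comp_lfunE zero_lfunE.
by apply: (gproj_neq gpH pHG (incl0_in h)).
Qed.

(** In $\lambda(a)\in\bigoplus_i H(i)\otimes A(d-i)$ only the term $i=d$ survives the inflation,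
    which kills positive degrees of $A$; so $a$ acts by multiplication with elements of $H(d)$ on
    the first factor. *)
Let pE_act n d a y : a \in ldeg A d ->
  pE n (lm_act E a y) = if (d <= n)%N then lm_act E a (pE (n - d)%N y) else 0.
Proof.
move=> aG; elim/tens_ind: y => [|h q t IH]; first by rewrite !linear0 if_same.
have linT (y : E) : linear (fun s : tens H A => tact (lm_act RH) (lm_act inflation) s y).
  by move=> c u v; rewrite linearP add_lfunE scale_lfunE.
pose T (y : E) : 'Hom(tens H A, E) :=
  linfun (fun s => tact (lm_act RH) (lm_act inflation) s y).
have TE (y : E) g b (x : H) (p : Q) : y = x \ox p -> T y (g \ox b) = (g * x) \ox lm_act Q (pi b) p.
  by move=> ->; rewrite (linfun_linear (linT _)) tactE tmapE /= reg_actE infl_actE.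
have actT y : lm_act E a y = T y (coact A a).
  by rewrite [lm_act E a]tens_module_actE (linfun_linear (linT _)).
have pureE : pE n (lm_act E a (h \ox q)) =
    if (d <= n)%N then lm_act E a (pE (n - d)%N (h \ox q)) else 0.
  rewrite !actT; pose g := if (d <= n)%N then T (pE (n - d)%N (h \ox q)) else 0.
  have -> : (if (d <= n)%N then T (pE (n - d)%N (h \ox q)) (coact A a) else 0) = g (coact A a).
    by rewrite /g; case: ifP; rewrite ?zero_lfunE.
  rewrite -comp_lfunE; apply/eqlfunP.
  have [_ _ /(_ d)/subvP cod] := lg_grading A.
  suff /subvP : (\sum_(i < d.+1) tensv (hdeg H i) (ldeg A (d - i)%N) <=
      lker (pE n \o T (h \ox q)%R - g)%VF)%VS by apply; apply/cod/memv_img.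
  apply/subv_sumP => i _; apply: tensv_sub => x b xG bG; apply/eqlfunP.
  rewrite comp_lfunE (TE _ _ _ h q) // tmapE id_lfunE /g tmapE id_lfunE.
  have [di|di] := eqVneq (d - i)%N 0%N; last first.
    rewrite (pi_deg bG di) linear0 zero_lfunE tpure0r; case: ifP => _; last by rewrite zero_lfunE.
    by rewrite (TE _ _ _ (pH (n - d)%N h) q) // (pi_deg bG di) linear0 zero_lfunE tpure0r.
  have xd : x \in hdeg H d.
    suff -> : d = i by []; apply/eqP.
    by rewrite eqn_leq -[(d <= i)%N]subn_eq0 di eqxx -ltnS ltn_ord.
  rewrite (gproj_mull Hg gpH pHG _ _ xd); case: ifP => _; last by rewrite tpure0l zero_lfunE.
  by rewrite (TE _ _ _ (pH (n - d)%N h) q).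
by rewrite !linearD /= IH pureE; case: ifP => _; rewrite ?linearD ?addr0.
Qed.

(* This submodule plays the role of A (x)_A0 Q.  The cofree module E containing it
   makes the Loewy property immediate, with no flatness of Q needed. *)
Let Ugen : 'Hom(tens A Q, E) := tlift (fun a q => lm_act E a (del q)).

Let UgenE a q : Ugen (a \ox q) = lm_act E a (del q).
Proof.
rewrite [LHS]tliftE //; split=> [x|x] c u v; rewrite ?linearP //.
by rewrite add_lfunE scale_lfunE.
Qed.

Let U := limg Ugen.

Let U_ind (W : {vspace E}) : (forall a q, lm_act E a (del q) \in W) -> (U <= W)%VS.
Proof.
move=> h; apply/subvP=> _ /memv_imgP[t _ ->]; elim/tens_ind: t => [|a q t IH].
  by rewrite linear0 mem0v.
by rewrite linearD memvD //= UgenE.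
Qed.

Let U_gen a q : lm_act E a (del q) \in U.
Proof. by rewrite -UgenE memv_img ?memvf. Qed.

Let U_act a w : w \in U -> lm_act E a w \in U.
Proof.
rewrite memv_preim; apply/subvP; apply: U_ind => b q.
by rewrite -memv_preim -lm_actME U_gen.
Qed.

Let U_del q : del q \in U.
Proof. by rewrite -[del q]lm_act1E U_gen. Qed.

Let U_co w : w \in U -> vsval (hm_co E) w \in tensv fullv U.
Proof.
rewrite memv_preim; apply/subvP; apply: U_ind => b q; rewrite -memv_preim AhomE.
have actU t : t \in tensv fullv U -> lm_act (tens_module RH E) b t \in tensv fullv U.
  rewrite memv_preim; apply/subvP; apply: tensv_sub => h u _ uU; rewrite -memv_preim.
  have [s sE] := tens_sum_seq (coact A b); rewrite (tens_act_pure (X := RH) (M := E) h u sE).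
  by apply: memv_suml => p _; apply: memv_tensv; rewrite ?memvf // U_act.
apply: actU; rewrite del_co; move: (del q) => t; elim/tens_ind: t => [|h x t IH].
  by rewrite linear0 mem0v.
by rewrite linearD memvD //= tmapE memv_tensv ?memvf ?U_del.
Qed.

Let U_deg n w : w \in U -> pE n w \in U.
Proof.
rewrite memv_preim; apply/subvP; apply: U_ind => b q; rewrite -memv_preim.
have [_ _ sp] := gpA; rewrite -[b]sp linear_sum sum_lfunE linear_sum.
apply: memv_suml => d _; rewrite /= (@pE_act n d) ?(gproj_mem gpA pAG) //.
by case: ifP => _; rewrite ?mem0v // pE_del; case: ifP => _; rewrite ?linear0 ?mem0v ?U_gen.
Qed.

(** Homogeneous $a$ of degree $d$ sends the degree-zero elements [del q] to degree $d$, so degree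
    zero comes from $A(0)$ alone, which preserves the image of [del]. *)
Let pE0_U w : w \in U -> pE 0%N w \in limg del.
Proof.
rewrite memv_preim; apply/subvP; apply: U_ind => b q; rewrite -memv_preim.
have [_ _ sp] := gpA; rewrite -[b]sp linear_sum sum_lfunE linear_sum.
apply: memv_suml => d _; rewrite /= (@pE_act 0%N d) ?(gproj_mem gpA pAG) //.
case: ifP => [|_]; last exact: mem0v.
rewrite leqn0 => /eqP->; rewrite pE_del eqxx.
by rewrite -(deg0_projE Ag gpA pAG) -del_act memv_img ?memvf.
Qed.

Let E_co_deg i l n y : (i + l)%N != n -> pE n y = y ->
  tmap (pH i) (pE l) (vsval (hm_co E) y) = 0.
Proof.
move=> iln <-; rewrite [vsval (hm_co E) _]free_coE.
elim/tens_ind: y => [|h q t IH]; first by rewrite !linear0.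
rewrite !linearD /= IH addr0 !tmapE !id_lfunE.
have -> s : tmap (pH i) (pE l) (tassoc H H Q (s \ox q)) =
    tassoc H H Q (tmap (pH i) (pH l) s \ox q).
  elim/tens_ind: s => [|u v s IHs]; first by rewrite !(linear0, tpure0l).
  by rewrite !(linearD, tpureDl) /= IHs !(tmapE, tassocE, id_lfunE).
suff -> : tmap (pH i) (pH l) (comult H (pH n h)) = 0 by rewrite tpure0l linear0.
have [_ /(_ n)/subvP cod _ _] := cgh_graded H.
have /cod : comult H (pH n h) \in (comult H @: hdeg H n)%VS.
  by rewrite memv_img // (gproj_mem gpH pHG).
suff /subvP sub : (\sum_(m < n.+1) tensv (hdeg H m) (hdeg H (n - m)%N) <=
    lker (tmap (pH i) (pH l)))%VS by move/sub; rewrite memv_ker => /eqP.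
apply/subv_sumP => m _; apply: tensv_sub => u v uG vG; rewrite memv_ker tmapE.
have [im|im] := eqVneq i m; last by rewrite (gproj_neq gpH pHG uG) // tpure0l.
rewrite (gproj_neq gpH pHG vG) ?tpure0r //; apply: contra iln => /eqP->.
by rewrite im subnKC // -ltnS.
Qed.

Let eps_pH n h : (0 < n)%N -> counit H (pH n h) = 0.
Proof.
have [_ _ eps0 _] := cgh_graded H => n0.
by have /subvP/(_ _ (gproj_mem gpH pHG n h)) := eps0 n n0; rewrite memv_ker => /eqP.
Qed.

Let eps_pH0 h : counit H (pH 0%N h) = counit H h.
Proof.
have [_ pN sp] := gpH; rewrite -[h in RHS]sp linear_sum; move: pN; case: NH => [|N] pN.
  by rewrite big_ord0 pN // zero_lfunE linear0.
by rewrite big_ord_recl big1 ?addr0 //= => i _; rewrite eps_pH.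
Qed.

(** In the cofree module, $y$ is recovered from its coaction by applying the counit to the second
    copy of $H$. The counit vanishes in positive degrees, so only the part in $H(n)\otimes E(0)$
    contributes. *)
Let E_Loewy n y : pE n y = y -> tmap (pH n) (pE 0%N) (vsval (hm_co E) y) = 0 -> y = 0.
Proof.
move=> yn y0; pose f : 'Hom(tens H E, E) := tmap \1 (tev Q (counit H)).
have tev_pE0 : (tev Q (counit H) \o pE 0%N)%VF = tev Q (counit H).
  apply: tens_ext => h q; rewrite comp_lfunE tmapE id_lfunE !tevE; congr (_ *: q).
  exact: eps_pH0.
have fco (x : E) : f (vsval (hm_co E) x) = x.
  rewrite [vsval (hm_co E) x]free_coE; elim/tens_ind: x => [|h q t IH].
    by rewrite !linear0.
  rewrite !linearD /= IH; congr (_ + _); rewrite tmapE id_lfunE.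
  rewrite -[h in RHS]counitr; elim/tens_ind: (comult H h) => [|u v s IHs].
    by rewrite !(linear0, tpure0l).
  rewrite !(linearD, tpureDl) /= IHs; congr (_ + _).
  rewrite tassocE tmapE id_lfunE tevE tliftE; first by rewrite tpureZl tpureZr.
  by split=> [?|?] c x z; rewrite ?linearP ?scalerDl ?scalerDr ?scalerA // mulrC.
have e t : pE n (f t) = f (tmap (pH n) (pE 0%N) t).
  rewrite -[LHS]comp_lfunE -[RHS]comp_lfunE; congr (fun_of_lfun _ _).
  by rewrite /f {1}/pE !tmap_comp !(comp_lfun1l, comp_lfun1r) tev_pE0.
by rewrite -yn -[y]fco e y0 linear0.
Qed.

Lemma graded_extension_exists : exists Qh inc pQ N, @graded_extension Qh inc pQ N.
Proof.
have [Qh [j [j_inj jU jco]]] := sub_hopfModule U_act U_co.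
pose r := ((vsval j)^-1)%VF.
have jK y : r (vsval j y) = y by apply: lker0_lfunK; apply/lker0P.
have rK w : w \in U -> vsval j (r w) = w by rewrite -jU; apply: limg_lfunVK.
have jy y : vsval j y \in U by rewrite -jU memv_img ?memvf.
pose inc : 'Hom(Q, Qh) := (r \o del)%VF; pose pQ n : 'End(Qh) := (r \o pE n \o vsval j)%VF.
have jinc q : vsval j (inc q) = del q by rewrite comp_lfunE rK.
have jpQ n y : vsval j (pQ n y) = pE n (vsval j y) by rewrite !comp_lfunE rK // U_deg.
have gen (W : vectType k) (f g : 'Hom(Qh, W)) :
    (forall a q, f (lm_act Qh a (inc q)) = g (lm_act Qh a (inc q))) -> f =1 g.
  move=> fg y; have /memv_imgP[t _ yt] := jy y; rewrite -[y]jK {}yt.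
  elim/tens_ind: t => [|a q t IH]; first by rewrite !linear0.
  rewrite !linearD /= IH; congr (_ + _).
  by rewrite UgenE -jinc -AhomE jK.
have jpr (i l : nat) y : tmap \1 (vsval j) (tmap (pH i) (pQ l) (vsval (hm_co Qh) y)) =
    tmap (pH i) (pE l) (vsval (hm_co E) (vsval j y)).
  rewrite jco -[LHS]comp_lfunE -[RHS]comp_lfunE !tmap_comp comp_lfun1l comp_lfun1r.
  congr (fun_of_lfun (tmap _ _) _); apply/lfunP=> x.
  by rewrite [LHS]comp_lfunE [RHS]comp_lfunE jpQ.
have j2_inj : injective (tmap \1 (vsval j) : 'Hom(tens H Qh, _)).
  by apply: tmap_inj => // x y; rewrite !id_lfunE.
exists Qh, inc, pQ, NH; split=> //.
- move=> q q' /(congr1 (vsval j)); rewrite !jinc => /(congr1 (tev Q (counit H))).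
  by rewrite !del_counit.
- by move=> a q; apply: j_inj; rewrite AhomE !jinc del_act.
- move=> q; apply: j2_inj; rewrite -jco jinc del_co delE -[LHS]comp_lfunE -[RHS]comp_lfunE.
  rewrite !tmap_comp !comp_lfun1l comp_lfun1r; congr (fun_of_lfun (tmap _ _) _).
  by apply/lfunP=> x; rewrite [RHS]comp_lfunE jinc.
- have [pp pN sp] := pE_gproj; split=> [m n y|n Nn|y].
  + by apply: j_inj; rewrite !jpQ pp; case: ifP; rewrite ?jpQ ?linear0.
  + by apply/lfunP=> y; apply: j_inj; rewrite jpQ pN // !zero_lfunE linear0.
  by apply: j_inj; rewrite linear_sum -[RHS]sp; apply: eq_bigr => n _; apply: jpQ.
- by move=> q; apply: j_inj; rewrite jpQ jinc pE_del.
- move=> y; have /memv_imgP[q _ e] := pE0_U (jy y); exists q.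
  by apply: j_inj; rewrite jpQ jinc.
- move=> n d a y aG; apply: j_inj; rewrite jpQ AhomE (@pE_act n d) //.
  by case: ifP; rewrite ?linear0 // AhomE jpQ.
- move=> i l n y iln yn; apply: j2_inj; rewrite jpr linear0.
  by apply: E_co_deg iln _; rewrite -jpQ yn.
- move=> n y yn y0; apply: j_inj; rewrite linear0.
  by apply: (@E_Loewy n); rewrite -?jpQ ?yn // -jpr y0 linear0.
(* The extension acts on $H\otimes Q$ as right multiplication by $c_{(-1)}$ tensored with
   $\phi(c_{(0)})$. It commutes with $A$, and by [phiP] it sends [del q] to [del (phi c q)], so it
   preserves $Q'$. *)
move=> C phi phiP; pose infl_fun (f : Ahom Q Q) : 'Hom(inflation, inflation) := vsval f.
have infl_in f : infl_fun f \in Ahoms inflation inflation.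
  by apply: AhomP => a q; rewrite /= infl_actE; apply: AhomE.
pose infl f : Ahom inflation inflation := Subvs (infl_in f).
have infl_lin : linear infl by move=> c f g; apply: Ahom_eqP => q.
pose R : 'Hom(tens H0 C, Ahom E E) :=
  tlift (fun (h : H0) c => tens_hom (ev (iH h : RH)) (infl (phi c))).
have RE h c : R (h \ox c) = tens_hom (ev (iH h : RH)) (infl (phi c)).
  rewrite [LHS]tliftE //; split=> [x|x] a u v.
    by rewrite linearP ev_linear (tens_hom_bilinear _ _ _ _).1.
  by rewrite linearP infl_lin (tens_hom_bilinear _ _ _ _).2.
have Rdel t q : vsval (R t) (del q) =
    tmap iH \1 (vsval (str Q (reg_module H0) Q (tmap \1 phi t)) q).
  elim/tens_ind: t => [|h c t IH]; first by rewrite !linear0 !zero_lfunE linear0.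
  rewrite !linearD /= !add_lfunE linearD /= IH; congr (_ + _).
  rewrite RE tmapE id_lfunE [X in tmap _ _ X](@strEq _ _ _ Q (reg_module H0) Q h (phi c) q).
  rewrite delE -[LHS]comp_lfunE -[RHS]comp_lfunE !tmap_comp !(comp_lfun1l, comp_lfun1r).
  congr (fun_of_lfun (tmap _ _) _); apply/lfunP=> x.
  rewrite [LHS]comp_lfunE [RHS]comp_lfunE.
  transitivity (iH x * iH h); last first.
    by rewrite -incl0M; congr (iH _); rewrite (ev_lfunE (h : reg_module H0)) reg_module_actE.
  exact: (etrans (evE (iH h : RH) (iH x)) (reg_module_actE _ _)).
have Rphi c q : vsval (R (coact C c)) (del q) = del (vsval (phi c) q).
  by rewrite Rdel -phiP [X in tmap _ _ X]comp_lfunE delE.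
have RU c y : vsval (R (coact C c)) (vsval j y) \in U.
  move: (vsval j y) (jy y) => w; rewrite memv_preim; apply/subvP; apply: U_ind => a q.
  by rewrite -memv_preim AhomE Rphi U_gen.
have Psi_in c : (r \o vsval (R (coact C c)) \o vsval j)%VF \in Ahoms Qh Qh.
  apply: AhomP => a y; apply: j_inj.
  by rewrite !comp_lfunE [RHS]AhomE !rK ?RU // -?AhomE ?RU // !AhomE.
pose Psi_fun c : Ahom Qh Qh := Subvs (Psi_in c).
have PsiE c y : vsval j (vsval (Psi_fun c) y) = vsval (R (coact C c)) (vsval j y).
  by rewrite /= !comp_lfunE rK ?RU.
have Psi_lin : linear Psi_fun.
  move=> a c c'; apply: Ahom_eqP => y.
  rewrite /= !comp_lfunE !linearP /= add_lfunE scale_lfunE.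
  by rewrite linearP add_lfunE scale_lfunE !comp_lfunE.
exists (linfun Psi_fun) => c q; rewrite (linfun_linear Psi_lin); apply: j_inj.
by rewrite PsiE !jinc Rphi.
Qed.

End Induction.

(** * The Loewy-graded algebra *)

(** Degree conditions are proved with projections, while [Loewy_grading] asks for inclusions of
    subspaces; this converts the former into the latter. *)
Lemma tensv_bigraded (k : fieldType) (V W : vectType k) (p : nat -> 'End(V)) N
    (q : nat -> 'End(W)) M (F : nat -> {vspace V}) (G : nat -> {vspace W}) n (t : tens V W) :
    gproj p N -> (forall n v, (v \in F n) <-> p n v = v) ->
    gproj q M -> (forall n v, (v \in G n) <-> q n v = v) ->
    (forall i l, (i + l)%N != n -> tmap (p i) (q l) t = 0) ->
  t \in (\sum_(i < n.+1) tensv (F i) (G (n - i)%N))%VS.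
Proof.
move=> gp pF gq qG t0; have [_ _ sp] := gp; have [_ _ sq] := gq.
have <- : \sum_(i < N) \sum_(l < M) tmap (p i) (q l) t = t.
  rewrite -[RHS]id_lfunE -tmap1.
  have <- : \sum_(i < N) p i = \1%VF by apply/lfunP=> v; rewrite sum_lfunE sp id_lfunE.
  have <- : \sum_(l < M) q l = \1%VF by apply/lfunP=> v; rewrite sum_lfunE sq id_lfunE.
  rewrite tmap_suml sum_lfunE; apply: eq_bigr => i _.
  by rewrite tmap_sumr sum_lfunE.
apply: memv_suml => i _; apply: memv_suml => l _.
have [iln|iln] := eqVneq (i + l)%N n; last by rewrite t0 // mem0v.
have in_ : (i < n.+1)%N by rewrite ltnS -iln leq_addr.
apply: (subvP (sumv_sup (Ordinal in_) isT (subvv _))) => /=.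
have -> : (n - i)%N = l by rewrite -iln addKn.
elim/tens_ind: t {t0} => [|v w t IH]; first by rewrite linear0 mem0v.
rewrite linearD memvD //= tmapE memv_tensv //; first exact: gproj_mem gp pF _ _.
exact: gproj_mem gq qG _ _.
Qed.

Lemma comod_iso_sym (k : fieldType) (H : hopfAlgebra k) (A B : comodAlgebra H) :
  comod_iso A B -> comod_iso B A.
Proof.
case=> f [f_bij f1 fM fco]; have f_inj := bij_inj f_bij.
have [g0 fK gK] := f_bij.
have gE b : (f^-1)%VF b = g0 b.
  by apply: f_inj; rewrite gK; apply: limg_lfunVK; rewrite -[b]gK memv_img ?memvf.
have fVK b : f ((f^-1)%VF b) = b by rewrite gE gK.
exists (f^-1)%VF; split.
- by exists f => b; [exact: fVK | rewrite gE fK].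
- by apply: f_inj; rewrite fVK f1.
- by move=> a b; apply: f_inj; rewrite fM !fVK.
move=> b; apply: (tmap_inj (f := \1%VF) (g := f)) => [x y|//|].
  by rewrite !id_lfunE.
rewrite -fco fVK -[RHS]comp_lfunE tmap_comp comp_lfun1l.
rewrite (_ : (f \o f^-1)%VF = \1%VF) ?tmap1 ?id_lfunE //.
by apply/lfunP=> x; rewrite comp_lfunE fVK id_lfunE.
Qed.

Section InducedAlgebra.
Variables (k : fieldType) (H : coradGradedHopf k) (A : LoewyGraded H).
Local Notation Hg := (hopf_graded_alg (cgh_graded H)).
Local Notation Ag := (Loewy_grading_alg (lg_grading A)).
Local Notation H0 := (coradical_part H).
Local Notation A0 := (comod_deg0 A).
Local Notation RH := (reg_module H).
Local Notation iH := (incl0 Hg : 'Hom(H0, H)).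
Variables (pH : nat -> 'End(H)) (NH : nat) (pA : nat -> 'End(A)) (NA : nat).
Hypotheses (gpH : gproj pH NH) (pHG : forall n v, (v \in hdeg H n) <-> pH n v = v).
Hypotheses (gpA : gproj pA NA) (pAG : forall n v, (v \in ldeg A n) <-> pA n v = v).
Variables (Q : hopfModule A0) (Qh : hopfModule A) (inc : 'Hom(Q, Qh)).
Variables (pQ : nat -> 'End(Qh)) (N : nat).
Hypothesis ge : graded_extension pH inc pQ N.
Hypotheses (A_simple : right_simple A) (Qh_gt0 : (0 < dimT Qh)%N).
Local Notation B := (end_comod A_simple Qh_gt0).
Local Notation co0 := (vsval (hm_co Q)).
Local Notation co := (vsval (hm_co Qh)).

Let Ahom_gen (M : lmodule A) (f g : Ahom Qh M) :
  (forall q, vsval f (inc q) = vsval g (inc q)) -> f = g.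
Proof.
move=> fg; apply: Ahom_eqP; apply: (ge_gen ge) => a q.
by rewrite !AhomE fg.
Qed.

Let pQ_ge n y : (N <= n)%N -> pQ n y = 0.
Proof. by have [_ pN _] := ge_gproj ge => /pN->; rewrite zero_lfunE. Qed.

(** The part of $b$ that raises degrees by $n$. Natural $n$ suffice to recover $b$, because $Q'$ is
    generated in degree zero. *)
Let proj_lfun n (b : Ahom Qh Qh) : 'End(Qh) :=
  \sum_(m < N) (pQ (m + n)%N \o vsval b \o pQ m)%VF.

Let proj_lfunE n b y :
  proj_lfun n b y = \sum_(m < N) pQ (m + n)%N (vsval b (pQ m y)).
Proof. by rewrite sum_lfunE; apply: eq_bigr => m _; rewrite !comp_lfunE. Qed.

Fact proj_lfun_in n b : proj_lfun n b \in Ahoms Qh Qh.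
Proof.
apply: AhomP => a y.
have lin1 : linear (fun a : A => proj_lfun n b (lm_act Qh a y)).
  by move=> c u v; rewrite !(linearP, add_lfunE, scale_lfunE).
have lin2 : linear (fun a : A => lm_act Qh a (proj_lfun n b y)).
  by move=> c u v; rewrite !(linearP, add_lfunE, scale_lfunE).
rewrite -[LHS](linfun_linear lin1) -[RHS](linfun_linear lin2).
apply: (homog_ext gpA pAG) => d {}a aG.
rewrite (linfun_linear lin1) (linfun_linear lin2) !proj_lfunE linear_sum.
(* The added terms vanish since [pQ] is zero from [N] on; the first [d] terms vanish because $ay$
   has no component below degree $d$. What remains is the sum for $y$, shifted by $d$. *)
transitivity (\sum_(m < d + N) pQ (m + n)%N (vsval b (pQ m (lm_act Qh a y)))).
  rewrite addnC big_split_ord /= [X in _ + X]big1 ?addr0 // => i _.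
  by rewrite [pQ (N + i)%N _]pQ_ge ?leq_addr // !linear0.
rewrite big_split_ord /= big1 ?add0r => [|i _]; last first.
  by rewrite (ge_act_deg ge _ _ aG) leqNgt ltn_ord /= !linear0.
apply: eq_bigr => m _; rewrite (ge_act_deg ge _ _ aG) leq_addr addKn AhomE.
by rewrite (ge_act_deg ge _ _ aG) -addnA leq_addr addKn.
Qed.

Let proj_fun n (b : B) : B := Subvs (proj_lfun_in n (b : Ahom Qh Qh)).

Let proj_funE n (b : B) y : vsval (proj_fun n b : Ahom Qh Qh) y =
  \sum_(m < N) pQ (m + n)%N (vsval (b : Ahom Qh Qh) (pQ m y)).
Proof. exact: proj_lfunE. Qed.

Let proj_lin n : linear (proj_fun n).
Proof.
move=> c b b'; apply: (@Ahom_eqP _ _ Qh Qh) => y.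
rewrite [RHS]add_lfunE [X in _ = X + _]scale_lfunE !proj_funE scaler_sumr -big_split.
apply: eq_bigr => m _.
have -> z : vsval (c *: b + b' : Ahom Qh Qh) z =
    c *: vsval (b : Ahom Qh Qh) z + vsval (b' : Ahom Qh Qh) z.
  by rewrite [LHS]add_lfunE [X in X + _]scale_lfunE.
exact: linearP.
Qed.

Definition pB n : 'End(B) := linfun (proj_fun n).

Let pBE n b y : vsval (pB n b : Ahom Qh Qh) y =
  \sum_(m < N) pQ (m + n)%N (vsval (b : Ahom Qh Qh) (pQ m y)).
Proof. by rewrite /pB (linfun_linear (proj_lin n)) proj_funE. Qed.

Let pB_hom n b m y : pQ m y = y ->
  vsval (pB n b : Ahom Qh Qh) y = pQ (m + n)%N (vsval (b : Ahom Qh Qh) y).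
Proof.
have [pp pN sp] := ge_gproj ge => ym; rewrite pBE; have [Nm|mN] := leqP N m.
  have y0 : y = 0 by rewrite -ym pQ_ge.
  by rewrite y0 !linear0 big1 // => i _; rewrite !linear0.
rewrite (bigD1 (Ordinal mN)) //= ym big1 ?addr0 // => i im.
rewrite -ym pp (_ : (i == m :> nat) = false) ?linear0 //; exact: negPf im.
Qed.

Let pB_inc n b q : vsval (pB n b : Ahom Qh Qh) (inc q) = pQ n (vsval (b : Ahom Qh Qh) (inc q)).
Proof. exact: (@pB_hom n b 0%N _ (ge_deg0 ge q)). Qed.

Lemma pB_gproj : gproj pB N.
Proof.
have [pp pN sp] := ge_gproj ge; split=> [i j b|n Nn|b].
- apply: (@Ahom_gen Qh) => q; rewrite !pB_inc pp; case: ifP => _; rewrite ?pB_inc //.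
  by rewrite zero_lfunE.
- apply/lfunP=> b; apply: (@Ahom_gen Qh) => q; rewrite pB_inc pQ_ge // zero_lfunE.
  by rewrite zero_lfunE.
apply: (@Ahom_gen Qh) => q; rewrite linear_sum sum_lfunE -[RHS]sp.
by apply: eq_bigr => n _; apply: pB_inc.
Qed.

Definition degB n : {vspace B} := limg (pB n).

Let pBG n b : b \in degB n <-> pB n b = b.
Proof. by split=> /(gproj_limg _ _ pB_gproj). Qed.

(** The coaction of an element of $Q$ has its first factor in $H(0)$, and multiplication by degree
    zero commutes with the projections of $H$. *)
Let str_proj i l t q :
  vsval (str Qh RH Qh (tmap (pH i) (pB l) t)) (inc q) =
  tmap (pH i) (pQ l) (vsval (str Qh RH Qh t) (inc q)).
Proof.
elim/tens_ind: t => [|h b t IH]; first by rewrite !linear0 !zero_lfunE linear0.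
rewrite !linearD /= !add_lfunE linearD /= IH; congr (_ + _).
have e (h' : H) (b' : B) : vsval (str Qh RH Qh (h' \ox b')) (inc q) =
    tmap (amulr h') (vsval (b' : Ahom Qh Qh)) (tmap iH inc (co0 q)).
  by rewrite -(ge_co ge) -ev_reg; apply: (@strEq _ _ _ Qh RH Qh).
rewrite tmapE (e (pH i h) (pB l b)) (e h b); elim/tens_ind: (co0 q) => [|x y s IHs].
  by rewrite !linear0.
rewrite !linearD /= IHs; congr (_ + _); rewrite !tmapE !amulrE pB_inc.
by rewrite (gproj_mull Hg gpH pHG _ _ (incl0_in x)) subn0.
Qed.

Let coB_proj i l b q :
  vsval (str Qh RH Qh (tmap (pH i) (pB l) (coact B b))) (inc q) =
  tmap (pH i) (pQ l) (co (vsval (b : Ahom Qh Qh) (inc q))).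
Proof.
rewrite str_proj; congr (tmap _ _ _).
by rewrite [str _ _ _ _](coactBE A_simple) [LHS]comp_lfunE.
Qed.

Let coB_deg i l n b : b \in degB n -> (i + l)%N != n -> tmap (pH i) (pB l) (coact B b) = 0.
Proof.
move=> /pBG bn iln; apply: (@str_inj _ _ _ Qh RH Qh); rewrite linear0.
apply: (@Ahom_gen (tens_module RH Qh)) => q; rewrite coB_proj zero_lfunE.
apply: (ge_co_deg ge iln); rewrite -bn pB_inc.
by have [pp _ _] := ge_gproj ge; rewrite pp eqxx.
Qed.

Lemma degB_Loewy : Loewy_grading degB.
Proof.
have [pp pN sp] := ge_gproj ge.
have coB n : (coact B @: degB n <= \sum_(i < n.+1) tensv (hdeg H i) (degB (n - i)%N))%VS.
  apply/subvP=> _ /memv_imgP[b bn ->].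
  by apply: tensv_bigraded gpH pHG pB_gproj pBG _ => i l; apply: coB_deg bn.
split=> //.
- split; first exact: gproj_grading pB_gproj.
    apply/pBG; apply: (@Ahom_gen Qh) => q; rewrite pB_inc.
    have -> : vsval ((1 : B) : Ahom Qh Qh) (inc q) = inc q by exact: id_lfunE.
    exact: ge_deg0 ge q.
  move=> i j; apply/prodvP=> b b' /pBG bi /pBG b'j; apply/pBG; apply: (@Ahom_gen Qh) => q.
  have mulE : vsval (b * b' : Ahom Qh Qh) (inc q) =
      vsval (b' : Ahom Qh Qh) (vsval (b : Ahom Qh Qh) (inc q)) by exact: comp_lfunE.
  rewrite pB_inc mulE.
  have yi : pQ i (vsval (b : Ahom Qh Qh) (inc q)) = vsval (b : Ahom Qh Qh) (inc q).
    by rewrite -{1}bi pB_inc pp eqxx -pB_inc bi.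
  by rewrite -{1}b'j (pB_hom _ _ yi) pp eqxx -(pB_hom _ _ yi) b'j.
move=> n; apply/vspaceP=> b; apply/idP/idP => [|]; last first.
  move: b; apply/subvP; apply/subv_sumP => i _; apply/subvP=> b bi; rewrite -memv_preim.
  suff sub : (\sum_(j < i.+1) tensv (hdeg H j) (degB (i - j)%N) <=
      tensv (filt (hdeg H) n) fullv)%VS.
    by apply: (subvP sub); apply: (subvP (coB i)); apply: memv_img.
  apply/subv_sumP => j _; apply: tensv_sub => h b' hj _; apply: memv_tensv; last exact: memvf.
  have jn : (j < n.+1)%N by apply: leq_trans (ltn_ord j) (ltn_ord i).
  exact: (subvP (sumv_sup (Ordinal jn) isT (subvv _))).
(* For $i>n$ the $H(i)\otimes B(0)$ part of $\lambda(b)$ vanishes, hence so does the $H(i)\otimes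
   Q'(0)$ part of the coaction of $b(q)$; [ge_Loewy] then kills the degree-$i$ part of $b(q)$. *)
rewrite -memv_preim => bn; apply/(filtP pB_gproj pBG) => i ni.
apply: (@Ahom_gen Qh) => q; rewrite pB_inc zero_lfunE.
have co0_ : tmap (pH i) (pB 0%N) (coact B b) = 0.
  transitivity ((0 : 'End(tens H B)) (coact B b)); last exact: zero_lfunE.
  move: bn; apply: tensv_ind => h b' hn _.
  by rewrite tmapE zero_lfunE (elimT (filtP gpH pHG _ _) hn) // tpure0l.
set y := vsval (b : Ahom Qh Qh) (inc q); apply: (ge_Loewy ge (n := i)); first by rewrite pp eqxx.
have : tmap (pH i) (pQ 0%N) (co y) = 0 by rewrite /y -coB_proj co0_ linear0 zero_lfunE.
(* The coaction is graded, so among the homogeneous parts of $y$ only that of degree $i$ contributes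
   to $H(i)\otimes Q'(0)$. *)
rewrite -{1}[y]sp linear_sum linear_sum /= => e; rewrite -[RHS]e.
have [Ni|iN] := leqP N i.
  rewrite pQ_ge // !linear0 big1 // => m _; apply: (ge_co_deg ge (n := m)).
    by rewrite addn0 neq_ltn (leq_trans (ltn_ord m) Ni) orbT.
  by rewrite pp eqxx.
rewrite (bigD1 (Ordinal iN)) //= big1 ?addr0 // => m mi; apply: (ge_co_deg ge (n := m)).
  by rewrite addn0 eq_sym.
by rewrite pp eqxx.
Qed.

Definition end_Loewy : LoewyGraded H := MkLoewyGraded degB_Loewy.

Variables (C : comodAlgebra H0) (phi : 'Hom(C, Ahom Q Q)).
Hypotheses (phi_bij : bijective phi) (phi1 : phi 1 = Ahom_id Q).
Hypothesis phiM : forall c c', phi (c * c') = Ahom_comp (phi c') (phi c).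
Hypothesis phi_co : forall c, Ahom_comp (hm_co Q) (phi c) =
  str Q (reg_module H0) Q (tmap \1 phi (coact C c)).

(** The map from $C$ extends $\phi(c)$ from $Q$ to $Q'$; it is injective since $Q$ embeds in $Q'$.
    Compatibility with the coactions is checked after [str], on elements of $Q$. *)
Lemma end_deg0_iso : comod_iso (comod_deg0 end_Loewy) C.
Proof.
apply: comod_iso_sym.
have [Psi PsiE] := ge_extend ge phi_co.
pose Bg := Loewy_grading_alg (lg_grading end_Loewy).
pose B0 := comod_deg0 end_Loewy; pose iB : 'Hom(B0, B) := incl0 Bg.
pose PsiB : 'Hom(C, B) := Psi; pose psi : 'Hom(C, B0) := (proj0 Bg \o PsiB)%VF.
have Psi_deg0 c : PsiB c \in degB 0%N.
  apply/pBG; apply: (@Ahom_gen Qh) => q; rewrite pB_inc PsiE.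
  exact: ge_deg0 ge _.
have iB_inj : injective iB := incl0_inj (Gg := Bg).
have psiE c : iB (psi c) = PsiB c by rewrite [psi c]comp_lfunE; apply: incl0VK.
have phi_inj := bij_inj phi_bij.
have psi_inj : injective psi.
  move=> c c' /(congr1 iB); rewrite !psiE => e; apply/phi_inj/Ahom_eqP => q.
  apply: (ge_inj ge); rewrite -!PsiE.
  by have := congr1 (fun u : Ahom Qh Qh => vsval u (inc q)) e.
(* A degree-zero endomorphism preserves $Q=Q'(0)$, so it restricts to an $A(0)$-endomorphism of $Q$,
   which is some $\phi(c)$. *)
have psi_surj b : exists c, psi c = b.
  have b0 := incl0_in b; have /pBG b0' : iB b \in degB 0%N := b0.
  pose bh : Ahom Qh Qh := iB b; pose f : 'End(Q) := (inc^-1 \o vsval bh \o inc)%VF.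
  have fE q : inc (f q) = vsval bh (inc q).
    rewrite !comp_lfunE limg_lfunVK // -[bh]/(iB b : Ahom Qh Qh) -b0' pB_inc.
    have [q' ->] := ge_deg0_img ge (vsval (iB b : Ahom Qh Qh) (inc q)).
    exact: memv_img (memvf _).
  have fA : f \in Ahoms Q Q.
    by apply: AhomP => a q; apply: (ge_inj ge); rewrite fE !(ge_act ge) AhomE fE.
  have [phi' _ phiK] := phi_bij; exists (phi' (Subvs fA)); apply: iB_inj.
  by rewrite psiE; apply: (@Ahom_gen Qh) => q; rewrite PsiE phiK; apply: fE.
exists psi; split.
- exists (psi^-1)%VF; first by apply: lker0_lfunK; apply/lker0P.
  by move=> b; apply: limg_lfunVK; have [c <-] := psi_surj b; rewrite memv_img ?memvf.
- apply: iB_inj; rewrite psiE [RHS](incl01 Bg); apply: (@Ahom_gen Qh) => q.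
  by rewrite PsiE phi1 id_lfunE; apply/esym/id_lfunE.
- move=> c c'; apply: iB_inj; rewrite [RHS](incl0M (Gg := Bg)) -!/iB !psiE.
  apply: (@Ahom_gen Qh) => q; rewrite PsiE phiM [in LHS]comp_lfunE -!PsiE.
  exact/esym/comp_lfunE.
move=> c; apply: (tmap_inj (f := iH) (g := iB)); [exact: incl0_inj | exact: iB_inj |].
rewrite [LHS](coact0E (A := end_Loewy)) -/iB psiE -[RHS]comp_lfunE tmap_comp comp_lfun1r.
have -> : (iB \o psi)%VF = PsiB by apply/lfunP=> x; rewrite comp_lfunE psiE.
apply: (@str_inj _ _ _ Qh RH Qh); apply: (@Ahom_gen (tens_module RH Qh)) => q.
have -> : str Qh RH Qh (coact end_Loewy (PsiB c)) = Ahom_comp (hm_co Qh) (Psi c).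
  exact: (coactBE A_simple).
rewrite [LHS]comp_lfunE PsiE (ge_co ge) -[X in tmap _ _ X](comp_lfunE).
rewrite -[(_ \o _)%VF]/(vsval (Ahom_comp (hm_co Q) (phi c))).
rewrite phi_co; elim/tens_ind: (coact C c) => [|h x t IH]; first by rewrite !linear0 !zero_lfunE linear0.
rewrite !linearD /= !add_lfunE linearD /= IH; congr (_ + _); rewrite !tmapE id_lfunE.
have -> : vsval (str Q (reg_module H0) Q (h \ox phi x)) q =
    tmap (amulr h) (vsval (phi x)) (co0 q).
  by rewrite -ev_reg; apply: (@strEq _ _ _ Q (reg_module H0) Q).
have -> : vsval (str Qh RH Qh (iH h \ox PsiB x)) (inc q) =
    tmap (amulr (iH h)) (vsval (Psi x)) (tmap iH inc (co0 q)).
  by rewrite -(ge_co ge) -ev_reg; apply: (@strEq _ _ _ Qh RH Qh).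
elim/tens_ind: (co0 q) => [|y z s IHs]; first by rewrite !linear0.
rewrite !linearD /= IHs; congr (_ + _); rewrite !tmapE PsiE !amulrE.
by rewrite -incl0M.
Qed.

End InducedAlgebra.

Theorem theorem1p2 (k : closedFieldType) (char0 : [pchar k] =i pred0)
    (H : coradGradedHopf k)
    (X0 : comodAlgebra (coradical_part H) -> Prop)
    (X0_complete : complete_AM_representatives X0)
    (A : LoewyGraded H) (A_exact : AM_exact A) :
  exists2 B : LoewyGraded H, Loewy_over X0 B & equivariant_Morita A B.
Proof.
have [A_simple A_dim] := A_exact; have [_ complete] := X0_complete.
have A0_simple := comod_deg0_right_simple A_simple.
have [C XC [F F_eq]] := complete (comod_modules (comod_deg0 A))
  (comod_modules_finite _) (comod_modules_exact A0_simple)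
  (comod_modules_indecomposable (comod_deg0_coinvariants A_dim)).
have [Q [phi [phi_bij phi1 phiM phi_co]]] := transport_algebra F_eq.
have [[Agr _ _] [[Hgr _ _] _ _ _]] := (Loewy_grading_alg (lg_grading A), cgh_graded H).
have [pH [NH [gpH pHG]]] := grading_gproj Hgr.
have [pA [NA [gpA pAG]]] := grading_gproj Agr.
have [Qh [inc [pQ [N ge]]]] := graded_extension_exists gpH pHG gpA pAG Q.
(* The module $Q$ is nonzero because $\phi$ is injective and $1\neq0$ in $C$. *)
have [x x_nz] : exists x : Q, x != 0.
  have id_nz : Ahom_id Q != 0.
    by rewrite -phi1 -(linear0 phi) (inj_eq (bij_inj phi_bij)) oner_eq0.
  have /lfunPn[x] : vsval (Ahom_id Q) != 0 by [].
  by rewrite id_lfunE zero_lfunE => x_nz; exists x.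
have Qh_gt0 : (0 < dimT Qh)%N.
  apply: (dimT_gt0 (v := inc x)); apply: contra x_nz => /eqP e; apply/eqP.
  by apply: (ge_inj ge); rewrite e linear0.
exists (end_Loewy gpH pHG gpA pAG ge A_simple Qh_gt0).
  by exists C => //; apply: end_deg0_iso phi_bij phi1 phiM phi_co.
exact: end_comod_Morita.
Qed.
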